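(* Let $U$ be a real Banach space with dual $U^\ast$ and closed unit ball $B_U$, and let $h:\mathbb{R}\to\mathbb{R}$ be a truncation function. Let $\nu$ be a cylindrical Lévy measure on $\mathcal{Z}(U)$ which extends to a $\sigma$-finite measure on $\mathcal{B}(U)$, again denoted by $\nu$, with $\nu(B_U^c)<\infty$. Then there exists a regularly continuous infinitely divisible cylindrical probability measure $\mu$ on $\mathcal{Z}(U)$ with cylindrical characteristics $(d_\nu,0,\nu)_h$, where $$d_\nu:U^\ast\to\mathbb{R},\qquad d_\nu(a):=\int_U\big(h(\langle u,a\rangle)-\langle u,a\rangle\mathbf{1}_{B_U}(u)\big)\,\nu(du).$$
   Context: $\langle u,a\rangle$ is the dual pairing of $u\in U$, $a\in U^\ast$; $B_U=\{u\in U:\|u\|\le1\}$. For $a_1,\dots,a_n\in U^\ast$ let $\pi_{a_1,\dots,a_n}:U\to\mathbb{R}^n$, $\pi_{a_1,\dots,a_n}(u)=(\langle u,a_1\rangle,\dots,\langle u,a_n\rangle)$. For $\Gamma\subseteq U^\ast$, $\mathcal{Z}(U,\Gamma)$ is the algebra of cylindrical sets $\pi_{a_1,\dots,a_n}^{-1}(B)$ with $n\in\mathbb{N}$, $a_1,\dots,a_n\in\Gamma$, $B\in\mathcal{B}(\mathbb{R}^n)$; $\mathcal{C}(U,\Gamma)$ is the $\sigma$-algebra it generates; $\mathcal{Z}(U):=\mathcal{Z}(U,U^\ast)$. A cylindrical measure is a function $\mu:\mathcal{Z}(U)\to[0,\infty]$ whose restriction to $\mathcal{C}(U,\Gamma)$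 is a measure for every finite $\Gamma\subseteq U^\ast$; it is a cylindrical probability measure if $\mu(U)=1$. The characteristic function is $\varphi_\mu(a)=\int_U e^{i\langle u,a\rangle}\mu(du)$, $a\in U^\ast$. The convolution of cylindrical probability measures is defined by convolving all image measures under the maps $\pi_{a_1,\dots,a_n}$; $\mu$ is infinitely divisible if for each $k\in\mathbb{N}$ there is a cylindrical probability measure $\mu_k$ with $\mu=(\mu_k)^{\ast k}$. A truncation function is a bounded measurable $h:\mathbb{R}\to\mathbb{R}$ with $h(s)=s$ for all $s$ in a neighbourhood of $0$. Put $\psi_h(t):=e^{it}-1-ih(t)$. A cylindrical Lévy measure is a cylindrical measure $\nu:\mathcal{Z}(U)\to[0,\infty]$ such that $\nu\circ a^{-1}$ is a Lévy measure on $\mathcal{B}(\mathbb{R})$ for all $a\in U^\ast$, i.e. $\int_{\mathbb{R}}(|s|^2\wedge1)\,(\nu\circ a^{-1})(ds)<\infty$. Any mass of the image measures $\nu\circ\pi_{a_1,\dots,a_n}^{-1}$ at the origin is disregarded (all integrands considered vanish there). Cylindrical characteristics: an infinitely divisible cylindrical probability measure $\mu$ has cylindrical characteristics $(p,q,\nu)_h$ if $p:U^\ast\to\mathbb{R}$ is a function, $q:U^\ast\to\mathbb{R}$ is a non-negative quadratic form, $\nu$ is a cylindrical measure such that $\nu\circ\pi_{a_1,\dots,a_n}^{-1}$ is (off the origin) the Lévy measure of $\mu\circ\pi_{a_1,\dots,a_n}^{-1}$ for all $a_1,\dots,a_n\in U^\ast$, $n\in\mathbb{N}$, and $$\varphi_\mu(a)=\exp\Big(ip(a)-\tfrac12q(a)+\int_U\psi_h(\langle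 u,a\rangle)\,\nu(du)\Big)\quad\text{for all }a\in U^\ast,$$ where the exponent is the distinguished logarithm of $\varphi_\mu$ (the unique $\Psi:U^\ast\to\mathbb{C}$ with $\exp\Psi=\varphi_\mu$, $\Psi(0)=0$ and $t\mapsto\Psi(ta)$ continuous on $\mathbb{R}$ for every $a$). A cylindrical probability measure $\mu$ is continuous if for each $\varepsilon>0$ there is a neighbourhood $N$ of $0$ in $(U^\ast,\|\cdot\|_{U^\ast})$ with $\mu(\{u\in U:|\langle u,a\rangle|\ge1\})\le\varepsilon$ for all $a\in N$. An infinitely divisible cylindrical probability measure with cylindrical characteristics $(p,q,\nu)_h$ is regularly continuous if the infinitely divisible cylindrical probability measures with cylindrical characteristics $(0,q,0)_h$ and $(p,0,\nu)_h$ are both continuous. *)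

(* Defs.v *)
From HB Require Import structures.
From mathcomp Require Import all_boot all_order all_algebra.
From mathcomp Require Import all_classical all_reals all_analysis.
From mathcomp.real_closed Require Import complex.

Set Implicit Arguments.
Unset Strict Implicit.
Unset Printing Implicit Defensive.

Import Order.TTheory GRing.Theory Num.Theory.
Import numFieldNormedType.Exports.

Local Open Scope classical_set_scope.
Local Open Scope ring_scope.

(** * The topological dual with the operator norm *)

Section dual.
Context {R : realType} (U : normedModType R).

Definition dual_pred : {pred U -> R^o} :=
  [pred f : U -> R^o | `[< linear f /\ continuous f >]].

Lemma dual_predP (f : U -> R^o) :
  reflect (linear f /\ continuous f) (f \in dual_pred).
Proof. exact: asboolP. Qed.

Lemma dual_submod_closed : submod_closed dual_pred.
Proof.
split.
  apply/dual_predP; split; first by move=> k x y; rewrite scaler0 addr0.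
  exact: cst_continuous.
move=> k f g /dual_predP[lf cf] /dual_predP[lg cg]; apply/dual_predP; split.
  move=> c x y; rewrite /= !fctE /= lf lg !scalerDr addrACA.
  by rewrite scalerA mulrC -scalerA.
move=> x; apply: cvgD; last exact: cg.
by apply: cvgZl_tmp; exact: cf.
Qed.

HB.instance Definition _ :=
  GRing.isSubmodClosed.Build R (U -> R^o) dual_pred dual_submod_closed.

Record dual := Dual { dual_fun :> U -> R^o ; dual_funP : dual_fun \in dual_pred }.

HB.instance Definition _ := [isSub for dual_fun].
HB.instance Definition _ := [Choice of dual by <:].
HB.instance Definition _ := [SubChoice_isSubLmodule of dual by <:].

Lemma dual_linear (a : dual) : linear a.
Proof. by have /dual_predP[] := dual_funP a. Qed.

Lemma dual_continuous (a : dual) : continuous a.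
Proof. by have /dual_predP[] := dual_funP a. Qed.

HB.instance Definition _ (a : dual) :=
  GRing.isLinear.Build R U R^o *:%R (dual_fun a) (dual_linear a).

Definition dual_norm (a : dual) : R :=
  sup [set `|a u| | u in [set u : U | `|u| <= 1]].

Lemma dual_has_sup (a : dual) :
  has_sup [set `|a u| | u in [set u : U | `|u| <= 1]].
Proof.
split; first by exists `|a 0|, 0 => //=; rewrite normr0 ler01.
have /linear_boundedP/pinfty_ex_gt0[r r0 ar] :=
  continuous_linear_bounded (0 : U) (@dual_continuous a 0).
exists r => _ [u /= u1 <-].
by rewrite (le_trans (ar u))// ler_piMr// ltW.
Qed.

Lemma dual_normP (a : dual) (u : U) : `|u| <= 1 -> `|a u| <= dual_norm a.
Proof. by move=> u1; apply: sup_upper_bound (dual_has_sup a) _ _; exists u. Qed.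

Lemma dual_norm_le (a : dual) (M : R) :
  (forall u : U, `|u| <= 1 -> `|a u| <= M) -> dual_norm a <= M.
Proof.
move=> aM; apply: ge_sup; first by case: (dual_has_sup a).
by move=> _ [u u1 <-]; exact: aM.
Qed.

Lemma dual_norm_ge0 (a : dual) : 0 <= dual_norm a.
Proof. by rewrite (le_trans _ (@dual_normP a 0 _))// normr0 ler01. Qed.

Lemma ler_dual_normD (a b : dual) :
  dual_norm (a + b) <= dual_norm a + dual_norm b.
Proof.
apply: dual_norm_le => u u1.
by rewrite (le_trans (ler_normD _ _))// lerD// dual_normP.
Qed.

Lemma ler_dual_normZ (k : R) (a : dual) :
  dual_norm (k *: a) <= `|k| * dual_norm a.
Proof.
apply: dual_norm_le => u u1.
by rewrite (_ : (k *: a) u = k * a u)// normrM ler_wpM2l// dual_normP.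
Qed.

Lemma dual_normZ (k : R) (a : dual) : dual_norm (k *: a) = `|k| * dual_norm a.
Proof.
apply/eqP; rewrite eq_le ler_dual_normZ /=.
have [->|k0] := eqVneq k 0; first by rewrite normr0 mul0r dual_norm_ge0.
rewrite -ler_pdivlMl ?normr_gt0// -normfV.
by rewrite -[X in dual_norm X <= _](scalerK k0) ler_dual_normZ.
Qed.

Lemma dual_norm0_eq0 (a : dual) : dual_norm a = 0 -> a = 0.
Proof.
move=> a0; apply/val_inj/funext => u.
suff : a u = 0 by [].
have [->|u0] := eqVneq u 0; first exact: linear0.
have nu : `|u| != 0 by rewrite normr_eq0.
rewrite -[u](scalerKV nu) linearZ /=.
have : `|a (`|u|^-1 *: u)| <= 0.
  rewrite -a0 dual_normP// normrZ ger0_norm ?invr_ge0// mulVf//.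
by rewrite normr_le0 => /eqP ->; rewrite scaler0.
Qed.

HB.instance Definition _ := Lmodule_isNormed.Build R dual
  ler_dual_normD dual_normZ dual_norm0_eq0.

End dual.

(** * Complex-valued integrals *)

Section complex_valued.
Context {R : realType}.
Local Open Scope complex_scope.

Definition cexp (z : R[i]) : R[i] :=
  (expR (complex.Re z))%:C * (cos (complex.Im z) +i* sin (complex.Im z)).

(* The value is meaningful when the real and imaginary parts are integrable. *)
Definition cintegral d (T : measurableType d) (mu : set T -> \bar R)
    (f : T -> R[i]) : R[i] :=
  fine (\int[mu]_x (complex.Re (f x))%:E) +i* fine (\int[mu]_x (complex.Im (f x))%:E).

Definition truncation_function (h : R -> R) : Prop :=
  [/\ exists M : R, forall s, `|h s| <= M,
      measurable_fun setT h
    & \forall s \near 0, h s = s].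

Definition psi_trunc (h : R -> R) (t : R) : R[i] :=
  cexp ('i%C * t%:C) - 1 - 'i%C * (h t)%:C.

End complex_valued.

(** * Measures on R^n

    The Borel sigma-algebra of R^n is the canonical sigma-algebra of
    [n.-tuple R]. *)

Section finite_dimension.
Context {R : realType} {n : nat}.
Implicit Types (x y t : n.-tuple R) (m : set (n.-tuple R) -> \bar R).
Local Open Scope complex_scope.

Definition tzero : n.-tuple R := [tuple 0 | _ < n].

Definition tadd x y : n.-tuple R := [tuple tnth x i + tnth y i | i < n].

Definition tdot x y : R := \sum_(i < n) tnth x i * tnth y i.

Definition tnorm x : R := Num.sqrt (tdot x x).

Definition convolution m1 m2 (B : set (n.-tuple R)) : \bar R :=
  \int[m1]_x m2 [set y | B (tadd x y)].

Definition convolution_power m (k : nat) : set (n.-tuple R) -> \bar R :=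
  iter k (convolution m) (dirac tzero).

(* [lam] is the Levy measure in the Levy-Khintchine formula for the probability
   measure [m]; it does not depend on the truncation function used, here
   x 1_{|x| <= 1}. *)
Definition Levy_measure_of m (lam : {measure set (n.-tuple R) -> \bar R}) :=
  [/\ lam [set tzero] = 0%E,
      (\int[lam]_x (Num.min (tnorm x ^+ 2) 1)%:E < +oo)%E
    & exists (b : n.-tuple R) (Q : 'M[R]_n),
      [/\ Q^T = Q,
          forall t, 0 <= \sum_(i < n) \sum_(j < n) tnth t i * Q i j * tnth t j
        & forall t, cintegral m (fun x => cexp ('i%C * (tdot t x)%:C)) =
            cexp ('i%C * (tdot t b)%:C
              - (2^-1 * \sum_(i < n) \sum_(j < n)
                   tnth t i * Q i j * tnth t j)%:C
              + cintegral lam (fun x =>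
                  cexp ('i%C * (tdot t x)%:C) - 1
                  - 'i%C * (tdot t x * \1_[set x | tnorm x <= 1] x)%:C))]].

End finite_dimension.

(** * Cylindrical measures

    A set function on the cylindrical algebra Z(U) is represented by a total
    function on [set U], whose values outside Z(U) are irrelevant. *)

Section cylindrical.
Context {R : realType} {U : normedModType R}.
Implicit Types (mu nu : set U -> \bar R) (a : dual U).
Local Open Scope complex_scope.

Definition cyl_proj n (a : n.-tuple (dual U)) (u : U) : n.-tuple R :=
  [tuple tnth a i u | i < n].

Definition cylinders (Gamma : set (dual U)) : set (set U) :=
  [set A | exists n (a : n.-tuple (dual U)) (B : set (n.-tuple R)),
    [/\ forall i, Gamma (tnth a i), measurable B & A = cyl_proj a @^-1` B]].

Definition cylindrical_measure mu : Prop :=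
  forall Gamma : set (dual U), finite_set Gamma ->
    exists m : {measure set (g_sigma_algebraType (cylinders Gamma)) -> \bar R},
      forall A, <<s cylinders Gamma >> A -> mu A = m A.

Definition cylindrical_probability mu : Prop :=
  cylindrical_measure mu /\ mu setT = 1%E.

Definition cyl_image1 mu a : set R -> \bar R := fun B => mu (a @^-1` B).

Definition cyl_image mu n (a : n.-tuple (dual U)) : set (n.-tuple R) -> \bar R :=
  fun B => mu (cyl_proj a @^-1` B).

(* int_U f(<u, a>) mu(du), taken with respect to the measure to which [mu]
   restricts on the sigma-algebra C(U, {a}). *)
Definition cyl_cintegral mu a (f : R -> R[i]) : R[i] :=
  @cintegral R _ (g_sigma_algebraType (cylinders [set a])) mu (fun u => f (a u)).

Definition char_fun mu a : R[i] := cyl_cintegral mu a (fun s => cexp ('i%C * s%:C)).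

Definition infinitely_divisible mu : Prop :=
  forall k : nat, (0 < k)%N -> exists mu_k : set U -> \bar R,
    cylindrical_probability mu_k /\
    forall n (a : n.-tuple (dual U)) (B : set (n.-tuple R)), measurable B ->
      cyl_image mu a B = convolution_power (cyl_image mu_k a) k B.

Definition cylindrical_Levy_measure nu : Prop :=
  cylindrical_measure nu /\
  forall a, (\int[cyl_image1 nu a]_s (Num.min (`|s| ^+ 2) 1)%:E < +oo)%E.

Definition nonneg_quadratic_form (q : dual U -> R) : Prop :=
  (forall a, 0 <= q a) /\
  exists b : dual U -> dual U -> R,
    [/\ forall a, scalar (b a), forall a c, b a c = b c a
      & forall a, q a = b a a].

Definition char_exponent (h : R -> R) (p q : dual U -> R) nu a : R[i] :=
  'i%C * (p a)%:C - (2^-1 * q a)%:C + cyl_cintegral nu a (psi_trunc h).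

Definition distinguished_log (phi Psi : dual U -> R[i]) : Prop :=
  [/\ forall a, cexp (Psi a) = phi a,
      Psi 0 = 0,
      forall a, continuous (fun t : R => complex.Re (Psi (t *: a)))
    & forall a, continuous (fun t : R => complex.Im (Psi (t *: a)))].

Definition has_characteristics (h : R -> R) (p q : dual U -> R) nu mu : Prop :=
  [/\ cylindrical_probability mu /\ infinitely_divisible mu,
      nonneg_quadratic_form q,
      cylindrical_measure nu,
      forall n (a : n.-tuple (dual U)),
        exists lam : {measure set (n.-tuple R) -> \bar R},
          Levy_measure_of (cyl_image mu a) lam /\
          forall B, measurable B -> lam B = cyl_image nu a (B `\ tzero)
    & distinguished_log (char_fun mu) (char_exponent h p q nu)].

Definition cylindrical_continuous mu : Prop :=
  forall e : R, 0 < e ->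
    \forall a \near (0 : dual U), (mu [set u | (1 <= `|(a : dual U) u|)%R] <= e%:E)%E.

Definition regularly_continuous (h : R -> R) (p q : dual U -> R) nu mu : Prop :=
  [/\ has_characteristics h p q nu mu,
      exists2 mu1, has_characteristics h (cst 0) q (cst 0%E) mu1
                 & cylindrical_continuous mu1
    & exists2 mu2, has_characteristics h p (cst 0) nu mu2
                 & cylindrical_continuous mu2].

End cylindrical.

(** * The Borel sigma-algebra *)

Section borel.
Context {R : realType} {U : normedModType R}.

Definition borelType := g_sigma_algebraType (@open U).

Definition unit_ball : set U := [set u | `|u| <= 1].

(* [nu] is the extension to B(U). *)
Definition drift (h : R -> R) (nu : {measure set borelType -> \bar R})
    (a : dual U) : R :=
  \int[nu]_u (h (a u) - a u * \1_unit_ball u).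

End borel.
Arguments borelType {R} U.
Arguments unit_ball {R} U.

(* Main.v *)
(* For a function a on U whose square is nu-integrable on the ball, let X(a) be
   the compensated Poisson integral of a: split U into countably many pieces of
   finite measure, sum the centred compound Poisson variables they carry, and
   pass to the limit in L^1, with second moments read off the characteristic
   functions. X is almost surely linear, and E exp(i X(a)) is the exponential of
   the integral of exp(i a) - 1 - i a 1_B. A finite family of dual elements
   satisfies only finitely many independent linear relations, so the law of X
   descends to a cylindrical probability measure mu; mu is infinitely divisible
   because nu / k gives a k-th convolution root, and the drift d_nu is what turns
   the compensator a 1_B into h(a). For continuity, only jumps outside the ball
   and the square function a |-> int_B a^2 dnu matter; the latter is lower
   semicontinuous and finite on the Banach space U*, hence continuous at 0 by
   Baire's theorem. The pair (0, q) = (0, 0) is the case nu = 0. *)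

Require Import Defs.
From HB Require Import structures.
From mathcomp Require Import all_boot all_order all_algebra.
From mathcomp Require Import all_classical all_reals all_analysis.
From mathcomp Require Import measurable_realfun.
From mathcomp Require Import ring lra.
From mathcomp.real_closed Require Import complex.

Set Implicit Arguments.
Unset Strict Implicit.
Unset Printing Implicit Defensive.

Import Order.TTheory GRing.Theory Num.Theory.
Import numFieldNormedType.Exports.

Local Open Scope classical_set_scope.
Local Open Scope ring_scope.

(** * Countable products of probability measures *)

Section sequence_space.
Context d (T : measurableType d).

Definition coordinate_sets : set (set (nat -> T)) :=
  [set A | exists k (B : set T), measurable B /\ A = [set w | B (w k)]].

Definition seqspace : Type := g_sigma_algebraType coordinate_sets.

HB.instance Definition _ := Measurable.copy seqspace
  (g_sigma_algebraType coordinate_sets).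

Lemma measurable_coord k : measurable_fun setT (fun w : seqspace => w k).
Proof.
move=> _ B mB; rewrite setTI; apply: sub_sigma_algebra.
by exists k, B.
Qed.

Lemma measurable_fun_seqspace d' (T' : measurableType d') (f : T' -> seqspace) :
  (forall k, measurable_fun setT (fun x => f x k)) -> measurable_fun setT f.
Proof.
move=> mf; apply: (@measurability _ _ _ seqspace setT f coordinate_sets erefl).
move=> _ [_ [k [B [mB ->]]] <-].
exact: mf k measurableT B mB.
Qed.

Definition upd (k : nat) (x : T) (w : nat -> T) : seqspace :=
  fun i => if i == k then x else w i.

Lemma measurable_upd k :
  measurable_fun setT (fun p : seqspace * T => upd k p.2 p.1).
Proof.
apply: measurable_fun_seqspace => i; rewrite /upd; case: eqP => _.
  exact: measurable_snd.
exact: measurableT_comp (measurable_coord i) measurable_fst.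
Qed.

Lemma measurable_upd1 k w : measurable_fun setT (fun x : T => upd k x w).
Proof.
apply: measurable_fun_seqspace => i; rewrite /upd; case: eqP => _ //.
Qed.

Definition depends_below (K : nat) V (f : seqspace -> V) :=
  forall w w' : seqspace, (forall i, (i < K)%N -> w i = w' i) -> f w = f w'.

Lemma depends_belowW K K' V (f : seqspace -> V) :
  (K <= K')%N -> depends_below K f -> depends_below K' f.
Proof.
by move=> KK df w w' ww'; apply: df => i iK; apply: ww'; exact: leq_trans KK.
Qed.

Lemma upd_depends K V (f : seqspace -> V) k x w :
  (K <= k)%N -> depends_below K f -> f (upd k x w) = f w.
Proof.
move=> Kk; apply => i iK; rewrite /upd ifN// ltn_eqF//.
exact: leq_trans Kk.
Qed.

End sequence_space.

Section iterated_integral.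
Context d (T : measurableType d) (R : realType) (P : nat -> probability T R).
Local Open Scope ereal_scope.
Implicit Types f g : seqspace T -> \bar R.

Definition int_coord k f : seqspace T -> \bar R :=
  fun w => \int[P k]_x f (upd k x w).

Definition nnmeas f := measurable_fun setT f /\ forall w, 0 <= f w.

Lemma nnmeas_upd k f w : nnmeas f ->
  measurable_fun setT (fun x => f (upd k x w)) /\ forall x, 0 <= f (upd k x w).
Proof.
by move=> [mf f0]; split => //; exact: measurableT_comp mf (measurable_upd1 _ _).
Qed.

Lemma nnmeas_int_coord k f : nnmeas f -> nnmeas (int_coord k f).
Proof.
move=> [mf f0]; split; last by move=> w; exact: integral_ge0.
apply: (@measurable_fun_fubini_tonelli_F _ _ _ _ _ (P k)
  (fun p : seqspace T * T => f (upd k p.2 p.1))) => //.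
exact: measurableT_comp mf (measurable_upd _).
Qed.

Fixpoint iter_int j m f : seqspace T -> \bar R :=
  if m is m'.+1 then int_coord j (iter_int j.+1 m' f) else f.

Lemma nnmeas_iter_int j m f : nnmeas f -> nnmeas (iter_int j m f).
Proof.
by elim: m j => [|m IH] j //= nf; apply: nnmeas_int_coord; exact: IH.
Qed.

Lemma int_coord_depends K k f : (K <= k)%N ->
  depends_below K f -> int_coord k f = f.
Proof.
move=> Kk df; apply/funext => w; rewrite /int_coord.
under eq_integral do rewrite (upd_depends _ _ Kk df).
by rewrite integral_cst// [X in _ * X]probability_setT mule1.
Qed.

Lemma depends_int_coord k f : depends_below k.+1 f ->
  depends_below k (int_coord k f).
Proof.
move=> df w w' ww'; apply: eq_integral => x _; apply: df => i.
by rewrite ltnS leq_eqVlt /upd => /predU1P[->|ik]; [rewrite eqxx|rewrite ww'].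
Qed.

Lemma iter_intSr j m f : iter_int j m.+1 f = iter_int j m (int_coord (j + m) f).
Proof.
elim: m j => [|m IH] j; first by rewrite addn0.
by rewrite -[LHS]/(int_coord j (iter_int j.+1 m.+1 f)) IH addSnnS.
Qed.

Lemma iter_int_depends K j m f : (K <= j)%N ->
  depends_below K f -> iter_int j m f = f.
Proof.
move=> Kj df; elim: m j Kj => //= m IH j Kj.
by rewrite IH ?(leq_trans Kj)// (int_coord_depends _ df).
Qed.

Lemma iter_int_stable K j m m' f : depends_below K f ->
  (K <= j + m)%N -> (m <= m')%N -> iter_int j m' f = iter_int j m f.
Proof.
move=> df Kjm /subnK <-; elim: (m' - m)%N => // n IH.
rewrite addSn iter_intSr (int_coord_depends _ df)//.
by rewrite (leq_trans Kjm)// leq_add2l leq_addl.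
Qed.

Lemma depends_iter_int j m f : depends_below (j + m) f ->
  depends_below j (iter_int j m f).
Proof.
elim: m j => [|m IH] j /=; first by rewrite addn0.
by rewrite addnS -addSn => /IH; exact: depends_int_coord.
Qed.

Lemma le_iter_int j m f g : nnmeas f -> nnmeas g -> (forall w, f w <= g w) ->
  forall w, iter_int j m f w <= iter_int j m g w.
Proof.
move=> nf ng fg; elim: m j => [|m IH] j w //=.
have [mf f0] := nnmeas_upd j w (nnmeas_iter_int j.+1 m nf).
have [mg g0] := nnmeas_upd j w (nnmeas_iter_int j.+1 m ng).
by apply: ge0_le_integral => //= x _; exact: IH.
Qed.

Lemma iter_intD j m f g : nnmeas f -> nnmeas g ->
  iter_int j m (f \+ g) = iter_int j m f \+ iter_int j m g.
Proof.
move=> nf ng; elim: m j => [|m IH] j //=; rewrite IH; apply/funext => w.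
have [mf f0] := nnmeas_upd j w (nnmeas_iter_int j.+1 m nf).
have [mg g0] := nnmeas_upd j w (nnmeas_iter_int j.+1 m ng).
by rewrite /int_coord /= ge0_integralD.
Qed.

Lemma iter_intZ j m f (k : R) : (0 <= k)%R -> nnmeas f ->
  iter_int j m (fun w => k%:E * f w) = fun w => k%:E * iter_int j m f w.
Proof.
move=> k0 nf; elim: m j => [|m IH] j //=; rewrite IH; apply/funext => w.
have [mf f0] := nnmeas_upd j w (nnmeas_iter_int j.+1 m nf).
by rewrite /int_coord /= ge0_integralZl_EFin.
Qed.

Lemma nnmeas_cst (r : R) : (0 <= r)%R -> nnmeas (cst r%:E).
Proof. by []. Qed.

Lemma iter_int_cst j m r : iter_int j m (cst r) = cst r.
Proof. exact: (@iter_int_depends 0). Qed.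

End iterated_integral.

Section product_compactness.
Context d (T : measurableType d) (R : realType) (P : nat -> probability T R).
Local Open Scope ereal_scope.
Implicit Types A B : set (seqspace T).

Definition ind A : seqspace T -> \bar R := fun w => (\1_A w)%:E.

Lemma nnmeas_ind A : measurable A -> nnmeas (ind A).
Proof.
move=> mA; split; last by move=> w; rewrite lee_fin.
exact/measurable_EFinP/measurable_indic.
Qed.

Definition level K A := measurable A /\ depends_below K A.

Lemma depends_ind K A : depends_below K A -> depends_below K (ind A).
Proof.
move=> dA w w' ww'; congr (_%:E); rewrite !indicE.
by congr ((_ : bool)%:R); apply/idP/idP; rewrite !inE (dA _ _ ww').
Qed.

Section nested.
Variables (B : nat -> set (seqspace T)) (K : nat -> nat).
Hypothesis levB : forall n, level (K n) (B n).
Hypothesis decB : forall n, B n.+1 `<=` B n.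

Let G j n := iter_int P j (K n) (ind (B n)).

Let nnG j n : nnmeas (G j n).
Proof. by apply/nnmeas_iter_int/nnmeas_ind; case: (levB n). Qed.

Let GE j n m : (K n <= j + m)%N -> iter_int P j m (ind (B n)) = G j n.
Proof.
move=> Knm; have dB := depends_ind (levB n).2.
case: (leqP (K n) m) => Km.
  by rewrite /G -(iter_int_stable _ dB (leq_addl _ _) Km).
by rewrite /G -(iter_int_stable _ dB Knm (ltnW Km)).
Qed.

Let GS j n : G j n = int_coord P j (G j.+1 n).
Proof.
have := @GE j n (K n).+1; rewrite addnS => <- //.
by rewrite leqW// leq_addl.
Qed.

Let G_le1 j n w : G j n w <= 1.
Proof.
rewrite -[leRHS]/(cst 1 w) -(iter_int_cst P j (K n)).
have mB := (levB n).1.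
apply: le_iter_int; [exact: nnmeas_ind|exact: nnmeas_cst|].
by move=> v; rewrite lee_fin indicE -[leRHS]/(1%:R) ler_nat leq_b1.
Qed.

Let G_dec j w n m : (n <= m)%N -> G j m w <= G j n w.
Proof.
elim: m => [|m IH]; first by rewrite leqn0 => /eqP ->.
rewrite leq_eqVlt => /predU1P[->//|]; rewrite ltnS => /IH; apply: le_trans.
have mB := (levB m).1; have mB1 := (levB m.+1).1.
pose M := maxn (K m) (K m.+1).
rewrite -(@GE j m M) ?(leq_trans (leq_maxl _ _) (leq_addl _ _))//.
rewrite -(@GE j m.+1 M) ?(leq_trans (leq_maxr _ _) (leq_addl _ _))//.
apply: le_iter_int; [exact: nnmeas_ind|exact: nnmeas_ind|move=> v].
rewrite lee_fin !indicE ler_nat; case: (boolP (v \in B m.+1)) => //.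
by rewrite inE => /decB Bmv; rewrite mem_set.
Qed.

Let bounded_below j w := exists2 e : R, (0 < e)%R & forall n, e%:E <= G j n w.

Let extend j w : bounded_below j w -> exists x, bounded_below j.+1 (upd j x w).
Proof.
move=> [e e0 eG]; apply: contrapT => /forallNP noG.
pose phi n x := G j.+1 n (upd j x w).
have mphi n : measurable_fun setT (phi n) by exact: (nnmeas_upd j w (nnG j.+1 n)).1.
have phi0 n x : 0 <= phi n x by exact: (nnmeas_upd j w (nnG j.+1 n)).2.
pose S n := [set x | phi n x < (e / 2)%:E].
have mS n : measurable (S n).
  by rewrite -[S n]setTI; exact: emeasurable_fun_infty_o.
have ndS : nondecreasing_seq S.
  move=> n m nm; apply/subsetPset => x /=; apply: le_lt_trans.
  exact: G_dec.
have ST : \bigcup_n S n = setT.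
  apply/seteqP; split=> // x _; apply: contrapT => /forall2NP nS.
  apply: (noG x); exists (e / 2)%R; first by rewrite divr_gt0.
  move=> n; case: (nS n) => nSn; first by case: nSn.
  by rewrite leNgt; apply/negP.
have PS : P j (S n) @[n --> \oo] --> 1%E.
  rewrite -(@probability_setT _ _ _ (P j)) -ST.
  by apply: nondecreasing_cvg_mu => //; rewrite ST; exact: measurableT.
have [n] : exists n, (1 - e / 2)%:E < P j (S n).
  have : \forall n \near \oo, (1 - e / 2)%:E < P j (S n).
    apply: (PS [set y | (1 - e / 2)%:E < y]); apply: open_ereal_gt'.
    by rewrite lte_fin ltrBlDr ltrDl divr_gt0.
  by case=> N _ /(_ N (leqnn _)) ?; exists N.
apply/negP; rewrite -leNgt.
have PSfin : P j (S n) \is a fin_num by exact: fin_num_measure.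
have : e%:E <= \int[P j]_x ((e / 2)%:E + (\1_(~` S n) x)%:E).
  apply: le_trans (eG n) _; rewrite GS; apply: ge0_le_integral => //=.
  - by move=> x _; exact: phi0.
  - exact: mphi.
  - apply: emeasurable_funD => //.
    by apply/measurable_EFinP/measurable_indic; exact: measurableC.
  - move=> x _; rewrite -/(phi n x) indicE.
    case: (boolP (x \in ~` S n)) => /=.
      move=> _; apply: le_trans (G_le1 _ _ _) _.
      by rewrite -EFinD lee_fin lerDr divr_ge0// ltW.
    rewrite notin_setE /= adde0 => /contrapT; exact: ltW.
rewrite ge0_integralD//=; last 2 first.
- by move=> x _; rewrite lee_fin divr_ge0// ltW.
- by apply/measurable_EFinP/measurable_indic; exact: measurableC.
rewrite integral_cst// [X in _ * X]probability_setT mule1.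
rewrite integral_indic ?setIT//; last exact: measurableC.
rewrite [X in _ + X](_ : _ = 1 - P j (S n)); last exact: probability_setC.
move: (P j (S n)) PSfin => [p| |]// _.
rewrite -EFinB -EFinD !lee_fin.
by move=> ?; lra.
Qed.

Lemma nested_level_sets w0 :
  (exists2 e : R, (0 < e)%R & forall n, e%:E <= iter_int P 0 (K n) (ind (B n)) w0) ->
  \bigcap_n B n !=set0.
Proof.
move=> b0.
pose next j w := xget point [set x | bounded_below j.+1 (upd j x w)].
pose st := fix st j := if j is j'.+1 then upd j' (next j' (st j')) (st j')
  else (w0 : seqspace T).
have bst j : bounded_below j (st j).
  elim: j => [//|j IH] /=; rewrite /next.
  by have [x bx] := extend IH; case: xgetP => [y _ by_|/(_ x)].
pose v : seqspace T := fun k => st k.+1 k.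
have stv j k : (k < j)%N -> st j k = v k.
  elim: j => // j IH; rewrite ltnS leq_eqVlt => /predU1P[->//|kj].
  by rewrite -IH//= /upd ltn_eqF.
exists v => n _.
have [e e0 /(_ n)] := bst (K n).
have [mB dB] := levB n.
rewrite /G (iter_int_depends _ _ (leqnn _) (depends_ind dB)).
rewrite (depends_ind dB (w' := v)); last exact: stv.
rewrite /ind indicE lee_fin; case: (boolP (v \in B n)).
  by rewrite inE.
by move=> _; rewrite leNgt e0.
Qed.

End nested.
End product_compactness.

Section level_algebra.
Context d (T : measurableType d).

Lemma level_coord k (B : set T) : measurable B ->
  level k.+1 [set w : seqspace T | B (w k)].
Proof.
move=> mB; split; last by move=> w w' /(_ k (ltnSn k)) /= ->.
by rewrite -[X in measurable X]setTI; exact: measurable_coord.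
Qed.

Lemma levelW K K' (A : set (seqspace T)) :
  (K <= K')%N -> level K A -> level K' A.
Proof. by move=> KK [mA dA]; split => //; exact: depends_belowW dA. Qed.

Lemma levelD K (A B : set (seqspace T)) :
  level K A -> level K B -> level K (A `\` B).
Proof.
move=> [mA dA] [mB dB]; split; first exact: measurableD.
by move=> w w' ww'; rewrite /= /setD /= (dA _ _ ww') (dB _ _ ww').
Qed.

Lemma levelU K (A B : set (seqspace T)) :
  level K A -> level K B -> level K (A `|` B).
Proof.
move=> [mA dA] [mB dB]; split; first exact: measurableU.
by move=> w w' ww'; rewrite /setU /= (dA _ _ ww') (dB _ _ ww').
Qed.

Lemma levelT K : level K [set: seqspace T].
Proof. by split; [exact: measurableT|]. Qed.

Lemma level0 K : level K (@set0 (seqspace T)).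
Proof. by split; [exact: measurable0|]. Qed.

Definition level_sets : set (set (seqspace T)) := [set A | exists K, level K A].

Lemma level_setsD : setD_closed level_sets.
Proof.
move=> A B [K KA] [K' KB]; exists (maxn K K').
by apply: levelD; [exact: levelW (leq_maxl _ _) KA|
  exact: levelW (leq_maxr _ _) KB].
Qed.

Lemma level_setsT : level_sets setT.
Proof. by exists 0%N; exact: levelT. Qed.

Definition levelspace : Type := nat -> T.

HB.instance Definition _ := Pointed.on levelspace.
HB.instance Definition _ := isAlgebraOfSets_setD.Build default_measure_display
  levelspace level_setsT level_setsD.

End level_algebra.

Section product_premeasure.
Context d (T : measurableType d) (R : realType) (P : nat -> probability T R).
Local Open Scope ereal_scope.

Definition level_content (A : set (levelspace T)) : \bar R :=
  iter_int P 0 (xget 0%N [set K | level K A]) (ind R A) point.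

Lemma level_contentE K (A : set (seqspace T)) w :
  level K A -> level_content A = iter_int P 0 K (ind R A) w.
Proof.
move=> lA; rewrite /level_content; case: xgetP => [K' _ lA'|/(_ K)]; last by [].
have dI := depends_ind R lA'.2; have dI' := depends_ind R lA.2.
transitivity (iter_int P 0 (maxn K K') (ind R A) point).
  by rewrite (iter_int_stable _ dI' (m := K) (m' := maxn K K'))// ?leq_maxl//
     -(iter_int_stable _ dI' (m := K) (m' := maxn K K'))// ?leq_maxl//
     (iter_int_stable _ dI (m := K'))// leq_maxr.
rewrite (iter_int_stable _ dI' (m := K))// ?leq_maxl//.
by apply: (@depends_iter_int _ _ _ P 0 K).
Qed.

Let content_ge0 A : 0 <= level_content A.
Proof.
rewrite /level_content; case: xgetP => [K _ [mA dA]|]; last by rewrite /= lee_fin.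
by case: (nnmeas_iter_int P 0 K (nnmeas_ind R mA)).
Qed.

Let content0 : level_content set0 = 0.
Proof.
by rewrite (level_contentE point (level0 T 0)) /= /ind indic0.
Qed.

Let content_additive : measure_function.semi_additive level_content.
Proof.
apply/additive2P => // A B [K KA] [K' KB] AB.
have KA' := levelW (leq_maxl K K') KA; have KB' := levelW (leq_maxr K K') KB.
have KAB := levelU KA' KB'.
rewrite (level_contentE point KA') (level_contentE point KB').
rewrite (level_contentE point KAB).
have nA := nnmeas_ind R KA'.1; have nB := nnmeas_ind R KB'.1.
rewrite (_ : ind R (A `|` B) = ind R A \+ ind R B) ?iter_intD//.
apply/funext => w; rewrite /ind /= !indicE -EFinD -natrD in_setU; congr (_%:R%:E).
case: (boolP (w \in A)) => //; case: (boolP (w \in B)) => //.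
rewrite !inE => Bw Aw; suff : (A `&` B) w by rewrite AB.
by split.
Qed.

HB.instance Definition _ :=
  isContent.Build _ _ _ level_content content_ge0 content_additive.

Let content_subadditive : measurable_subset_sigma_subadditive level_content.
Proof.
move=> A F mF mA AF; rewrite leNgt; apply/negP => ltA.
have mU n : measurable (\big[setU/set0]_(i < n) F i : set (levelspace T)).
  by apply: bigsetU_measurable => i _; exact: mF.
pose B n := A `\` \big[setU/set0]_(i < n) F i.
have mB n : measurable (B n : set (levelspace T)) by exact: measurableD.
pose K n := xget 0%N [set K | level K (B n)].
have levB n : level (K n) (B n).
  by rewrite /K; case: xgetP => [//|noK]; have [k /noK] := mB n.
suff : \bigcap_n B n !=set0.
  move=> [w Bw]; have [Aw _] := Bw 0%N I.
  have [n _ Fnw] := AF _ Aw; have [_] := Bw n.+1 I; apply.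
  by rewrite big_ord_recr /=; right.
have cA : level_content A \is a fin_num.
  case: mA => KA lA; rewrite ge0_fin_numE// (level_contentE point lA).
  apply: (@le_lt_trans _ _ (iter_int P 0 KA (cst 1) point)).
    apply: le_iter_int; [exact: nnmeas_ind lA.1|exact: nnmeas_cst|].
    by move=> v; rewrite lee_fin indicE -[leRHS]/(1%:R) ler_nat leq_b1.
  by rewrite iter_int_cst ltry.
have cF : \sum_(i <oo) level_content (F i) \is a fin_num.
  rewrite ge0_fin_numE; last exact: nneseries_ge0.
  by apply: lt_trans ltA _; rewrite -ge0_fin_numE.
apply: (@nested_level_sets _ _ _ P B K levB _ point).
  move=> n; rewrite /B => w [Aw nU]; split => //; apply: contra_not nU => Uw.
  by rewrite big_ord_recr; left.
exists (fine (level_content A - \sum_(i <oo) level_content (F i))).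
  by rewrite -lte_fin fineK ?fin_numB ?cA ?cF// lteBrDl?cF// adde0.
move=> n; rewrite -(level_contentE point (levB n)).
rewrite fineK ?fin_numB ?cA ?cF// leeBlDr//.
apply: (@le_trans _ _ (level_content (B n) + \sum_(i < n) level_content (F i))).
  have AE : A `<=` \big[setU/set0]_(i < n.+1)
      (fun i => if i is i'.+1 then F i' else B n) i.
    move=> w Aw; rewrite big_ord_recl /=.
    have [Uw|nUw] := pselect ((\big[setU/set0]_(i < n) F i) w); first by right.
    by left.
  have := @content_subadditive _ _ _ level_content A
    (fun i => if i is i'.+1 then F i' else B n) n.+1 _ mA AE.
  rewrite big_ord_recl /=; apply => -[|k] _ //=.
rewrite leeD2l// -(big_mkord xpredT (fun i => level_content (F i))).
exact: nneseries_lim_ge.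
Qed.

HB.instance Definition _ := Content_SigmaSubAdditive_isMeasure.Build _ _ _
  level_content content_subadditive.

Definition seq_prob : set (seqspace T) -> \bar R := measure_extension level_content.

Let sub_extension (A : set (seqspace T)) : measurable A ->
  measurable (A : set (g_sigma_algebraType (@measurable _ (levelspace T)))).
Proof.
apply: smallest_sub; first exact: smallest_sigma_algebra.
move=> _ [k [B [mB ->]]]; apply: sub_sigma_algebra; exists k.+1.
exact: level_coord.
Qed.

Let seq_prob0 : seq_prob set0 = 0. Proof. exact: measure0. Qed.

Let seq_prob_ge0 A : 0 <= seq_prob A. Proof. exact: measure_ge0. Qed.

Let seq_prob_sigma_additive : semi_sigma_additive seq_prob.
Proof.
move=> F mF tF mUF.
exact: (@measure_semi_sigma_additive _ _ _ (measure_extension level_content) F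
  (fun i => sub_extension (mF i)) tF (sub_extension mUF)).
Qed.

HB.instance Definition _ := isMeasure.Build _ _ _ seq_prob
  seq_prob0 seq_prob_ge0 seq_prob_sigma_additive.

Lemma seq_probE K (A : set (seqspace T)) w :
  level K A -> seq_prob A = iter_int P 0 K (ind R A) w.
Proof.
move=> lA; rewrite /seq_prob /measure_extension measurable_mu_extE/=.
  exact: level_contentE.
by exists K.
Qed.

Let seq_probT : seq_prob setT = 1.
Proof.
by rewrite (seq_probE point (levelT T 0))/= /ind indicT.
Qed.

HB.instance Definition _ := Measure_isProbability.Build _ _ _ seq_prob seq_probT.

Lemma seq_prob_indep K (A : set (seqspace T)) (B : set T) :
  level K A -> measurable B ->
  seq_prob (A `&` [set w | B (w K)]) = seq_prob A * P K B.
Proof.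
move=> lA mB.
have lAB : level K.+1 (A `&` [set w | B (w K)]).
  have lA' := levelW (leqnSn K) lA; have lB := level_coord K mB.
  by rewrite -(setDD A); apply: levelD => //; exact: levelD.
rewrite (seq_probE point lAB) (seq_probE point lA) iter_intSr add0n.
have -> : int_coord P K (ind R (A `&` [set w | B (w K)])) =
    fun w => (fine (P K B))%:E * ind R A w.
  apply/funext => w; rewrite /int_coord.
  under eq_integral do rewrite /ind indicI /= EFinM.
  under eq_integral => x _.
    rewrite -/(ind R A _) (upd_depends _ _ (leqnn K) (depends_ind R lA.2)).
    rewrite (_ : \1_[set w | B (w K)] (upd K x w) = \1_B x); last first.
      by rewrite !indicE /=; congr ((_ : bool)%:R); apply/idP/idP; rewrite !inE
        /= /upd eqxx.
  over.
  rewrite ge0_integralZl_EFin//; last exact/measurable_EFinP/measurable_indic.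
  by rewrite integral_indic// setIT muleC fineK// fin_num_measure.
rewrite iter_intZ ?fine_ge0//; last exact: nnmeas_ind lA.1.
by rewrite muleC fineK// fin_num_measure.
Qed.

End product_premeasure.

(** * Characteristic functions *)

Section complex_exponential.
Context {R : realType}.
Local Open Scope complex_scope.
Implicit Types z w : R[i].

Lemma cexp_i (s : R) : cexp ('i%C * s%:C) = cos s +i* sin s.
Proof. by rewrite /cexp /=; simpc; rewrite expR0 !mul1r. Qed.

Lemma cexp0 : cexp (0 : R[i]) = 1.
Proof. by rewrite /cexp /= expR0 cos0 sin0 mul1r. Qed.

Lemma cexpD z w : cexp (z + w) = cexp z * cexp w.
Proof.
case: z w => [a b] [c d]; rewrite /cexp /=; simpc.
rewrite expRD cosD sinD; apply/eqP; rewrite eq_complex /=.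
by apply/andP; split; apply/eqP; ring.
Qed.

Lemma cexp_sum (I : Type) (r : seq I) (F : I -> R[i]) :
  cexp (\sum_(i <- r) F i) = \prod_(i <- r) cexp (F i).
Proof.
by apply: (big_morph (@cexp R) cexpD cexp0).
Qed.

End complex_exponential.

Section image_measure.
Context d d' (T : measurableType d) (T' : measurableType d') (R : realType).

Definition law (m : set T -> \bar R) (f : T -> T') (_ : measurable_fun setT f) :
  set T' -> \bar R := pushforward m f.

Section measure.
Variables (m : {measure set T -> \bar R}) (f : T -> T').
Hypothesis mf : measurable_fun setT f.

Let law0 : law m mf set0 = 0%E.
Proof. by rewrite /law /pushforward preimage_set0 measure0. Qed.

Let law_ge0 A : (0 <= law m mf A)%E. Proof. exact: measure_ge0. Qed.

Let law_sigma_additive : semi_sigma_additive (law m mf).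
Proof.
move=> F mF tF mUF; rewrite /law /pushforward preimage_bigcup.
apply: measure_semi_sigma_additive.
- by move=> n; rewrite -[X in measurable X]setTI; exact: mf.
- apply/trivIsetP => /= i j _ _ ij; rewrite -preimage_setI.
  by move/trivIsetP : tF => /(_ _ _ _ _ ij) ->//; rewrite preimage_set0.
- by rewrite -preimage_bigcup -[X in measurable X]setTI; exact: mf.
Qed.

HB.instance Definition _ := isMeasure.Build _ _ _
  (law m mf) law0 law_ge0 law_sigma_additive.

Lemma Rintegral_law (g : T' -> R) : measurable_fun setT g ->
  m.-integrable setT (EFin \o (g \o f)) ->
  \int[law m mf]_x g x = \int[m]_x g (f x).
Proof.
move=> mg ig; rewrite /Rintegral /law; congr fine.
have := @integral_pushforward _ _ _ _ _ f mf m setT (EFin \o g).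
by rewrite preimage_setT; apply => //; exact/measurable_EFinP.
Qed.

Lemma ge0_integral_law (g : T' -> \bar R) : measurable_fun setT g ->
  (forall x, 0 <= g x)%E -> (\int[law m mf]_x g x = \int[m]_x g (f x))%E.
Proof.
move=> mg g0; rewrite /law.
by have := @ge0_integral_pushforward _ _ _ _ _ f mf m setT g; rewrite preimage_setT; apply.
Qed.

End measure.

Section proba.
Variables (m : probability T R) (f : T -> T').
Hypothesis mf : measurable_fun setT f.

Let lawT : law m mf setT = 1%E.
Proof. by rewrite /law /pushforward preimage_setT probability_setT. Qed.

HB.instance Definition _ := Measure_isProbability.Build _ _ _ (law m mf) lawT.

End proba.

End image_measure.

Section bounded_measurable.
Context d (T : measurableType d) (R : realType).
Implicit Types f g : T -> R.

Definition bdd f := measurable_fun setT f /\ exists M, forall x, `|f x| <= M.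

Lemma bdd_integrable (m : {measure set T -> \bar R}) f :
  (m setT < +oo)%E -> bdd f -> m.-integrable setT (EFin \o f).
Proof.
move=> mT [mf [M fM]]; apply: measurable_bounded_integrable => //.
exists M; split; first by rewrite num_real.
by move=> N MN x _ /=; rewrite (le_trans (fM x))// ltW.
Qed.

Lemma prob_integrable (m : probability T R) f :
  bdd f -> m.-integrable setT (EFin \o f).
Proof. by apply: bdd_integrable; rewrite [ltLHS]probability_setT ltry. Qed.

Lemma bdd_cst r : bdd (cst r).
Proof. by split => //; exists `|r|. Qed.

Lemma bddD f g : bdd f -> bdd g -> bdd (fun x => f x + g x).
Proof.
move=> [mf [M fM]] [mg [N gN]]; split; first exact: measurable_funD.
by exists (M + N) => x; rewrite (le_trans (ler_normD _ _))// lerD.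
Qed.

Lemma bddM f g : bdd f -> bdd g -> bdd (fun x => f x * g x).
Proof.
move=> [mf [M fM]] [mg [N gN]]; split; first exact: measurable_funM.
by exists (M * N) => x; rewrite normrM ler_pM.
Qed.

Lemma bddN f : bdd f -> bdd (fun x => - f x).
Proof.
move=> [mf [M fM]]; split; first exact: measurableT_comp.
by exists M => x; rewrite normrN.
Qed.

Lemma bddB f g : bdd f -> bdd g -> bdd (fun x => f x - g x).
Proof. by move=> bf /bddN; exact: bddD. Qed.

Lemma bddZ r f : bdd f -> bdd (fun x => r * f x).
Proof. exact/bddM/bdd_cst. Qed.

Lemma bdd_cos f : measurable_fun setT f -> bdd (fun x => cos (f x)).
Proof.
move=> mf; split; last by exists 1 => x; exact: cos_max.
apply: measurableT_comp mf; apply: continuous_measurable_fun.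
exact: continuous_cos.
Qed.

Lemma bdd_sin f : measurable_fun setT f -> bdd (fun x => sin (f x)).
Proof.
move=> mf; split; last by exists 1 => x; exact: sin_max.
apply: measurableT_comp mf; apply: continuous_measurable_fun.
exact: continuous_sin.
Qed.

End bounded_measurable.

Lemma bdd_comp d d' (T : measurableType d) (T' : measurableType d')
    (R : realType) (f : T' -> R) (g : T -> T') :
  measurable_fun setT g -> bdd f -> bdd (f \o g).
Proof.
move=> mg [mf [M fM]]; split; last by exists M => x; exact: fM.
exact: measurableT_comp mf mg.
Qed.

Section characteristic_function.
Context {R : realType}.
Local Open Scope complex_scope.

Definition chf d (T : measurableType d) (m : set T -> \bar R) (f : T -> R) : R[i] :=
  cintegral m (fun x => cexp ('i%C * (f x)%:C)).

Lemma chfE d (T : measurableType d) (m : {measure set T -> \bar R}) (f : T -> R) :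
  chf m f = (\int[m]_x cos (f x)) +i* (\int[m]_x sin (f x)).
Proof.
by congr (fine _ +i* fine _); apply: eq_integral => x _; rewrite cexp_i.
Qed.

Lemma chf_cst d (T : measurableType d) (m : probability T R) (r : R) :
  chf m (cst r) = cexp ('i%C * r%:C).
Proof.
have mT : fine (m setT) = 1 by rewrite probability_setT.
have I (c : R) : \int[m]_x c = c by rewrite (Rintegral_cst m measurableT) mT mulr1.
by rewrite chfE cexp_i /= !I.
Qed.

Lemma chf_law d d' (T : measurableType d) (T' : measurableType d')
    (m : probability T R) (g : T -> T') (mg : measurable_fun setT g)
    (f : T' -> R) : measurable_fun setT f ->
  chf (law m mg) f = chf m (f \o g).
Proof.
move=> mf; rewrite !chfE.
have bc : bdd (fun x => cos (f x)) by exact: bdd_cos.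
have bs : bdd (fun x => sin (f x)) by exact: bdd_sin.
by rewrite !Rintegral_law//; [exact: bs.1|exact/prob_integrable/(bdd_comp mg)|
  exact: bc.1|exact/prob_integrable/(bdd_comp mg)].
Qed.

Section product.
Context d1 d2 (T1 : measurableType d1) (T2 : measurableType d2).
Variables (m1 : probability T1 R) (m2 : probability T2 R).

Lemma Rintegral_prod (f : T1 * T2 -> R) : bdd f ->
  \int[(m1 \x m2)%E]_z f z = \int[m1]_x \int[m2]_y f (x, y).
Proof.
move=> bf; have := prob_integrable (m1 \x m2)%E bf => if_.
have bfx x : bdd (fun y => f (x, y)).
  by apply: (@bdd_comp _ _ _ _ _ f (pair x)) => //; exact: measurable_pair1.
rewrite /Rintegral -(integral12_prod_meas1 if_); congr fine.
apply: eq_integral => x _; rewrite /= fineK//.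
exact/integrable_fin_num/prob_integrable.
Qed.

Lemma Rintegral_prodM (f : T1 -> R) (g : T2 -> R) : bdd f -> bdd g ->
  \int[(m1 \x m2)%E]_z (f z.1 * g z.2) = (\int[m1]_x f x) * (\int[m2]_x g x).
Proof.
move=> bf bg; rewrite Rintegral_prod.
  rewrite -RintegralZr//; last exact: prob_integrable.
  by apply: eq_Rintegral => x _ /=; rewrite RintegralZl//; exact: prob_integrable.
apply: bddM; [exact: (bdd_comp measurable_fst bf)|
  exact: (bdd_comp measurable_snd bg)].
Qed.

Lemma chf_prod (f : T1 -> R) (g : T2 -> R) :
  measurable_fun setT f -> measurable_fun setT g ->
  chf (m1 \x m2)%E (fun z => f z.1 + g z.2) = chf m1 f * chf m2 g.
Proof.
move=> mf mg; have cf := bdd_cos mf; have sf := bdd_sin mf.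
have cg := bdd_cos mg; have sg := bdd_sin mg.
have B (u : T1 -> R) (v : T2 -> R) : bdd u -> bdd v ->
    (m1 \x m2)%E.-integrable setT (EFin \o (fun z => u z.1 * v z.2)).
  move=> bu bv; apply: prob_integrable; apply: bddM.
    exact: (bdd_comp measurable_fst bu).
  exact: (bdd_comp measurable_snd bv).
rewrite !chfE; simpc; congr (_ +i* _).
  under eq_Rintegral do rewrite cosD.
  rewrite RintegralB//; [|exact: (B (cos \o f) (cos \o g))|
    exact: (B (sin \o f) (sin \o g))].
  by rewrite (Rintegral_prodM cf cg) (Rintegral_prodM sf sg).
under eq_Rintegral do rewrite sinD.
rewrite RintegralD//; [|exact: (B (sin \o f) (cos \o g))|
  exact: (B (cos \o f) (sin \o g))].
by rewrite (Rintegral_prodM sf cg) (Rintegral_prodM cf sg) addrC.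
Qed.

End product.

Section sequence.
Context d (T : measurableType d) (P : nat -> probability T R).

Lemma chf_seq_indep K (S : seqspace T -> R) (f : T -> R) :
  measurable_fun setT S -> depends_below K S -> measurable_fun setT f ->
  chf (seq_prob P) (fun w => S w + f (w K)) = chf (seq_prob P) S * chf (P K) f.
Proof.
move=> mS dS mf.
have mphi : measurable_fun setT (fun w : seqspace T => (S w, w K)).
  by apply: measurable_fun_pair => //; exact: measurable_coord.
have mF : measurable_fun setT (fun p : R * T => p.1 + f p.2).
  by apply: measurable_funD => //; exact: measurableT_comp mf measurable_snd.
have <- : chf (law (seq_prob P) mphi) (fun p => p.1 + f p.2) =
    chf (seq_prob P) (fun w => S w + f (w K)) by rewrite chf_law.
have -> : chf (seq_prob P) S = chf (law (seq_prob P) mS) id by rewrite chf_law.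
rewrite -chf_prod// !chfE /Rintegral.
have E : forall A, measurable A ->
    (law (seq_prob P) mS \x P K)%E A = law (seq_prob P) mphi A.
  apply: product_measure_unique => A B mA mB.
  rewrite -[RHS](@seq_prob_indep _ _ _ P K (S @^-1` A) B)//; split.
    by rewrite -[X in measurable X]setTI; exact: mS.
  by move=> w w' /dS; rewrite /preimage /= => ->.
by congr (fine _ +i* fine _); apply: eq_measure_integral => A mA _;
  rewrite -[LHS]E.
Qed.

Lemma chf_seq_sum K (f : nat -> T -> R) :
  (forall k, measurable_fun setT (f k)) ->
  chf (seq_prob P) (fun w => \sum_(k < K) f k (w k)) =
  \prod_(k < K) chf (P k) (f k).
Proof.
move=> mf; elim: K => [|K IH].
  rewrite big_ord0 [X in chf _ X](_ : _ = cst 0); last first.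
    by apply/funext => w; rewrite big_ord0.
  by rewrite chf_cst mulr0 cexp0.
rewrite big_ord_recr /= -IH -chf_seq_indep//; first last.
- by move=> w w' ww'; apply: eq_bigr => k _; rewrite ww'.
- apply: measurable_sum => k.
  exact: measurableT_comp (mf k) (measurable_coord _).
by congr chf; apply/funext => w; rewrite big_ord_recr.
Qed.

End sequence.
End characteristic_function.

Lemma cvgn_le (R : realType) (u : nat -> R) (l M : R) :
  u k @[k --> \oo] --> l -> (forall k, u k <= M) -> l <= M.
Proof.
move=> ul uM; rewrite -(cvg_lim (@Rhausdorff R) ul).
by apply: limr_le; [apply/cvg_ex; exists l|exact: nearW].
Qed.

Lemma cvgn_ge (R : realType) (u : nat -> R) (l M : R) :
  u k @[k --> \oo] --> l -> (forall k, M <= u k) -> M <= l.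
Proof.
move=> ul uM; rewrite -(cvg_lim (@Rhausdorff R) ul).
by apply: limr_ge; [apply/cvg_ex; exists l|exact: nearW].
Qed.

Section bounded_convergence.
Context d (T : measurableType d) (R : realType) (m : probability T R).

Lemma bounded_convergence (F : nat -> T -> R) (f : T -> R) (M : R) :
  (forall k, measurable_fun setT (F k)) -> (forall k x, `|F k x| <= M) ->
  (forall x, F k x @[k --> \oo] --> f x) ->
  bdd f /\ \int[m]_x F k x @[k --> \oo] --> \int[m]_x f x.
Proof.
move=> mF FM Ff.
have mf : measurable_fun setT f.
  exact: (measurable_fun_cvg mF (fun x _ => Ff x)).
have bF k : bdd (F k) by split => //; exists M.
have bf : bdd f.
  by split => //; exists M => x; exact: cvgn_le (cvg_norm (Ff x)) _.
split => //; apply: fine_cvg.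
rewrite fineK; last exact/integrable_fin_num/prob_integrable.
have [//|||||_ _] := @dominated_convergence _ _ _ m _ measurableT
  (fun k => EFin \o F k) (EFin \o f) (cst M%:E).
- by move=> k; exact/measurable_EFinP.
- exact/measurable_EFinP.
- by apply: aeW => x _; apply: cvg_EFin; [exact: nearW|exact: Ff].
- exact: finite_measure_integrable_cst.
- by apply: aeW => x k _; rewrite lee_fin.
by [].
Qed.

End bounded_convergence.

Lemma norm_Rintegral_le d (T : measurableType d) (R : realType)
    (m : probability T R) (f : T -> R) (M : R) :
  measurable_fun setT f -> (forall x, `|f x| <= M) -> `|\int[m]_x f x| <= M.
Proof.
move=> mf fM; have bf : bdd f by split => //; exists M.
apply: le_trans (le_normr_Rintegral measurableT (prob_integrable m bf)) _.
have -> : M = \int[m]_x (cst M : T -> R) x.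
  by rewrite Rintegral_cst// [X in fine X]probability_setT mulr1.
apply: le_Rintegral => //; last exact/prob_integrable/bdd_cst.
by apply: prob_integrable; split; [exact: measurableT_comp|exists M => x; rewrite normr_id].
Qed.

Section absolute_value_approximation.
Context {R : realType}.
Implicit Type s : R.

Fixpoint absq k s : R :=
  if k is k'.+1 then absq k' s + (s ^+ 2 - absq k' s ^+ 2) / 2 else 0.

Lemma absq_bound k s : `|s| <= 1 -> 0 <= absq k s <= `|s|.
Proof.
move=> s1; have s0 := normr_ge0 s.
elim: k => [|k /andP[q0 qs]] /=; first by rewrite lexx normr_ge0.
by rewrite -(real_normK (num_real s)); apply/andP; split; nra.
Qed.

Lemma absq_cvg s : `|s| <= 1 -> absq k s @[k --> \oo] --> `|s|.
Proof.
move=> s1; have s0 := normr_ge0 s.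
have nd : nondecreasing_seq (absq ^~ s).
  apply/nondecreasing_seqP => k /=; have /andP[q0 qs] := absq_bound k s1.
  by rewrite -(real_normK (num_real s)); nra.
have ub : has_ubound (range (absq ^~ s)).
  by exists `|s| => _ [k _ <-]; have /andP[] := absq_bound k s1.
have [l cq] : exists l : R, absq k s @[k --> \oo] --> l.
  by eexists; exact: nondecreasing_cvgn nd ub.
suff -> : `|s| = l by [].
have l0 : 0 <= l.
  by apply: (cvgn_ge cq) => k; have /andP[] := absq_bound k s1.
have cq1 : absq k.+1 s @[k --> \oo] --> l by rewrite (cvg_shiftS (absq ^~ s)).
have cq2 : absq k.+1 s @[k --> \oo] --> l + (s ^+ 2 - l ^+ 2) / 2.
  apply: cvgD => //; apply: cvgM; last exact: cvg_cst.
  by apply: cvgB; [exact: cvg_cst|rewrite expr2; under eq_cvg do rewrite expr2; exact: cvgM].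
have ll : l = l + (s ^+ 2 - l ^+ 2) / 2.
  exact: (cvg_unique (@Rhausdorff R) cq1 cq2).
have sl : `|s| ^+ 2 = l ^+ 2 by rewrite (real_normK (num_real s)); lra.
by apply/eqP; rewrite -(eqrXn2 (n := 2)) // sl.
Qed.

End absolute_value_approximation.

Section uniqueness.
Context {R : realType} {n : nat}.
Local Notation Rn := (n.-tuple R).
Implicit Types (t x y : Rn) (f g w : Rn -> R).

Lemma measurable_tdot t : measurable_fun setT (tdot t).
Proof.
apply: measurable_sum => i; apply: measurable_funM => //.
exact: measurable_tnth.
Qed.

Lemma tdotC x y : tdot x y = tdot y x.
Proof. by apply: eq_bigr => i _; rewrite mulrC. Qed.

Lemma tdotDl t y x : tdot (tadd t y) x = tdot t x + tdot y x.
Proof.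
rewrite /tdot -big_split /=; apply: eq_bigr => i _.
by rewrite tnth_mktuple mulrDl.
Qed.

Definition tscale (c : R) x : Rn := [tuple c * tnth x i | i < n].

Lemma tdotZl c t x : tdot (tscale c t) x = c * tdot t x.
Proof.
rewrite /tdot mulr_sumr; apply: eq_bigr => i _.
by rewrite tnth_mktuple mulrA.
Qed.

Lemma tdot0l x : tdot (tzero : Rn) x = 0.
Proof. by apply: big1 => i _; rewrite tnth_mktuple mul0r. Qed.

Definition tunit (i : 'I_n) : Rn := [tuple (j == i)%:R | j < n].

Lemma tdot_unit i x : tdot (tunit i) x = tnth x i.
Proof.
rewrite /tdot (bigD1 i)//= tnth_mktuple eqxx mul1r big1 ?addr0// => j ji.
by rewrite tnth_mktuple (negbTE ji) mul0r.
Qed.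

Inductive trigpoly : (Rn -> R) -> Prop :=
| trig_cos t : trigpoly (fun x => cos (tdot t x))
| trig_sin t : trigpoly (fun x => sin (tdot t x))
| trig_add f g : trigpoly f -> trigpoly g -> trigpoly (fun x => f x + g x)
| trig_scale c f : trigpoly f -> trigpoly (fun x => c * f x).

Lemma trig_cst c : trigpoly (cst c).
Proof.
rewrite (_ : cst c = (fun x => c * cos (tdot tzero x))).
  exact: trig_scale (trig_cos _).
by apply/funext => x; rewrite tdot0l cos0 mulr1.
Qed.

Lemma trigpoly_bdd f : trigpoly f -> bdd f.
Proof.
elim=> [t|t|{}f g _ bf _ bg|c {}f _ bf].
- by apply: bdd_cos; exact: measurable_tdot.
- by apply: bdd_sin; exact: measurable_tdot.
- exact: bddD.
- exact: bddZ.
Qed.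

Lemma trig_mul f g : trigpoly f -> trigpoly g -> trigpoly (fun x => f x * g x).
Proof.
have prod_to_sum (u v a b : Rn -> R) c : trigpoly u -> trigpoly v ->
    (forall x, a x * b x = 2^-1 * (u x + c * v x)) ->
    trigpoly (fun x => a x * b x).
  move=> tu tv /funext ->.
  by apply: trig_scale; apply: trig_add => //; exact: trig_scale.
move=> + tg; elim=> [t|t|{}f f' _ tf _ tf'|c {}f _ tf].
- elim: tg => [y|y|{}g g' _ tg' _ tg''|c {}g _ tg'].
  + apply: (prod_to_sum _ _ _ _ 1 (trig_cos (tadd t y))
      (trig_cos (tadd t (tscale (-1) y)))) => x.
    by rewrite !tdotDl tdotZl !mulN1r cosB cosD; field.
  + apply: (prod_to_sum _ _ _ _ (-1) (trig_sin (tadd t y))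
      (trig_sin (tadd t (tscale (-1) y)))) => x.
    by rewrite !tdotDl tdotZl !mulN1r sinB sinD; field.
  + by under eq_fun do rewrite mulrDr; exact: trig_add.
  + by under eq_fun do rewrite mulrCA; exact: trig_scale.
- elim: tg => [y|y|{}g g' _ tg' _ tg''|c {}g _ tg'].
  + apply: (prod_to_sum _ _ _ _ 1 (trig_sin (tadd t y))
      (trig_sin (tadd t (tscale (-1) y)))) => x.
    by rewrite !tdotDl tdotZl !mulN1r sinB sinD; field.
  + apply: (prod_to_sum _ _ _ _ (-1) (trig_cos (tadd t (tscale (-1) y)))
      (trig_cos (tadd t y))) => x.
    by rewrite !tdotDl tdotZl !mulN1r cosB cosD; field.
  + by under eq_fun do rewrite mulrDr; exact: trig_add.
  + by under eq_fun do rewrite mulrCA; exact: trig_scale.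
- by under eq_fun do rewrite mulrDl; exact: trig_add.
- by under eq_fun do rewrite -mulrA; exact: trig_scale.
Qed.

Lemma trig_exp f k : trigpoly f -> trigpoly (fun x => f x ^+ k).
Proof.
move=> tf; elim: k => [|k IH]; first exact: trig_cst.
by under eq_fun do rewrite exprS; exact: trig_mul.
Qed.

Lemma trig_opp f : trigpoly f -> trigpoly (fun x => - f x).
Proof. by move=> tf; under eq_fun do rewrite -mulN1r; exact: trig_scale. Qed.

Lemma trig_sub f g : trigpoly f -> trigpoly g -> trigpoly (fun x => f x - g x).
Proof. by move=> tf /trig_opp; exact: trig_add. Qed.

Lemma trig_absq k f : trigpoly f -> trigpoly (fun x => absq k (f x)).
Proof.
move=> tf; elim: k => [|k IH] /=; first exact: trig_cst.
apply: trig_add => //; under eq_fun do rewrite mulrC; apply: trig_scale.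
by apply: trig_sub; exact: trig_exp.
Qed.

Section same_chf.
Variables m1 m2 : probability Rn R.
Hypothesis m12 : forall t, chf m1 (tdot t) = chf m2 (tdot t).

(* [w] is a weight against which the two measures cannot be told apart by
   trigonometric polynomials. *)
Definition agree w := bdd w /\
  forall g, trigpoly g -> \int[m1]_x (w x * g x) = \int[m2]_x (w x * g x).

Lemma agree1 : agree (cst 1).
Proof.
split; first exact: bdd_cst.
suff H g : trigpoly g -> \int[m1]_x g x = \int[m2]_x g x.
  by move=> g tg; under eq_Rintegral do rewrite mul1r;
    under [in RHS]eq_Rintegral do rewrite mul1r; exact: H.
elim=> [t|t|{}f {}g tf If tg Ig|c {}f tf If].
- by have := m12 t; rewrite !chfE => -[].
- by have := m12 t; rewrite !chfE => -[].
- by rewrite !RintegralD ?If ?Ig//; exact/prob_integrable/trigpoly_bdd.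
- by rewrite !RintegralZl ?If//; exact/prob_integrable/trigpoly_bdd.
Qed.

Lemma agreeM w f : agree w -> trigpoly f -> agree (fun x => w x * f x).
Proof.
move=> [bw aw] tf; split; first exact/bddM/trigpoly_bdd.
move=> g tg; under eq_Rintegral do rewrite -mulrA.
under [in RHS]eq_Rintegral do rewrite -mulrA.
by apply: aw; exact: trig_mul.
Qed.

Lemma agree_cvg (F : nat -> Rn -> R) f (M : R) :
  (forall k, agree (F k)) -> (forall k x, `|F k x| <= M) ->
  (forall x, F k x @[k --> \oo] --> f x) -> agree f.
Proof.
move=> aF FM Ff; have mF k : measurable_fun setT (F k) by case: (aF k) => -[].
have [bf _] := bounded_convergence m1 mF FM Ff; split => // g tg.
have [mg [N gN]] := trigpoly_bdd tg.
have mFg k : measurable_fun setT (fun x => F k x * g x).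
  exact: measurable_funM.
have FgMN k x : `|F k x * g x| <= M * N by rewrite normrM ler_pM.
have Fgfg x : F k x * g x @[k --> \oo] --> f x * g x.
  by apply: cvgM; [exact: Ff|exact: cvg_cst].
have [_ c1] := bounded_convergence m1 mFg FgMN Fgfg.
have [_ c2] := bounded_convergence m2 mFg FgMN Fgfg.
have E : (fun k => \int[m1]_x (F k x * g x)) = (fun k => \int[m2]_x (F k x * g x)).
  by apply/funext => k; have [_] := aF k; apply.
by move: c1; rewrite E => c1; exact: (cvg_unique (@Rhausdorff R) c1 c2).
Qed.

Lemma agree_pos w f : agree w -> trigpoly f -> (forall x, `|f x| <= 1) ->
  agree (fun x => w x * \1_[set y | 0 < f y] x).
Proof.
move=> aw tf f1; have [_ [M wM]] := aw.1.
pose p k s : R := (s + absq k s) / 2.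
have p_le k x : -1 <= p k (f x) <= 1.
  have /andP[q0 q1] := absq_bound k (f1 x); have f1x := f1 x.
  by move: (f1x); rewrite ler_norml => /andP[? ?]; rewrite /p; lra.
pose pos s : R := (s + `|s|) / 2.
have p_cvg x : p k (f x) @[k --> \oo] --> pos (f x).
  apply: cvgM; last exact: cvg_cst.
  by apply: cvgD; [exact: cvg_cst|exact: absq_cvg].
have pos01 x : 0 <= pos (f x) <= 1.
  have := f1 x; have := ler_norm (f x); have := ler_norm (- f x).
  by rewrite /pos normrN; lra.
have step N : agree (fun x => w x * (1 - (1 - pos (f x)) ^+ N)).
  apply: (@agree_cvg (fun k x => w x * (1 - (1 - p k (f x)) ^+ N)) _ (M * (1 + 2 ^+ N))).
  - move=> k; apply: agreeM => //.
    apply: (trig_sub (trig_cst 1)); apply: trig_exp.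
    apply: (trig_sub (trig_cst 1)).
    rewrite /p; under eq_fun do rewrite mulrC; apply: trig_scale.
    by apply: trig_add => //; exact: trig_absq.
  - move=> k x; rewrite normrM ler_pM//.
    rewrite (le_trans (ler_normB _ _))// normr1 lerD2l normrX lerXn2r ?nnegrE//.
    by have /andP[? ?] := p_le k x; rewrite ler_norml; apply/andP; split; lra.
  - move=> x; apply: cvgM; first exact: cvg_cst.
    apply: cvgB; first exact: cvg_cst.
    apply: (@cvg_comp _ _ _ (fun k => 1 - p k (f x)) (fun s => s ^+ N)); last exact: exprn_continuous.
    by apply: cvgB; [exact: cvg_cst|exact: p_cvg].
apply: (@agree_cvg _ _ M step).
- move=> k x; rewrite -[leRHS]mulr1 normrM ler_pM// ger0_norm.
    rewrite lerBlDr lerDl exprn_ge0//.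
    by have /andP[? ?] := pos01 x; lra.
  rewrite subr_ge0 exprn_ile1//; have /andP[? ?] := pos01 x; lra.
- move=> x; apply: cvgM; first exact: cvg_cst.
  rewrite indicE; have [fx|fx] := ltrP 0 (f x).
    rewrite mem_set//= -[1%:R]subr0; apply: cvgB; first exact: cvg_cst.
    apply: cvg_expr; have /andP[? ?] := pos01 x.
    by rewrite ger0_norm /pos ?ger0_norm//; have := f1 x; rewrite ?ger0_norm; lra.
  rewrite memNset /=; last by rewrite ltNge fx.
  rewrite /pos ler0_norm// subrr mul0r subr0.
  by under eq_fun do rewrite expr1n subrr; exact: cvg_cst.
Qed.

Lemma agree_halfspace w i c : agree w ->
  agree (fun x => w x * \1_[set y | c < tnth y i] x).
Proof.
move=> aw; have [_ [M wM]] := aw.1.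
pose f (k : nat) x := sin ((tnth x i - c) / k.+1%:R).
apply: (@agree_cvg (fun k x => w x * \1_[set y | 0 < f k y] x) _ M).
- move=> k; apply: agree_pos => //; last by move=> x; exact: sin_max.
  rewrite (_ : f k = fun x =>
      cos (c / k.+1%:R) * sin (tdot (tscale k.+1%:R^-1 (tunit i)) x)
      - sin (c / k.+1%:R) * cos (tdot (tscale k.+1%:R^-1 (tunit i)) x)).
    by apply: trig_sub; apply: trig_scale; [exact: trig_sin|exact: trig_cos].
  apply/funext => x; rewrite /f tdotZl tdot_unit mulrBl sinB mulrC.
  by rewrite [_^-1 * _]mulrC [cos _ * sin (c / _)]mulrC.
- move=> k x; rewrite -[leRHS]mulr1 normrM ler_pM//.
  by rewrite indicE ger0_norm// -[leRHS]/(1%:R) ler_nat leq_b1.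
- move=> x; apply: cvgM; first exact: cvg_cst.
  apply: cvg_near_cst.
  have [K _ HK] : \forall k \near \oo, `|tnth x i - c| < k%:R :> R.
    by apply: nbhs_infty_gtr.
  near=> k; rewrite !indicE; congr ((_ : bool)%:R).
  have k0 : 0 < k.+1%:R :> R by rewrite ltr0n.
  have kb : `|tnth x i - c| / k.+1%:R < 1.
    rewrite ltr_pdivrMr// mul1r (@lt_trans _ _ k%:R) ?ltr_nat//.
    by apply: HK; near: k; exact: nbhs_infty_ge.
  have pi1 : 1 < pi :> R by rewrite (lt_le_trans _ (pi_ge2 R))// ltr1n.
  apply/idP/idP; rewrite !inE /= /f.
    move=> sin0; rewrite -subr_gt0 ltNge; apply/negP => le0.
    move: sin0; rewrite ltNge => /negP; apply.
    rewrite -oppr_ge0 -sinN sin_ge0_pi//.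
    move: kb; rewrite ler0_norm// mulNr => kb.
    rewrite oppr_ge0 mulr_le0_ge0 ?invr_ge0 ?(ltW k0)//=.
    exact: ltW (lt_trans kb pi1).
  move=> ct; have gt0 : 0 < tnth x i - c by rewrite subr_gt0.
  rewrite sin_gt0_pi// divr_gt0//=.
  by move: kb; rewrite gtr0_norm// => /lt_trans; apply.
Unshelve. all: by end_near. Qed.

Lemma chf_unique A : measurable A -> m1 A = m2 A.
Proof.
pose H (p : 'I_n * R) : set Rn := [set x | p.2 < tnth x p.1].
pose G : set (set Rn) := [set A | exists s, A = \big[setI/setT]_(p <- s) H p].
have mH p : measurable (H p).
  rewrite (_ : H p = (fun x => tnth x p.1) @^-1` `]p.2, +oo[%classic).
    by rewrite -[X in measurable X]setTI; exact: measurable_tnth.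
  by apply/seteqP; split => x /=; rewrite /H /= in_itv/= andbT.
have mG B : G B -> measurable B.
  by move=> [s ->]; apply: bigsetI_measurable.
have GE : @measurable _ Rn = <<s G >>.
  apply/seteqP; split; last first.
    by apply: smallest_sub => //; exact: sigma_algebra_measurable.
  move=> B mB.
  have mid : measurable_fun setT (id : g_sigma_algebraType G -> Rn).
    apply/measurable_fun_tnthP => i.
    apply: (measurability _ (RGenOInfty.measurableE R)) => _ [_ [c ->] <-].
    apply: sub_sigma_algebra; exists [:: (i, c)].
    rewrite big_seq1 setTI; apply/seteqP.
    by split => x /=; rewrite /H /= in_itv/= andbT.
  by have := mid measurableT B mB; rewrite setTI preimage_id.
apply: (@measure_unique _ _ _ G (fun=> setT)) => //.
- move=> _ _ [s ->] [s' ->]; exists (s ++ s').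
  by rewrite big_cat.
- by move=> _; exists [::]; rewrite big_nil.
- by apply/seteqP; split => // x _; exists 0%N.
- move=> _ [s ->].
  have : agree (\1_(\big[setI/setT]_(p <- s) H p)).
    elim: s => [|p s IH]; first by rewrite big_nil indicT; exact: agree1.
    rewrite big_cons setIC indicI; exact: agree_halfspace.
  move=> [_ /(_ _ (trig_cst 1))]; rewrite /Rintegral.
  under eq_integral do rewrite mulr1; under [in RHS]eq_integral do rewrite mulr1.
  have mS : measurable (\big[setI/setT]_(p <- s) H p) by apply: mG; exists s.
  rewrite !integral_indic// setIT => E.
  by rewrite -[LHS]fineK ?fin_num_measure// -[RHS]fineK ?fin_num_measure//; congr EFin.
- by move=> k; rewrite [ltLHS]probability_setT ltry.
Qed.

End same_chf.
End uniqueness.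

(** * Compound Poisson laws *)

Section complex_exponential_series.
Context {R : realType}.
Implicit Types (x y s : R) (r q : nat -> R).

Definition psum r N s : R := \sum_(n < N) r n * (s ^+ n / n`!%:R).

Lemma psumS r N s : psum r N.+1 s = psum r N s + r N * (s ^+ N / N`!%:R).
Proof. by rewrite /psum big_ord_recr. Qed.

Section derivative.
Variables (x y : R) (r q : nat -> R).
Hypothesis rS : forall n, r n.+1 = x * r n - y * q n.

Lemma is_derive_psum N s :
  is_derive s 1 (psum r N.+1) (x * psum r N s - y * psum q N s).
Proof.
elim: N => [|N IH].
  rewrite (_ : psum r 1 = cst (r 0%N)); last first.
    by apply/funext => z; rewrite /psum big_ord1 expr0 fact0 divr1 mulr1.
  by apply: is_derive_eq; rewrite /psum !big_ord0 !mulr0 subrr.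
pose k := r N.+1 / (N.+1)`!%:R.
rewrite (_ : psum r N.+2 = psum r N.+1 + k *: (id ^+ N.+1)); last first.
  apply/funext => z; rewrite psumS /k; congr (_ + _).
  have idX m : (id ^+ m : R -> R) z = z ^+ m.
    by elim: m => // m IHm; rewrite !exprS -IHm.
  by rewrite -[RHS]/(k * (id ^+ N.+1 : R -> R) z) idX /k mulrA mulrAC.
have dX : is_derive s (1 : R) (id ^+ N.+1 : R -> R) ((N.+1%:R * s ^+ N) *: 1).
  exact: (@is_deriveX _ _ id N.+1 s 1 1 (is_derive_id s 1)).
apply: (is_derive_eq (is_deriveD IH (is_deriveZ k dX))).
rewrite !psumS /k rS /GRing.scale /= mulr1 factS natrM.
have : N`!%:R != 0 :> R by rewrite pnatr_eq0 -lt0n fact_gt0.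
have : N.+1%:R != 0 :> R by rewrite pnatr_eq0.
by move: (N.+1%:R) (N`!%:R) => a b a0 b0; field; rewrite a0 b0.
Qed.

End derivative.

Section rotation.
Variables (x y : R) (r q : nat -> R).
Hypothesis rS : forall n, r n.+1 = x * r n - y * q n.
Hypothesis qS : forall n, q n.+1 = x * q n + y * r n.

Let qS' n : q n.+1 = x * q n - (- y) * r n.
Proof. by rewrite qS mulNr opprK. Qed.

Let rot N s := expR (- x * s) *
  (psum r N s * cos (y * s) + psum q N s * sin (y * s)).

Let rot' N s := expR (- x * s) * (s ^+ N / N`!%:R) *
  ((y * q N - x * r N) * cos (y * s) - (x * q N + y * r N) * sin (y * s)).

Let is_derive_rot N s : is_derive s 1 (rot N.+1) (rot' N s).
Proof.
have dr := is_derive_psum rS N s; have dq := is_derive_psum qS' N s.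
have dl (a : R) : is_derive s 1 (fun z => a * z) a.
  rewrite (_ : (fun z => _) = a *: id); last by apply/funext.
  by apply: is_derive_eq; rewrite /GRing.scale /= mulr1.
have de : is_derive s 1 (fun z => expR (- x * z)) (expR (- x * s) * (- x)).
  exact: (@is_derive1_comp _ expR (fun z => - x * z) s).
have dc : is_derive s 1 (fun z => cos (y * z)) (- sin (y * s) * y).
  exact: (@is_derive1_comp _ cos (fun z => y * z) s).
have ds : is_derive s 1 (fun z => sin (y * z)) (cos (y * s) * y).
  exact: (@is_derive1_comp _ sin (fun z => y * z) s).
apply: (is_derive_eq
  (is_deriveM de (is_deriveD (is_deriveM dr dc) (is_deriveM dq ds)))).
transitivity (expR (- x * s) *
    ((psum r N.+1 s * (- sin (y * s) * y) +
      cos (y * s) * (x * psum r N s - y * psum q N s)) +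
     (psum q N.+1 s * (cos (y * s) * y) +
      sin (y * s) * (x * psum q N s - (- y) * psum r N s))) +
  (psum r N.+1 s * cos (y * s) + psum q N.+1 s * sin (y * s)) *
    (expR (- x * s) * (- x))); first by [].
by rewrite !psumS /rot'; ring.
Qed.

Let M := `|x| + `|y|.

Let coef_bound n : `|r n| + `|q n| <= M ^+ n * (`|r 0%N| + `|q 0%N|).
Proof.
elim: n => [|n IH]; first by rewrite expr0 mul1r.
rewrite rS qS exprS -mulrA; apply: le_trans (_ : M * (`|r n| + `|q n|) <= _).
  have := ler_normB (x * r n) (y * q n); have := ler_normD (x * q n) (y * r n).
  by rewrite !normrM /M; lra.
by apply: ler_wpM2l => //; rewrite addr_ge0.
Qed.

Lemma cvg_rotated_series : psum r N 1 * cos y + psum q N 1 * sin y @[N --> \oo] -->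
  expR x * r 0%N.
Proof.
have M0 : 0 <= M by rewrite addr_ge0.
have r0 N : rot N.+1 0 = r 0%N.
  have p0 (a : nat -> R) : psum a N.+1 0 = a 0%N.
    rewrite /psum big_ord_recl /= expr0 fact0 divr1 mulr1 big1 ?addr0// => i _.
    by rewrite expr0n /= mul0r mulr0.
  by rewrite /rot !mulr0 expR0 cos0 sin0 mulr0 addr0 mulr1 mul1r p0.
pose C := expR `|x| * (2 * M * (`|r 0%N| + `|q 0%N|)).
have bound N : `|rot N.+1 1 - r 0%N| <= C * (M ^+ N / N`!%:R).
  rewrite -(r0 N); have [||c c01 ->] := @MVT R (rot N.+1) (rot' N) 0 1 ltr01.
  - by move=> s _; exact: is_derive_rot.
  - apply: continuous_subspaceT => s; apply: differentiable_continuous.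
    by apply/derivable1_diffP; have [] := is_derive_rot N s.
  rewrite subr0 mulr1 /rot' !normrM.
  move: c01; rewrite in_itv /= => /andP[c0 c1].
  have e1 : `|expR (- x * c)| <= expR `|x|.
    rewrite ger0_norm ?expR_ge0// ler_expR (le_trans (ler_norm _))// normrM normrN.
    by rewrite ler_piMr// gtr0_norm// ltW.
  have e2 : `|c ^+ N| <= 1 by rewrite normrX exprn_ile1// gtr0_norm// ltW.
  have e3 : `|(y * q N - x * r N) * cos (y * c) - (x * q N + y * r N) * sin (y * c)| <=
      2 * M * (M ^+ N * (`|r 0%N| + `|q 0%N|)).
    apply: le_trans (_ : 2 * M * (`|r N| + `|q N|) <= _); last first.
      by rewrite ler_wpM2l// mulr_ge0.
    rewrite (le_trans (ler_normB _ _))// !normrM.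
    have h1 : `|y * q N - x * r N| * `|cos (y * c)| <= `|y| * `|q N| + `|x| * `|r N|.
      rewrite -!normrM; apply: le_trans (ler_normB _ _).
      by rewrite normrM ler_piMr ?cos_max.
    have h2 : `|x * q N + y * r N| * `|sin (y * c)| <= `|x| * `|q N| + `|y| * `|r N|.
      rewrite -!normrM; apply: le_trans (ler_normD _ _).
      by rewrite normrM ler_piMr ?sin_max.
    apply: le_trans (lerD h1 h2) _; rewrite /M.
    have := normr_ge0 x; have := normr_ge0 y.
    have := normr_ge0 (r N); have := normr_ge0 (q N); nra.
  have fN : 0 < N`!%:R :> R by rewrite ltr0n fact_gt0.
  have -> : C * (M ^+ N / N`!%:R) = expR `|x| * (1 * N`!%:R^-1) *
      (2 * M * (M ^+ N * (`|r 0%N| + `|q 0%N|))) by rewrite /C; ring.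
  have e4 : `|expR (- x * c)| * (`|c ^+ N| * `|N`!%:R^-1|) <=
      expR `|x| * (1 * N`!%:R^-1).
    have e5 : `|N`!%:R^-1 : R| <= N`!%:R^-1 by rewrite gtr0_norm// invr_gt0.
    exact: ler_pM (normr_ge0 _) (mulr_ge0 (normr_ge0 _) (normr_ge0 _)) e1
      (ler_pM (normr_ge0 _) (normr_ge0 _) e2 e5).
  exact: ler_pM (mulr_ge0 (normr_ge0 _) (mulr_ge0 (normr_ge0 _) (normr_ge0 _)))
    (normr_ge0 _) e4 e3.
have rot_cvg : rot N.+1 1 @[N --> \oo] --> r 0%N.
  apply/subr_cvg0/norm_cvg0P.
  apply: (@squeeze_cvgr _ _ _ _ (cst 0) (fun N => C * exp_coeff M N)).
  - by apply: nearW => N; rewrite normr_ge0 /= bound.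
  - exact: cvg_cst.
  - by rewrite -(mulr0 C); apply: cvgM; [exact: cvg_cst|exact: cvg_exp_coeff].
rewrite -(cvg_shiftS (fun N => psum r N 1 * cos y + psum q N 1 * sin y)).
rewrite (_ : (fun n => _) = fun N => expR x * rot N.+1 1).
  by apply: cvgM => //; exact: cvg_cst.
apply/funext => N; rewrite /rot !mulr1 mulrA -expRD subrr expR0 mul1r.
by [].
Qed.

End rotation.

Local Open Scope complex_scope.

Lemma cvg_cexp_series (z : R[i]) :
  psum (fun n => complex.Re (z ^+ n)) N 1 @[N --> \oo] --> complex.Re (cexp z) /\
  psum (fun n => complex.Im (z ^+ n)) N 1 @[N --> \oo] --> complex.Im (cexp z).
Proof.
case: z => x y; set r := fun n => complex.Re _; set q := fun n => complex.Im _.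
have rS n : r n.+1 = x * r n - y * q n.
  by rewrite /r /q exprS; case: (_ ^+ n).
have qS n : q n.+1 = x * q n + y * r n.
  by rewrite /r /q exprS; case: (_ ^+ n) => a b /=; rewrite addrC.
have r'S n : - r n.+1 = x * (- r n) + y * q n by rewrite rS; ring.
have q'S n : q n.+1 = x * q n - y * (- r n) by rewrite qS; ring.
have c1 := cvg_rotated_series rS qS; have c2 := cvg_rotated_series q'S r'S.
rewrite /r /q /= mulr1 mulr0 in c1 c2.
have pN N : psum (fun n => - r n) N 1 = - psum r N 1.
  by rewrite /psum -sumrN; apply: eq_bigr => i _; rewrite mulNr.
have c2' : psum q N 1 * cos y - psum r N 1 * sin y @[N --> \oo] --> (0 : R).
  by move: c2; under eq_cvg do rewrite pN mulNr.
have cs := cos2Dsin2 y.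
have E1 : psum r ^~ 1 = (fun N => (psum r N 1 * cos y + psum q N 1 * sin y) * cos y -
    (psum q N 1 * cos y - psum r N 1 * sin y) * sin y).
  apply/funext => N; transitivity (psum r N 1 * (cos y ^+ 2 + sin y ^+ 2)).
    by rewrite cs mulr1.
  by ring.
have E2 : psum q ^~ 1 = (fun N => (psum r N 1 * cos y + psum q N 1 * sin y) * sin y +
    (psum q N 1 * cos y - psum r N 1 * sin y) * cos y).
  apply/funext => N; transitivity (psum q N 1 * (cos y ^+ 2 + sin y ^+ 2)).
    by rewrite cs mulr1.
  by ring.
split; rewrite /cexp /=; simpc.
- rewrite E1 -[_ * cos y in X in _ --> X]subr0 -(mul0r (sin y)).
  by apply: cvgB; apply: cvgM => //; exact: cvg_cst.
- rewrite E2 -[_ * sin y in X in _ --> X]addr0 -(mul0r (cos y)).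
  by apply: cvgD; apply: cvgM => //; exact: cvg_cst.
Qed.

End complex_exponential_series.

Section nat_expectation.
Context {R : realType} (P : probability nat R).

Lemma Rintegral_nat (g : nat -> R) : bdd g ->
  \sum_(n < N) g n * fine (P [set (n : nat)]) @[N --> \oo] --> \int[P]_n g n.
Proof.
move=> [mg [M gM]].
pose F N x := \sum_(n < N) g n * \1_[set (n : nat)] x.
have FE N x : F N x = if (x < N)%N then g x else 0.
  rewrite /F; case: ltnP => xN.
    rewrite (bigD1 (Ordinal xN))//= indicE mem_set// mulr1 big1 ?addr0// => i ix.
    rewrite indicE memNset ?mulr0//= => xi; move/negP: ix; apply.
    by apply/eqP/val_inj.
  rewrite big1// => i _; rewrite indicE memNset ?mulr0//= => xi.
  by move: xN; rewrite xi leqNgt ltn_ord.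
have bterm n : bdd (fun x => g n * \1_[set (n : nat)] x).
  apply: bddZ; split; first exact: measurable_indic.
  by exists 1 => x; rewrite indicE ger0_norm// -[leRHS]/(1%:R) ler_nat leq_b1.
have bF N : bdd (F N).
  rewrite /F; elim: N => [|N IH].
    by under eq_fun do rewrite big_ord0; exact: bdd_cst.
  by under eq_fun do rewrite big_ord_recr /=; exact: bddD.
have IF N : \int[P]_n F N n = \sum_(n < N) g n * fine (P [set (n : nat)]).
  elim: N => [|N IH].
    by rewrite /F big_ord0; under eq_Rintegral do rewrite big_ord0; rewrite Rintegral_cst// mul0r.
  rewrite big_ord_recr /= -IH.
  transitivity (\int[P]_n (F N n + g N * \1_[set N] n)).
    by apply: eq_Rintegral => x _; rewrite /F big_ord_recr.
  rewrite RintegralD//; [|exact/prob_integrable/bF|exact/prob_integrable/bterm].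
  congr (_ + _); rewrite RintegralZl//; last first.
    apply: prob_integrable; split; first exact: measurable_indic.
    by exists 1 => x; rewrite indicE ger0_norm// -[leRHS]/(1%:R) ler_nat leq_b1.
  by congr (_ * _); rewrite /Rintegral integral_indic// setIT.
have FM k x : `|F k x| <= M.
  by rewrite FE; case: ifP => // _; rewrite normr0; exact: le_trans (gM x).
have Fg x : F k x @[k --> \oo] --> g x.
  by apply: cvg_near_cst; exists x.+1 => // k /= xk; rewrite FE xk.
have [_] := bounded_convergence P (fun N => (bF N).1) FM Fg.
by under eq_cvg do rewrite IF.
Qed.

Lemma poisson_prob1 (c : R) k n : 0 <= c ->
  fine (poisson_prob c k [set (n : nat)]) = c ^+ n / n`!%:R * expR (- c).
Proof.
rewrite le_eqVlt => /predU1P[<-|c0]; rewrite /poisson_prob ?ltxx ?c0; last first.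
  by rewrite esum_set1 ?lee_fin ?poisson_pmf_ge0// /poisson_pmf c0.
rewrite diracE oppr0 expR0 mulr1 expr0n; case: n => [|n].
  by rewrite mem_set//= fact0 divr1.
by rewrite memNset//= mul0r.
Qed.

End nat_expectation.

Section compound_poisson.
Context d (S : measurableType d) (R : realType).
Implicit Types (nu : {measure set S -> \bar R}) (a : S -> R).
Local Open Scope complex_scope.

Definition cp_space : Type := nat * seqspace S.

HB.instance Definition _ := Measurable.copy cp_space (nat * seqspace S)%type.

Definition cp_jump nu : probability S R :=
  mnormalize nu (\d_point : {measure set S -> \bar R}).

Definition cp_prob nu : set cp_space -> \bar R :=
  (poisson_prob (fine (nu setT)) 0%N \x seq_prob (fun _ => cp_jump nu))%E.

HB.instance Definition _ nu := Probability.on (cp_prob nu).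

Definition cp_sum a : cp_space -> R := fun p => \sum_(i < p.1) a (p.2 i).

Lemma cp_sumD a b p : cp_sum (fun u => a u + b u) p = cp_sum a p + cp_sum b p.
Proof. exact: big_split. Qed.

Lemma cp_sumZ c a p : cp_sum (fun u => c * a u) p = c * cp_sum a p.
Proof. by rewrite /cp_sum mulr_sumr. Qed.

Lemma measurable_cp_sum a : measurable_fun setT a -> measurable_fun setT (cp_sum a).
Proof.
move=> ma.
pose h N (p : cp_space) : R := \sum_(i < N) (i < p.1)%:R * a (p.2 i).
have mh N : measurable_fun setT (h N).
  apply: measurable_sum => i; apply: measurable_funM.
    by apply: (@measurableT_comp _ _ _ _ _ _ (fun n : nat => (i < n)%:R : R)).
  apply: (measurableT_comp ma); apply: (measurableT_comp (measurable_coord i)).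
  exact: measurable_snd.
apply: (measurable_fun_cvg mh) => -[n u] _; apply: cvg_near_cst.
exists n => // N /= nN; rewrite /h /cp_sum /=.
rewrite (big_ord_widen _ (fun i => a (u i)) nN) [RHS]big_mkcond /=.
by apply: eq_bigr => i _; case: ifP; rewrite ?mul1r ?mul0r.
Qed.

Lemma cp_jumpE nu A : (nu setT < +oo)%E -> measurable A ->
  nu A = ((fine (nu setT))%:E * cp_jump nu A)%E.
Proof.
move=> nufin mA.
have nuT : nu setT \is a fin_num by rewrite ge0_fin_numE.
rewrite /cp_jump /= /mnormalize; case: ifPn => [/orP[/eqP n0|/eqP noo]|].
- rewrite n0 /= mul0e; apply/eqP; rewrite eq_le measure_ge0 andbT -n0.
  by rewrite le_measure// inE.
- by rewrite noo in nufin.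
- rewrite negb_or => /andP[n0 _]; rewrite muleC -muleA -EFinM.
  by rewrite mulVf ?mule1// fine_eq0.
Qed.

Lemma Rintegral_cp_jump nu (f : S -> R) : (nu setT < +oo)%E -> bdd f ->
  \int[nu]_u f u = fine (nu setT) * \int[cp_jump nu]_u f u.
Proof.
move=> nufin bf.
have c0 : 0 <= fine (nu setT) by rewrite fine_ge0.
pose m := mscale (NngNum c0) (cp_jump nu).
have E g : (\int[nu]_u g u = \int[m]_u g u)%E.
  by apply: eq_measure_integral => A mA _; rewrite (cp_jumpE nufin mA).
have [mf [M fM]] := bf.
have M0 : 0 <= M by exact: le_trans (fM point).
have bp : bdd (fun u => f u + M) by apply: bddD => //; exact: bdd_cst.
have fp0 u : 0 <= f u + M by have := fM u; rewrite ler_norml; lra.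
have Ifp : \int[nu]_u (f u + M) = fine (nu setT) * \int[cp_jump nu]_u (f u + M).
  rewrite /Rintegral E ge0_integral_mscale//.
  - by rewrite fineM//; exact/integrable_fin_num/prob_integrable.
  - exact/measurable_EFinP/(bp.1).
  - by move=> u _; rewrite lee_fin.
have bM : bdd (cst M : S -> R) by exact: bdd_cst.
move: Ifp; rewrite (RintegralD measurableT (bdd_integrable nufin bf) (bdd_integrable nufin bM)).
rewrite (RintegralD measurableT (prob_integrable (cp_jump nu) bf)
  (prob_integrable (cp_jump nu) bM)).
have Ec : \int[cp_jump nu]_u (cst M : S -> R) u = M.
  by rewrite Rintegral_cst// [X in fine X]probability_setT mulr1.
rewrite Ec (Rintegral_cst nu)//; move: (\int[nu]_u f u) => I; lra.
Qed.

Lemma cintegral_cexp_i (m : {measure set S -> \bar R}) a :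
  (m setT < +oo)%E -> measurable_fun setT a ->
  cintegral m (fun u => cexp ('i%C * (a u)%:C) - 1) =
  (\int[m]_u cos (a u) - fine (m setT)) +i* (\int[m]_u sin (a u)).
Proof.
move=> mfin ma.
rewrite -[X in _ - X]mul1r -(Rintegral_cst m measurableT) -RintegralB//; first last.
- exact/bdd_integrable/bdd_cst.
- exact/bdd_integrable/bdd_cos.
by congr (fine _ +i* fine _); apply: eq_integral => u _;
  rewrite cexp_i /= ?oppr0 ?addr0.
Qed.

Lemma chf_cp_sum nu a : (nu setT < +oo)%E -> measurable_fun setT a ->
  chf (cp_prob nu) (cp_sum a) =
  cexp (cintegral nu (fun u => cexp ('i%C * (a u)%:C) - 1)).
Proof.
move=> nufin ma.
pose c := fine (nu setT); have c0 : 0 <= c by rewrite fine_ge0.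
pose phi := chf (cp_jump nu) a.
have -> : cintegral nu (fun u => cexp ('i%C * (a u)%:C) - 1) = c%:C * phi - c%:C.
  rewrite (cintegral_cexp_i nufin ma) /phi chfE.
  rewrite (Rintegral_cp_jump nufin (bdd_cos ma)) (Rintegral_cp_jump nufin (bdd_sin ma)).
  by simpc.
have ms : measurable_fun setT (cp_sum a) by exact: measurable_cp_sum.
have chfn n : chf (seq_prob (fun _ => cp_jump nu)) (fun u => cp_sum a (n, u)) = phi ^+ n.
  rewrite (chf_seq_sum (fun _ => cp_jump nu) n (f := fun _ => a))//.
  by rewrite prodr_const card_ord.
have ms1 n : measurable_fun setT (fun u => cp_sum a (n, u)).
  by apply: (measurableT_comp ms); exact: measurable_pair1.
have bRe : bdd (fun n => complex.Re (phi ^+ n)).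
  split => //; exists 1 => n; rewrite -chfn chfE /=.
  by apply: norm_Rintegral_le => [|u]; [exact: (bdd_cos (ms1 n)).1|exact: cos_max].
have bIm : bdd (fun n => complex.Im (phi ^+ n)).
  split => //; exists 1 => n; rewrite -chfn chfE /=.
  by apply: norm_Rintegral_le => [|u]; [exact: (bdd_sin (ms1 n)).1|exact: sin_max].
have [cRe cIm] := cvg_cexp_series (c%:C * phi).
have ReM (r : R) (z : R[i]) : complex.Re (r%:C * z) = r * complex.Re z.
  by case: z => x y /=; rewrite mul0r subr0.
have ImM (r : R) (z : R[i]) : complex.Im (r%:C * z) = r * complex.Im z.
  by case: z => x y /=; rewrite mul0r addr0.
have cX n : (c%:C * phi) ^+ n = (c ^+ n)%:C * phi ^+ n by rewrite exprMn rmorphXn.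
have cexpc z : cexp (z - c%:C) = (expR (- c))%:C * cexp z.
  rewrite cexpD mulrC; congr (_ * _).
  by rewrite /cexp /= oppr0 cos0 sin0 -complexr0; simpc.
rewrite cexpc chfE; apply/eqP; rewrite eq_complex ReM ImM; apply/andP; split; apply/eqP.
- rewrite (Rintegral_prod _ _ (bdd_cos ms)).
  transitivity (\int[poisson_prob c 0%N]_n complex.Re (phi ^+ n)).
    by apply: eq_Rintegral => n _; rewrite -chfn chfE.
  have L1 := @Rintegral_nat R (poisson_prob c 0%N) _ bRe.
  have L2 : expR (- c) * psum (fun n => complex.Re ((c%:C * phi) ^+ n)) N 1
      @[N --> \oo] --> expR (- c) * complex.Re (cexp (c%:C * phi)).
    by apply: cvgM => //; exact: cvg_cst.
  suff E : (fun N => \sum_(n < N) complex.Re (phi ^+ n) *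
      fine (poisson_prob c 0%N [set (n : nat)])) = fun N => expR (- c) *
      psum (fun n => complex.Re ((c%:C * phi) ^+ n)) N 1.
    by move: L1; rewrite E => L1; exact: (cvg_unique (@Rhausdorff R) L1 L2).
  apply/funext => N; rewrite /psum mulr_sumr; apply: eq_bigr => n _.
  by rewrite poisson_prob1// cX ReM expr1n; ring.
- rewrite (Rintegral_prod _ _ (bdd_sin ms)).
  transitivity (\int[poisson_prob c 0%N]_n complex.Im (phi ^+ n)).
    by apply: eq_Rintegral => n _; rewrite -chfn chfE.
  have L1 := @Rintegral_nat R (poisson_prob c 0%N) _ bIm.
  have L2 : expR (- c) * psum (fun n => complex.Im ((c%:C * phi) ^+ n)) N 1
      @[N --> \oo] --> expR (- c) * complex.Im (cexp (c%:C * phi)).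
    by apply: cvgM => //; exact: cvg_cst.
  suff E : (fun N => \sum_(n < N) complex.Im (phi ^+ n) *
      fine (poisson_prob c 0%N [set (n : nat)])) = fun N => expR (- c) *
      psum (fun n => complex.Im ((c%:C * phi) ^+ n)) N 1.
    by move: L1; rewrite E => L1; exact: (cvg_unique (@Rhausdorff R) L1 L2).
  apply/funext => N; rewrite /psum mulr_sumr; apply: eq_bigr => n _.
  by rewrite poisson_prob1// cX ImM expr1n; ring.
Qed.

End compound_poisson.

(** * Estimates and limits *)

Section trigonometric_estimates.
Context {R : realType}.
Implicit Types s x y : R.

Lemma le_norm_sin s : `|sin s| <= `|s|.
Proof.
wlog s0 : s / 0 <= s.
  move=> W; have [/W//|/ltW s0] := leP 0 s.
  by have := W (- s); rewrite oppr_ge0 sinN !normrN; apply.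
have [c _] := @MVT_segment R sin cos 0 s s0
  (fun x _ => is_derive_sin x)
  (continuous_subspaceT (@continuous_sin R)).
by rewrite sin0 !subr0 => ->; rewrite normrM ler_piMl// cos_max.
Qed.

Lemma one_sub_cosE s : 1 - cos s = 2 * sin (s / 2) ^+ 2.
Proof.
have -> : cos s = 1 - 2 * sin (s / 2) ^+ 2; last by ring.
rewrite [in LHS](_ : s = (s / 2) *+ 2); last by rewrite -mulr_natr divfK.
by rewrite cos_mulr2n cos2sin2; ring.
Qed.

Lemma one_sub_cos_ge0 s : 0 <= 1 - cos s.
Proof. by rewrite subr_ge0 cos_le1. Qed.

Lemma one_sub_cos_le_sqr s : 1 - cos s <= s ^+ 2 / 2.
Proof.
rewrite one_sub_cosE -(real_normK (num_real (sin _))) -(real_normK (num_real s)).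
have := le_norm_sin (s / 2); rewrite normrM [`|2^-1|]ger0_norm//.
have := normr_ge0 (sin (s / 2)); have := normr_ge0 s.
by move: `|sin (s / 2)| `|s| => u v; nra.
Qed.

Lemma one_sub_cos_le_norm s : 1 - cos s <= `|s|.
Proof.
have := one_sub_cos_le_sqr s; have := cos_geN1 s.
rewrite -(real_normK (num_real s)); have := normr_ge0 s.
by move: (`|s|) (cos s) => u v; have [|] := leP u 2; nra.
Qed.

Lemma sqr_le_one_sub_cos s : `|s| <= 1 -> s ^+ 2 <= 8 * (1 - cos s).
Proof.
move=> s1; rewrite one_sub_cosE.
suff : `|s| / 4 <= `|sin (s / 2)|.
  rewrite -(real_normK (num_real s)) -(real_normK (num_real (sin _))).
  by have := normr_ge0 s; move: `|sin (s / 2)| `|s| => u v; nra.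
wlog s0 : s s1 / 0 <= s.
  move=> W; have [/(W _ s1)//|/ltW s0] := leP 0 s.
  have := W (- s); rewrite oppr_ge0 mulNr sinN !normrN; exact.
have s20 : 0 <= s / 2 by lra.
have [c] := @MVT_segment R sin cos 0 (s / 2) s20
  (fun x _ => is_derive_sin x)
  (continuous_subspaceT (@continuous_sin R)).
rewrite in_itv/= => /andP[c0 cs]; rewrite sin0 !subr0 => ->.
move: s1; rewrite ger0_norm// => s1.
have cc := one_sub_cos_le_norm c; rewrite ger0_norm// in cc.
have c2 : 2^-1 <= cos c by lra.
by rewrite ger0_norm; nra.
Qed.

Lemma sin_sub_id_le s : `|sin s - s| <= 2 * s ^+ 2.
Proof.
have sqr := real_normK (num_real s).
have [s1|s1] := leP `|s| 1; last first.
  rewrite (le_trans (ler_normB _ _))// -sqr.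
  by have := le_norm_sin s; have := normr_ge0 s; move: (`|s|) s1 => u; nra.
suff : `|sin s - s| <= `|s| ^+ 2 by rewrite sqr; have := sqr_ge0 s; lra.
wlog s0 : s s1 {sqr} / 0 <= s.
  move=> W; have [/(W _ s1)//|/ltW s0] := leP 0 s.
  by have := W (- s); rewrite oppr_ge0 sinN -opprD !normrN; apply.
have cont : {within `[0, s], continuous (sin - id : R -> R)}.
  apply: continuous_subspaceT => x; apply: cvgB; first exact: continuous_sin.
  exact: cvg_id.
have [c] := @MVT_segment R (sin - id) (fun x => cos x - 1) 0 s s0
  (fun x _ => is_deriveB (is_derive_sin x) (is_derive_id x 1)) cont.
rewrite in_itv/= => /andP[c0 cs]; rewrite /= !fctE /= sin0 !subr0 => ->.
rewrite normrM expr2 ler_wpM2r// distrC ger0_norm ?one_sub_cos_ge0//.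
by rewrite (le_trans (one_sub_cos_le_norm c))// !ger0_norm.
Qed.

Lemma lipschitz_cos x y : `|cos x - cos y| <= `|x - y|.
Proof.
wlog xy : x y / y <= x.
  move=> W; have [/W//|/ltW/W] := leP y x.
  by rewrite distrC [`|y - x|]distrC.
have [c _ ->] := @MVT_segment R cos (fun x => - sin x) y x xy
  (fun z _ => is_derive_cos z)
  (continuous_subspaceT (@continuous_cos R)).
by rewrite normrM normrN ler_piMl// sin_max.
Qed.

Lemma lipschitz_sin x y : `|sin x - sin y| <= `|x - y|.
Proof.
wlog xy : x y / y <= x.
  move=> W; have [/W//|/ltW/W] := leP y x.
  by rewrite distrC [`|y - x|]distrC.
have [c _ ->] := @MVT_segment R sin cos y x xy
  (fun z _ => is_derive_sin z)
  (continuous_subspaceT (@continuous_sin R)).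
by rewrite normrM ler_piMl// cos_max.
Qed.

Lemma one_sub_Re_cexp_le (z : R[i]) : complex.Re z <= 0 ->
  1 - complex.Re (cexp z) <= - complex.Re z + `|complex.Im z|.
Proof.
case: z => x y /= x0; rewrite mul0r subr0.
have ex1 : expR x <= 1 by rewrite -expR0 ler_expR.
have ex : 1 + x <= expR x := expR_ge1Dx x.
have := one_sub_cos_le_norm y; have := one_sub_cos_ge0 y; have := expR_gt0 x.
by move: (expR x) (cos y) `|y| ex1 ex => e c n; nra.
Qed.

End trigonometric_estimates.

Section limits.
Context d (T : measurableType d) (R : realType).
Local Open Scope ereal_scope.

Lemma fatou_le (m : {measure set T -> \bar R}) (f : nat -> T -> \bar R)
    (g : T -> \bar R) (C : \bar R) :
  (forall n, measurable_fun setT (f n)) -> (forall n x, 0 <= f n x) ->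
  (forall x, f n x @[n --> \oo] --> g x) ->
  (\forall n \near \oo, \int[m]_x f n x <= C) -> \int[m]_x g x <= C.
Proof.
move=> mf f0 fg fC.
rewrite (_ : g = fun x => limn_einf (f^~ x)); last first.
  by apply/funext => x; rewrite (cvg_limn_einf_sup (fg x)).1.
apply: le_trans (fatou m measurableT mf (fun n x _ => f0 n x)) _.
rewrite limn_einf_lim; apply: lime_le; first exact: is_cvg_einfs.
near=> n; apply: le_trans (_ : \int[m]_x f n x <= _); last by near: n.
by apply: ereal_inf_lbound; exists n => /=.
Unshelve. all: by end_near. Qed.

Variable P : probability T R.

(* E Z^2 is the limit of E [Z^2; |Z| <= n], and on |Z| <= n one has
   Z^2 <= 8 n^2 (1 - cos (Z / n)). *)
Lemma second_moment_le (Z : T -> R) (V : R) : measurable_fun setT Z -> (0 <= V)%R ->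
  (forall t, 1 - complex.Re (chf P (fun x => (t * Z x)%R)) <= t ^+ 2 * V)%R ->
  \int[P]_x (Z x ^+ 2)%:E <= (8 * V)%:E.
Proof.
move=> mZ V0 HV.
pose f n x : \bar R := if (`|Z x| <= n.+1%:R)%R then (Z x ^+ 2)%:E else 0.
have mnZ : measurable_fun setT (fun x => `|Z x|)%R by exact: measurableT_comp.
apply: (@fatou_le P f).
- move=> n; apply: measurable_fun_ifT => //; last first.
    exact/measurable_EFinP/measurable_funX.
  by apply: measurable_fun_ler.
- by move=> n x; rewrite /f; case: ifP => // _; rewrite lee_fin sqr_ge0.
- move=> x; apply: cvg_near_cst.
  have [N _ HN] := nbhs_infty_gtr `|Z x|%R.
  exists N => // n /= Nn; rewrite /f ifT// ltW// (lt_le_trans (HN _ Nn))//.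
  by rewrite ler_nat.
- apply: nearW => n; pose t : R := (n.+1%:R^-1)%R.
  have n0 : (0 < n.+1%:R :> R)%R by rewrite ltr0n.
  have t0 : (0 < t)%R by rewrite invr_gt0.
  have mtZ : measurable_fun setT (fun x => t * Z x)%R by exact: measurable_funM.
  have bc : bdd (fun x => 1 - cos (t * Z x))%R.
    by apply: bddB; [exact: bdd_cst|exact: bdd_cos].
  apply: (@le_trans _ _ (\int[P]_x (8 * n.+1%:R ^+ 2 * (1 - cos (t * Z x)))%R%:E)).
    apply: ge0_le_integral => //.
    + by move=> x _; rewrite /f; case: ifP => // _; rewrite lee_fin sqr_ge0.
    + apply: measurable_fun_ifT => //; first exact: measurable_fun_ler.
      exact/measurable_EFinP/measurable_funX.
    + exact/measurable_EFinP/(bddZ _ bc).1.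
    + move=> x _; rewrite /f; case: ifP => [Zn|_]; last first.
        by rewrite lee_fin !mulr_ge0// ?one_sub_cos_ge0// sqr_ge0.
      rewrite lee_fin mulrAC -mulrA.
      have := @sqr_le_one_sub_cos R (t * Z x).
      rewrite normrM gtr0_norm// /t mulrC ler_pdivrMr// mul1r => /(_ Zn).
      rewrite exprMn exprVn mulrC -ler_pdivlMr ?invr_gt0 ?exprn_gt0// invrK.
      by rewrite -mulrA => /le_trans; apply; rewrite mulrA.
  have I8 := prob_integrable P (bddZ (8 * n.+1%:R ^+ 2) bc).
  rewrite -[leLHS]fineK ?integrable_fin_num// lee_fin.
  rewrite -/(Rintegral P setT (fun x => 8 * n.+1%:R ^+ 2 * (1 - cos (t * Z x))))%R.
  rewrite RintegralZl//; last exact: prob_integrable.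
  rewrite RintegralB//; [|exact/prob_integrable/bdd_cst|exact/prob_integrable/bdd_cos].
  have -> : (\int[P]_x (1 : R) = 1)%R.
    by rewrite Rintegral_cst// [X in fine X]probability_setT mulr1.
  have := HV t; rewrite chfE /= => HVt.
  apply: (@le_trans _ _ (8 * n.+1%:R ^+ 2 * (t ^+ 2 * V))%R).
    by rewrite ler_wpM2l// mulr_ge0// sqr_ge0.
  have -> : (t ^+ 2 = (n.+1%:R ^+ 2)^-1)%R by rewrite exprVn.
  by rewrite mulrA mulfK// expf_neq0// gt_eqF.
Qed.

Lemma first_moment_le (Z : T -> R) (V eta : R) : measurable_fun setT Z -> (0 < eta)%R ->
  \int[P]_x (Z x ^+ 2)%:E <= V%:E -> \int[P]_x `|Z x|%:E <= (eta + V / eta)%:E.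
Proof.
move=> mZ eta0 ZV.
apply: (@le_trans _ _ (\int[P]_x (eta%:E + eta^-1%:E * (Z x ^+ 2)%:E))).
  apply: ge0_le_integral => //.
  - exact/measurable_EFinP/measurableT_comp.
  - apply: emeasurable_funD => //; apply/measurable_EFinP/measurable_funM => //.
    exact: measurable_funX.
  - move=> x _; rewrite -EFinM -EFinD lee_fin [(eta^-1 * _)%R]mulrC.
    rewrite -[in leRHS](real_normK (num_real (Z x))).
    have [Ze|Ze] := leP `|Z x|%R eta.
      by rewrite (le_trans Ze)// lerDl divr_ge0 ?sqr_ge0// ltW.
    apply: (@le_trans _ _ (`|Z x| ^+ 2 / eta)%R); last by rewrite lerDr ltW.
    by rewrite ler_pdivlMr// expr2 ler_wpM2l// ltW.
rewrite ge0_integralD//; last 3 first.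
- by move=> x _; rewrite lee_fin ltW.
- by move=> x _; rewrite -EFinM lee_fin mulr_ge0 ?sqr_ge0// invr_ge0 ltW.
- apply/measurable_EFinP/measurable_funM => //; exact: measurable_funX.
rewrite integral_cst// [X in _ * X]probability_setT mule1 EFinD leeD2l//.
rewrite ge0_integralZl_EFin//; last 3 first.
- by move=> x _; rewrite lee_fin sqr_ge0.
- exact/measurable_EFinP/measurable_funX.
- by rewrite invr_ge0 ltW.
by rewrite mulrC EFinM lee_wpmul2l// lee_fin invr_ge0 ltW.
Qed.

End limits.

Section L1.
Context d (T : measurableType d) (R : realType) (P : probability T R).
Local Open Scope ereal_scope.
Implicit Types f g : T -> R.

Definition L1dist f g := \int[P]_x `|f x - g x|%:E.

Definition L1cvg (f : nat -> T -> R) g := forall e : R, (0 < e)%R ->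
  exists N, forall n, (N <= n)%N -> L1dist (f n) g <= e%:E.

Lemma measurable_dist f g : measurable_fun setT f -> measurable_fun setT g ->
  measurable_fun setT (fun x => `|f x - g x|%:E).
Proof.
move=> mf mg; apply/measurable_EFinP; apply: measurableT_comp => //.
exact: measurable_funB.
Qed.

Lemma L1dist_ge0 f g : 0 <= L1dist f g.
Proof. by apply: integral_ge0 => x _; rewrite lee_fin. Qed.

Lemma L1distC f g : L1dist f g = L1dist g f.
Proof. by apply: eq_integral => x _; rewrite distrC. Qed.

Lemma L1dist_triangle h f g : measurable_fun setT f -> measurable_fun setT g ->
  measurable_fun setT h -> L1dist f g <= L1dist f h + L1dist h g.
Proof.
move=> mf mg mh; rewrite /L1dist -ge0_integralD//; try exact: measurable_dist.
apply: ge0_le_integral => //; first exact: measurable_dist.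
  by apply: emeasurable_funD; exact: measurable_dist.
by move=> x _; rewrite -EFinD lee_fin (le_trans _ (ler_normD _ _))// addrA subrK.
Qed.

Lemma L1dist_eq0 f g : measurable_fun setT f -> measurable_fun setT g ->
  L1dist f g = 0 -> P [set x | f x != g x] = 0.
Proof.
move=> mf mg fg0.
have mfg : measurable_fun setT (fun x => (f x - g x)%:E).
  by apply/measurable_EFinP; exact: measurable_funB.
have [+ _] := ae_eq_integral_abs P measurableT mfg.
move=> /(_ fg0) [N [mN PN0 HN]].
apply/eqP; rewrite eq_le measure_ge0 andbT -PN0 le_measure ?inE//.
  rewrite (_ : [set x | _] = (f \- g)%R @^-1` [set~ 0%R]).
    rewrite -[X in measurable X]setTI; apply: (measurable_funB mf mg) => //.
    exact: measurableC.
  by apply/seteqP; split => x /=; rewrite -subr_eq0 => /eqP.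
move=> x /= fgx; apply: HN => /= /(_ I) [] /eqP.
by rewrite subr_eq0; exact/negP.
Qed.

Lemma L1_complete (f : nat -> T -> R) : (forall n, measurable_fun setT (f n)) ->
  (forall e : R, (0 < e)%R -> exists N, forall m n, (N <= m)%N -> (N <= n)%N ->
    L1dist (f m) (f n) <= e%:E) ->
  exists2 g, measurable_fun setT g & L1cvg f g.
Proof.
move=> mf cauchy.
have e0 j : (0 < 2^-1 ^+ j :> R)%R by rewrite exprn_gt0.
have [ph phP] := choice (fun j => cauchy _ (e0 j)).
pose phi j := (\sum_(i < j.+1) ph i)%N.
have phi_ge j : (ph j <= phi j)%N by rewrite /phi big_ord_recr /= leq_addl.
have phi_mono j : (phi j <= phi j.+1)%N by rewrite [leqRHS]/phi big_ord_recr /= leq_addr.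
pose D j x := (f (phi j.+1) x - f (phi j) x)%R.
have mD j : measurable_fun setT (D j) by exact: measurable_funB.
have mDe j : measurable_fun setT (fun x => `|D j x|%:E) by exact: measurable_dist.
pose H x := \sum_(j <oo) `|D j x|%:E.
have mH : measurable_fun setT H.
  by apply: ge0_emeasurable_sum => // j x _ _; rewrite lee_fin.
have H0 x : 0 <= H x by apply: nneseries_ge0 => j _ _; rewrite lee_fin.
have IH : \int[P]_x H x < +oo.
  rewrite integral_nneseries//.
  apply: (@le_lt_trans _ _ (\sum_(j <oo) (2^-1 ^+ j)%:E)).
    apply: lee_nneseries => j *; first by apply: integral_ge0 => x _; rewrite lee_fin.
    by apply: phP; rewrite ?phi_ge// (leq_trans (phi_ge _)).
  have cg : (series (geometric (1 : R) 2^-1) n)%:E @[n --> \oo] --> ((1 - 2^-1)^-1)%:E.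
    apply: cvg_EFin; first exact: nearW.
    have := @cvg_geometric_series R 1 2^-1; rewrite mul1r; apply.
    by rewrite ger0_norm// invf_lt1// ltr1n.
  rewrite (_ : limn _ = ((1 - 2^-1)^-1)%:E) ?ltry//.
  apply/cvg_lim => //.
  rewrite (_ : (fun n => _) = (fun n => (series (geometric (1 : R) 2^-1) n)%:E))//.
  apply/funext => n; rewrite /series /= sumEFin; congr EFin.
  by apply: eq_bigr => i _; rewrite mul1r.
have iH : P.-integrable setT H.
  by apply/integrableP; split => //; under eq_integral do rewrite gee0_abs//.
pose A := [set x | H x < +oo].
have mA : measurable A by rewrite -[A]setTI; exact: emeasurable_fun_infty_o.
have PA0 : P (~` A) = 0.
  have [N [mN PN0 HN]] := integrable_ae measurableT iH.
  apply/eqP; rewrite eq_le measure_ge0 andbT -PN0 le_measure ?inE//.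
    exact: measurableC.
  move=> x /= nAx; apply: HN => /= /(_ I) Hfin; apply: nAx.
  by rewrite /A /= ltey_eq Hfin.
pose h j x := (f (phi j) x * \1_A x)%R.
have mh j : measurable_fun setT (h j).
  by apply: measurable_funM => //; exact: measurable_indic.
have ch x : cvgn (h ^~ x).
  have [|nAx] := boolP (x \in A); last first.
    rewrite (_ : h ^~ x = cst 0%R); first exact: is_cvg_cst.
    by apply/funext => j; rewrite /h indicE (negbTE nAx) mulr0.
  rewrite inE => Ax; rewrite (_ : h ^~ x = fun j => f (phi j) x); last first.
    by apply/funext => j; rewrite /h indicE mem_set// mulr1.
  have Hx : H x < +oo := Ax.
  have nc : cvgn (series (fun k => `|D k x|%R)).
    apply: nondecreasing_is_cvgn.
      by apply/nondecreasing_seqP => n; rewrite /series /= big_nat_recr//= lerDl.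
    exists (fine (H x)) => _ [n _ <-].
    rewrite -lee_fin fineK; last by rewrite ge0_fin_numE.
    rewrite /series /= -sumEFin; apply: nneseries_lim_ge => i _ _.
    by rewrite lee_fin.
  have sc := normed_cvg nc.
  have E : (fun j => f (phi j) x) = (fun j => f (phi 0%N) x + series (D ^~ x) j)%R.
    apply/funext => j; rewrite /series /= /D.
    by rewrite (telescope_sumr _ (leq0n j)) addrC subrK.
  by rewrite E; apply: is_cvgD => //; exact: is_cvg_cst.
pose g x := limn (h ^~ x).
have hg x : h j x @[j --> \oo] --> g x by exact: ch.
have mg : measurable_fun setT g by exact: (measurable_fun_cvg mh (fun x _ => hg x)).
exists g => //.
have bound j n : (ph j <= n)%N -> L1dist (f n) g <= (2^-1 ^+ j)%:E.
  move=> jn; rewrite /L1dist.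
  rewrite (ge0_negligible_integral (measurableC mA))//; last exact: measurable_dist.
  rewrite setTD setCK integral_mkcond.
  have mfd k : measurable_fun setT (fun x => `|f n x - f (phi k) x|%R).
    by apply: measurableT_comp => //; exact: measurable_funB.
  pose F k x := (`|f n x - f (phi k) x| * \1_A x)%:E.
  apply: (@fatou_le _ _ _ P F).
  - move=> k; apply/measurable_EFinP; apply: measurable_funM; last exact: measurable_indic.
    exact: mfd.
  - by move=> k x; rewrite lee_fin mulr_ge0.
  - move=> x.
    have -> : ((fun y => `|f n y - g y|%:E) \_ A) x = (`|f n x * \1_A x - g x * \1_A x|%R)%:E.
      rewrite patchE indicE; case: (x \in A); first by rewrite !mulr1.
      by rewrite !mulr0 subrr normr0.
    apply: cvg_EFin; first exact: nearW.
    rewrite (_ : _ \o _ = fun k => `|f n x * \1_A x - h k x * \1_A x|%R).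
      apply: cvg_norm; apply: cvgB; first exact: cvg_cst.
      by apply: cvgM; [exact: hg|exact: cvg_cst].
    apply/funext => k /=; rewrite /h indicE; case: (x \in A); first by rewrite !mulr1.
    by rewrite !mulr0 subrr normr0.
  - exists j => // k /= jk.
    apply: (@le_trans _ _ (L1dist (f n) (f (phi k)))); last first.
      apply: phP => //; apply: leq_trans (phi_ge j) _.
      by elim: k jk => [|k IHk]; [rewrite leqn0 => /eqP ->|rewrite leq_eqVlt =>
        /predU1P[->//|/IHk/leq_trans]; apply].
    apply: ge0_le_integral => //.
    + by move=> x _; rewrite lee_fin mulr_ge0.
    + apply/measurable_EFinP; apply: measurable_funM; last exact: measurable_indic.
      exact: mfd.
    + exact: measurable_dist.
    + by move=> x _; rewrite lee_fin ler_piMr// indicE -[leRHS]/(1%:R)%R ler_nat leq_b1.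
move=> e epos.
have [N _ HN] : \forall j \near \oo, (2^-1 ^+ j < e :> R)%R.
  have := @cvg_expr R 2^-1; rewrite ger0_norm// invf_lt1// ltr1n => /(_ isT).
  by move/cvgr_lt; apply.
exists (ph N) => n Nn; apply: le_trans (bound _ _ Nn) _.
by rewrite lee_fin ltW// HN /=.
Qed.

End L1.

Section restricted_measure.
Context d (S : measurableType d) (R : realType) (nu : {measure set S -> \bar R}).
Variables (D : set S) (mD : measurable D).
Local Open Scope ereal_scope.

Lemma ge0_integral_mrestr (f : S -> \bar R) : measurable_fun setT f ->
  (forall x, 0 <= f x) -> \int[mrestr nu mD]_x f x = \int[nu]_(x in D) f x.
Proof.
move=> mf f0; have mDC := measurableC mD.
have E : \int[nu]_(x in D) f x =
    \int[measure_add (mrestr nu mD) (mrestr nu mDC)]_(x in D) f x.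
  apply: eq_measure_integral => A mA _; rewrite [RHS]measure_addE /= /mrestr.
  rewrite -measureU; [|exact: measurableI|exact: measurableI|].
    by rewrite -setIUr setUCr setIT.
  by rewrite setIACA setICr setI0.
have mfD : measurable_fun D f by exact: measurable_funTS.
rewrite E ge0_integral_measure_add//.
rewrite [X in _ = _ + X](_ : _ = 0) ?adde0; last first.
  rewrite (@ge0_negligible_integral _ _ _ _ _ D)//; last first.
    by rewrite /= /mrestr setICr measure0.
  by rewrite setDv integral_set0.
rewrite (@ge0_negligible_integral _ _ _ _ setT (~` D))//; last first.
  by rewrite /= /mrestr setICl measure0.
by rewrite setTD setCK.
Qed.

Lemma Rintegral_mrestr (f : S -> R) : measurable_fun setT f ->
  (\int[mrestr nu mD]_x f x = \int[nu]_(x in D) f x)%R.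
Proof.
move=> mf; rewrite /Rintegral integralE [in RHS]integralE.
have mfe : measurable_fun setT (EFin \o f) by exact/measurable_EFinP.
by rewrite !ge0_integral_mrestr//; [exact: measurable_funeneg|exact: measurable_funepos].
Qed.

End restricted_measure.

Section chf_limits.
Context d (T : measurableType d) (R : realType) (P : probability T R).
Local Open Scope complex_scope.

Lemma chf_shift (f : T -> R) (c : R) : measurable_fun setT f ->
  chf P (fun x => f x + c) = chf P f * cexp ('i%C * c%:C).
Proof.
move=> mf; have cf := prob_integrable P (bdd_cos mf).
have sf := prob_integrable P (bdd_sin mf).
have Z (k : R) (g : T -> R) : P.-integrable setT (EFin \o g) ->
    P.-integrable setT (EFin \o (fun x => g x * k)).
  move=> ig; rewrite (_ : EFin \o _ = (fun x => k%:E * (EFin \o g) x)%E).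
    exact: integrableZl.
  by apply/funext => x; exact: (congr1 EFin (mulrC (g x) k)).
rewrite !chfE cexp_i; simpc; congr (_ +i* _).
  under eq_Rintegral do rewrite cosD.
  by rewrite RintegralB ?RintegralZr//; exact: Z.
under eq_Rintegral do rewrite sinD.
by rewrite RintegralD ?RintegralZr// 1?addrC//; exact: Z.
Qed.

Lemma chf_L1cvg (f : nat -> T -> R) (g : T -> R) :
  (forall n, measurable_fun setT (f n)) -> measurable_fun setT g -> L1cvg P f g ->
  complex.Re (chf P (f n)) @[n --> \oo] --> complex.Re (chf P g) /\
  complex.Im (chf P (f n)) @[n --> \oo] --> complex.Im (chf P g).
Proof.
move=> mf mg fg.
have aux (u : R -> R) : (forall s t, `|u s - u t| <= `|s - t|) ->
    (forall h : T -> R, measurable_fun setT h -> bdd (fun x => u (h x))) ->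
    \int[P]_x u (f n x) @[n --> \oo] --> \int[P]_x u (g x).
  move=> lip bu; apply/cvgrPdist_le => e e0.
  have [N HN] := fg e e0; exists N => // n /= Nn.
  rewrite -RintegralB//; [|exact/prob_integrable/bu|exact/prob_integrable/bu].
  have bd : bdd (fun x => u (g x) - u (f n x)) by apply: bddB; exact: bu.
  rewrite (le_trans (le_normr_Rintegral measurableT (prob_integrable P bd)))//.
  have bdn : bdd (fun x => `|u (g x) - u (f n x)|).
    split; first exact: measurableT_comp bd.1.
    by have [_ [M HM]] := bd; exists M => x; rewrite normr_id.
  rewrite -lee_fin fineK; last exact/integrable_fin_num/prob_integrable.
  apply: le_trans (HN _ Nn); rewrite L1distC; apply: ge0_le_integral => //.
  - exact/measurable_EFinP/bdn.1.
  - exact: measurable_dist.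
  - by move=> x _; rewrite lee_fin lip.
have ReE h : complex.Re (chf P h) = \int[P]_x cos (h x) by rewrite chfE.
have ImE h : complex.Im (chf P h) = \int[P]_x sin (h x) by rewrite chfE.
split.
- rewrite ReE; under eq_cvg do rewrite ReE.
  exact: (aux cos (@lipschitz_cos R) (fun h mh => bdd_cos mh)).
- rewrite ImE; under eq_cvg do rewrite ImE.
  exact: (aux sin (@lipschitz_sin R) (fun h mh => bdd_sin mh)).
Qed.

Lemma cvg_cexp (z : nat -> R[i]) (l : R[i]) :
  complex.Re (z n) @[n --> \oo] --> complex.Re l ->
  complex.Im (z n) @[n --> \oo] --> complex.Im l ->
  complex.Re (cexp (z n)) @[n --> \oo] --> complex.Re (cexp l) /\
  complex.Im (cexp (z n)) @[n --> \oo] --> complex.Im (cexp l).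
Proof.
move=> zr zi.
have er : expR (complex.Re (z n)) @[n --> \oo] --> expR (complex.Re l).
  by apply: continuous_cvg zr; exact: continuous_expR.
have cz : cos (complex.Im (z n)) @[n --> \oo] --> cos (complex.Im l).
  by apply: continuous_cvg zi; exact: continuous_cos.
have sz : sin (complex.Im (z n)) @[n --> \oo] --> sin (complex.Im l).
  by apply: continuous_cvg zi; exact: continuous_sin.
have ReE w : complex.Re (@cexp R w) = expR (complex.Re w) * cos (complex.Im w).
  by rewrite /cexp /= mul0r subr0.
have ImE w : complex.Im (@cexp R w) = expR (complex.Re w) * sin (complex.Im w).
  by rewrite /cexp /= mul0r addr0.
by split; [rewrite ReE; under eq_cvg do rewrite ReE|rewrite ImE; under eq_cvg do rewrite ImE];
  exact: cvgM.
Qed.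

End chf_limits.

Lemma sigma_finite_pieces d (S : measurableType d) (R : realType)
    (nu : {measure set S -> \bar R}) (B : set S) :
  sigma_finite setT nu -> measurable B -> (nu (~` B) < +oo)%E ->
  exists G : nat -> set S, [/\ G 0%N = ~` B, forall k, G k.+1 `<=` B,
    forall k, measurable (G k) /\ (nu (G k) < +oo)%E, trivIset setT G
    & \bigcup_k G k = setT].
Proof.
move=> [F FT Ffin] mB nuBC.
have mF k : measurable (F k) by case: (Ffin k).
have mD k : measurable (seqDU F k).
  by apply: measurableD => //; apply: bigsetU_measurable.
exists (fun k => if k is k'.+1 then seqDU F k' `&` B else ~` B); split => //.
- by move=> [|k]; split; [exact: measurableC|by []|exact: measurableI|
    apply: le_lt_trans (Ffin k).2; apply: le_measure; rewrite ?inE//;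
    [exact: measurableI|move=> x [[]]]].
- apply/trivIsetP => -[|i] [|j] _ _ //= ij.
  + by rewrite setICA setICl setI0.
  + by rewrite -setIA setICr setI0.
  + rewrite setIACA; have /trivIsetP := trivIset_seqDU F.
    by move=> /(_ i j I I) ->//; rewrite set0I.
- apply/seteqP; split => // x _; have [Bx|nBx] := pselect (B x); last by exists 0%N.
  have : (\bigcup_k seqDU F k) x by rewrite -seqDU_bigcup_eq -FT.
  by move=> [k _ Fx]; exists k.+1.
Qed.

(** * The compensated Poisson integral *)

Section square_integrable.
Context d (S : measurableType d) (R : realType).
Variables (nu : {measure set S -> \bar R}) (B : set S).
Hypothesis mB : measurable B.
Implicit Types a b : S -> R.

Definition adm a := measurable_fun setT a /\
  nu.-integrable setT (fun u => (a u ^+ 2 * \1_B u)%:E).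

Definition csq a A : R := \int[nu]_(u in A) (a u ^+ 2 * \1_B u).

Lemma measurable_sqB a : measurable_fun setT a ->
  measurable_fun setT (fun u => a u ^+ 2 * \1_B u).
Proof.
by move=> ma; apply: measurable_funM; [exact: measurable_funX|exact: measurable_indic].
Qed.

Lemma sqB_ge0 a u : 0 <= a u ^+ 2 * \1_B u.
Proof. by rewrite mulr_ge0 ?sqr_ge0. Qed.

Lemma admZ c a : adm a -> adm (fun u => c * a u).
Proof.
move=> [ma ia]; split; first exact: measurable_funM.
rewrite (_ : (fun u => _) = (fun u => (c ^+ 2)%:E * (a u ^+ 2 * \1_B u)%:E)%E).
  exact: integrableZl.
by apply/funext => u; rewrite exprMn -mulrA.
Qed.

Lemma admD a b : adm a -> adm b -> adm (fun u => a u + b u).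
Proof.
move=> [ma ia] [mb ib]; split; first exact: measurable_funD.
have ig : nu.-integrable setT (EFin \o (fun u =>
    2 * (a u ^+ 2 * \1_B u) + 2 * (b u ^+ 2 * \1_B u))).
  rewrite (_ : _ \o _ = ((fun u => 2%:E * (a u ^+ 2 * \1_B u)%:E) \+
    (fun u => 2%:E * (b u ^+ 2 * \1_B u)%:E))%E)//.
  by apply: integrableD => //; exact: integrableZl.
apply: (le_integrable measurableT _ _ ig).
  by apply/measurable_EFinP; apply: measurable_sqB; exact: measurable_funD.
move=> u _ /=.
have h1 : 0 <= (a u + b u) ^+ 2 * \1_B u by rewrite mulr_ge0 ?sqr_ge0.
have h2 : 0 <= 2 * (a u ^+ 2 * \1_B u) + 2 * (b u ^+ 2 * \1_B u).
  by rewrite addr_ge0// mulr_ge0// sqB_ge0.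
rewrite lee_fin (ger0_norm h1) (ger0_norm h2) !mulrA -mulrDl ler_wpM2r//.
by have := sqr_ge0 (a u - b u); rewrite sqrrB sqrrD; lra.
Qed.

Lemma adm_scaleD c a b : adm a -> adm b -> adm (fun u => a u + c * b u).
Proof. by move=> aa ab; apply: admD => //; exact: admZ. Qed.

Lemma csq_ge0 a A : 0 <= csq a A.
Proof. by apply: Rintegral_ge0 => u _; exact: sqB_ge0. Qed.

Lemma le_csq a A A' : adm a -> measurable A -> measurable A' -> A `<=` A' ->
  csq a A <= csq a A'.
Proof.
move=> [ma ia] mA mA' AA'; apply: fine_le.
- by apply: integrable_fin_num => //; exact: integrableS ia.
- by apply: integrable_fin_num => //; exact: integrableS ia.
- apply: ge0_subset_integral => //.
    exact/measurable_EFinP/measurable_funTS/measurable_sqB.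
  by move=> u _; rewrite lee_fin sqB_ge0.
Qed.

Hypothesis nuBC : (nu (~` B) < +oo)%E.

(* Exponent of the compensated Poisson integral of [a] over [A]; it is
   the integral over [A] of exp(i a) - 1 - i a 1_B. *)
Definition comp_re a u : R := cos (a u) - 1.
Definition comp_im a u : R := sin (a u) - a u * \1_B u.
Definition comp_exp a A : R[i] :=
  Complex (\int[nu]_(u in A) comp_re a u) (\int[nu]_(u in A) comp_im a u).

Definition comp_dom a u : R := 2 * (a u ^+ 2 * \1_B u) + 2 * \1_(~` B) u.

Lemma comp_dom_ge0 a u : 0 <= comp_dom a u.
Proof. by rewrite addr_ge0// mulr_ge0// sqB_ge0. Qed.

Lemma integrable_comp_dom a : adm a -> nu.-integrable setT (EFin \o comp_dom a).
Proof.
move=> [ma ia].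
rewrite (_ : _ \o _ = ((fun u => 2%:E * (a u ^+ 2 * \1_B u)%:E) \+
  (fun u => 2%:E * (\1_(~` B) u)%:E))%E) //.
apply: integrableD => //; apply: integrableZl => //.
apply/integrableP; split; first exact/measurable_EFinP/measurable_indic/measurableC.
under eq_integral do rewrite gee0_abs ?lee_fin//.
by rewrite integral_indic ?setIT//; exact: measurableC.
Qed.

Lemma comp_re_dom a u : `|comp_re a u| <= comp_dom a u.
Proof.
rewrite /comp_re /comp_dom distrC ger0_norm ?one_sub_cos_ge0// !indicE.
have := one_sub_cos_le_sqr (a u); have := cos_geN1 (a u); have := sqr_ge0 (a u).
have [Bu|nBu] := pselect (B u).
  by rewrite mem_set// memNset//=; lra.
by rewrite memNset// mem_set//=; lra.
Qed.

Lemma comp_im_dom a u : `|comp_im a u| <= comp_dom a u.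
Proof.
rewrite /comp_im /comp_dom !indicE.
have := sin_sub_id_le (a u); have := sin_max (a u).
have [Bu|nBu] := pselect (B u).
  by rewrite mem_set// memNset//= !mulr1 mulr0 addr0.
by rewrite memNset// mem_set//= !mulr0 subr0 add0r; lra.
Qed.

Lemma measurable_comp_re a : measurable_fun setT a -> measurable_fun setT (comp_re a).
Proof. by move=> ma; apply: measurable_funB => //; exact: (bdd_cos ma).1. Qed.

Lemma measurable_comp_im a : measurable_fun setT a -> measurable_fun setT (comp_im a).
Proof.
move=> ma; apply: measurable_funB; first exact: (bdd_sin ma).1.
by apply: measurable_funM => //; exact: measurable_indic.
Qed.

Lemma integrable_comp_re a : adm a -> nu.-integrable setT (EFin \o comp_re a).
Proof.
move=> aa; apply: (le_integrable measurableT _ _ (integrable_comp_dom aa)).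
  exact/measurable_EFinP/measurable_comp_re/aa.1.
by move=> u _; rewrite /= lee_fin [leRHS]ger0_norm ?comp_dom_ge0// comp_re_dom.
Qed.

Lemma integrable_comp_im a : adm a -> nu.-integrable setT (EFin \o comp_im a).
Proof.
move=> aa; apply: (le_integrable measurableT _ _ (integrable_comp_dom aa)).
  exact/measurable_EFinP/measurable_comp_im/aa.1.
by move=> u _; rewrite /= lee_fin [leRHS]ger0_norm ?comp_dom_ge0// comp_im_dom.
Qed.

Lemma comp_exp0 a : comp_exp a set0 = 0.
Proof. by rewrite /comp_exp !Rintegral_set0. Qed.

Lemma comp_expU a A A' : adm a -> measurable A -> measurable A' ->
  A `&` A' = set0 -> comp_exp a (A `|` A') = comp_exp a A + comp_exp a A'.
Proof.
move=> aa mA mA' AA'; have dj : [disjoint A & A'] by apply/disj_setPS; rewrite AA'.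
rewrite /comp_exp !Rintegral_setU//.
- apply: integrableS (integrable_comp_im aa) => //; exact: measurableU.
- apply: integrableS (integrable_comp_re aa) => //; exact: measurableU.
Qed.

Lemma comp_exp_cvg a (E : nat -> set S) : adm a -> (forall n, measurable (E n)) ->
  nondecreasing_seq E -> \bigcup_n E n = setT ->
  complex.Re (comp_exp a (E n)) @[n --> \oo] --> complex.Re (comp_exp a setT) /\
  complex.Im (comp_exp a (E n)) @[n --> \oo] --> complex.Im (comp_exp a setT).
Proof.
move=> aa mE ndE ET.
have aux (f : S -> R) : nu.-integrable setT (EFin \o f) ->
    \int[nu]_(u in E n) f u @[n --> \oo] --> \int[nu]_u f u.
  move=> fi; have mf : measurable_fun setT f by apply/measurable_EFinP; exact: measurable_int fi.
  under eq_cvg do rewrite Rintegral_mkcond.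
  apply: fine_cvg; rewrite fineK; last exact: integrable_fin_num.
  have [//|||||_ _] := @dominated_convergence _ _ _ nu _ measurableT
    (fun n => EFin \o (f \_ (E n))) (EFin \o f) (abse \o EFin \o f).
  - move=> n; apply/measurable_EFinP.
    by apply/(measurable_restrictT _ (mE n)); exact: measurable_funTS.
  - exact/measurable_EFinP.
  - apply: aeW => u _ /=; apply: cvg_near_cst.
    have : (\bigcup_n E n) u by rewrite ET.
    move=> [k _ Eku]; exists k => // n /= kn; rewrite patchE mem_set//.
    by move: Eku; apply/subsetPset/ndE.
  - exact: integrable_abse.
  - apply: aeW => u n _ /=; rewrite patchE; case: ifP => // _.
    by rewrite lee_fin normr0.
  by [].
by split; apply: aux; [exact: integrable_comp_re|exact: integrable_comp_im].
Qed.

Lemma one_sub_Re_comp_exp a t A : adm a -> measurable A -> A `<=` B ->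
  1 - complex.Re (cexp (comp_exp (fun u => t * a u) A)) <= t ^+ 2 * (3 * csq a A).
Proof.
move=> aa mA AB; have ata := admZ t aa.
have iA f : nu.-integrable setT (EFin \o f) -> nu.-integrable A (EFin \o f).
  exact: integrableS.
have ire := iA _ (integrable_comp_re ata); have iim := iA _ (integrable_comp_im ata).
have isq : nu.-integrable A (EFin \o (fun u => a u ^+ 2 * \1_B u)) by exact: iA aa.2.
have isqZ c : nu.-integrable A (EFin \o (fun u => c * (a u ^+ 2 * \1_B u))).
  rewrite (_ : _ \o _ = (fun u => c%:E * (a u ^+ 2 * \1_B u)%:E)%E)//.
  exact: integrableZl.
have re0 : complex.Re (comp_exp (fun u => t * a u) A) <= 0.
  rewrite /= -oppr_ge0 -mulN1r -RintegralZl//; apply: Rintegral_ge0 => u _.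
  by rewrite mulN1r opprB one_sub_cos_ge0.
apply: le_trans (one_sub_Re_cexp_le re0) _ => /=.
have h1 : - (\int[nu]_(u in A) comp_re (fun v => t * a v) u) <= t ^+ 2 / 2 * csq a A.
  rewrite -mulN1r -!RintegralZl//; apply: le_Rintegral => //.
    by move: (integrableZl mA (-1) ire); apply: eq_integrable => // u _ /=.
  move=> u /AB Bu; rewrite mulN1r opprB indicE mem_set// mulr1.
  by apply: le_trans (one_sub_cos_le_sqr _) _; rewrite exprMn mulrAC.
have h2 : `|\int[nu]_(u in A) comp_im (fun v => t * a v) u| <= 2 * t ^+ 2 * csq a A.
  apply: le_trans (le_normr_Rintegral mA iim) _.
  rewrite -RintegralZl//; apply: le_Rintegral => //; first exact: integrable_norm.
  move=> u /AB Bu; rewrite /comp_im indicE mem_set// !mulr1.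
  by apply: le_trans (sin_sub_id_le _) _; rewrite exprMn mulrA.
have := csq_ge0 a A; have := sqr_ge0 t; move: (csq a A) (t ^+ 2) h1 h2 => c q.
by move=> h1 h2 q0 c0; apply: le_trans (lerD h1 h2) _; nra.
Qed.

Lemma csq_tail_cvg a (E : nat -> set S) : adm a -> (forall n, measurable (E n)) ->
  nondecreasing_seq E -> \bigcup_n E n = setT -> csq a (~` E n) @[n --> \oo] --> (0 : R).
Proof.
move=> [ma ia] mE ndE ET; rewrite /csq; under eq_cvg do rewrite Rintegral_mkcond.
apply: fine_cvg.
have -> : 0%:E = (\int[nu]_u (0%R : R)%:E)%E by rewrite integral0.
have [//|||||_ _] := @dominated_convergence _ _ _ nu _ measurableT
  (fun n => EFin \o ((fun u => a u ^+ 2 * \1_B u) \_ (~` E n)))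
  (fun=> 0%:E) (fun u => (a u ^+ 2 * \1_B u)%:E).
- move=> n; apply/measurable_EFinP; apply/(measurable_restrictT _ (measurableC (mE n))).
  exact/measurable_funTS/measurable_sqB.
- exact/measurable_EFinP.
- apply: aeW => u _ /=; apply: cvg_near_cst.
  have : (\bigcup_n E n) u by rewrite ET.
  move=> [k _ Eku]; exists k => // n /= kn; rewrite patchE memNset//=; apply.
  by move: Eku; apply/subsetPset/ndE.
- by [].
- apply: aeW => u n _ /=; rewrite patchE lee_fin; case: ifP => _.
    by rewrite ger0_norm// sqB_ge0.
  by rewrite normr0 sqB_ge0.
by [].
Qed.

End square_integrable.

Lemma measurable_le_normr d (T : measurableType d) (R : realType) (f : T -> R) c :
  measurable_fun setT f -> measurable [set x | c <= `|f x|].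
Proof.
move=> mf; rewrite (_ : [set x | _] = (fun x => `|f x|) @^-1` `[c, +oo[); last first.
  by apply/seteqP; split => w; rewrite /= in_itv/= andbT.
have m : measurable_fun setT (fun x => `|f x|) by exact: measurableT_comp.
by rewrite -[X in measurable X]setTI; exact: m.
Qed.

Section poisson_integral.
Context d (S : measurableType d) (R : realType).
Variables (nu : {measure set S -> \bar R}) (B : set S).
Hypotheses (mB : measurable B) (nuBC : (nu (~` B) < +oo)%E).
Variable G : nat -> set S.
Hypotheses (G0 : G 0%N = ~` B) (GB : forall k, G k.+1 `<=` B).
Hypotheses (mG : forall k, measurable (G k)) (nuG : forall k, (nu (G k) < +oo)%E).
Hypotheses (tG : trivIset setT G) (GT : \bigcup_k G k = setT).
Implicit Types a b : S -> R.
Local Open Scope complex_scope.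

Let P k : probability (cp_space S) R := cp_prob (mrestr nu (mG k)).
Let Q : probability (seqspace (cp_space S)) R := seq_prob P.

Definition piece_mean a k : R := \int[nu]_(u in G k) (a u * \1_B u).

Definition piece a k (p : cp_space S) : R := cp_sum a p - piece_mean a k.

Definition jump_sum a J K (w : seqspace (cp_space S)) : R :=
  \sum_(k < K) (if (J <= k)%N then piece a k (w k) else 0).

Definition block J K := \bigcup_(k in [set k | (J <= k < K)%N]) G k.

Lemma measurable_block J K : measurable (block J K).
Proof. by apply: bigcup_measurable => k _. Qed.

Lemma integrable_piece_cst k (c : R) : nu.-integrable (G k) (cst c%:E).
Proof.
apply/integrableP; split; first exact: measurable_cst.
by rewrite integral_cst//= lte_mul_pinfty.
Qed.

Lemma integrable_piece_mean a k : adm nu B a ->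
  nu.-integrable (G k) (EFin \o (fun u => a u * \1_B u)).
Proof.
move=> [ma ia].
have ig : nu.-integrable (G k) (EFin \o (fun u => 1 + a u ^+ 2 * \1_B u)).
  rewrite (_ : _ \o _ = (cst 1%:E \+ (fun u => (a u ^+ 2 * \1_B u)%:E))%E)//.
  by apply: integrableD => //; [exact: integrable_piece_cst|exact: integrableS ia].
apply: (le_integrable (mG k) _ _ ig).
  apply/measurable_EFinP; apply: measurable_funTS.
  by apply: measurable_funM; [exact: ma|exact: measurable_indic].
move=> u _ /=; rewrite lee_fin [leRHS]ger0_norm; last by rewrite addr_ge0// sqB_ge0.
rewrite normrM indicE; case: (u \in B); last by rewrite /= normr0 !mulr0 addr0.
rewrite /= normr1 !mulr1 -(real_normK (num_real (a u))).
by have := sqr_ge0 (`|a u| - 1); rewrite sqrrB; have := normr_ge0 (a u); lra.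
Qed.

Lemma measurable_piece a k : measurable_fun setT a -> measurable_fun setT (piece a k).
Proof. by move=> ma; apply: measurable_funB => //; exact: measurable_cp_sum. Qed.

Lemma chf_piece a k : adm nu B a -> chf (P k) (piece a k) = cexp (comp_exp nu B a (G k)).
Proof.
move=> aa; have ma := aa.1.
rewrite chf_shift; last exact: measurable_cp_sum.
have fin : (mrestr nu (mG k) setT < +oo)%E by rewrite /= /mrestr setTI.
rewrite chf_cp_sum// cintegral_cexp_i// -cexpD; congr cexp.
have ia (u : R -> R) : bdd (fun x => u (a x)) ->
    nu.-integrable (G k) (EFin \o (fun x => u (a x))).
  move=> [mu [M HM]]; apply: (le_integrable (mG k) _ _ (integrable_piece_cst k M)).
    exact/measurable_EFinP/measurable_funTS.
  move=> x _; rewrite /= lee_fin; apply: le_trans (HM x) _; exact: ler_norm.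
rewrite /comp_exp /comp_re /comp_im; simpc; congr (_ +i* _).
- rewrite Rintegral_mrestr; last exact: (bdd_cos ma).1.
  rewrite RintegralB//; [|exact: (ia (@cos R) (bdd_cos ma))|exact: integrable_piece_cst].
  by rewrite Rintegral_cst// mul1r /= /mrestr setTI.
- rewrite Rintegral_mrestr; last exact: (bdd_sin ma).1.
  rewrite RintegralB//; first exact: (ia (@sin R) (bdd_sin ma)).
  exact: integrable_piece_mean.
Qed.

Lemma block0 J K : (K <= J)%N -> block J K = set0.
Proof.
move=> KJ; apply/seteqP; split => // x [k /= /andP[Jk kK]] _.
by have := leq_trans (leq_ltn_trans Jk kK) KJ; rewrite ltnn.
Qed.

Lemma blockS J K : (J <= K)%N -> block J K.+1 = block J K `|` G K.
Proof.
move=> JK; apply/seteqP; split => x.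
  move=> [k /= /andP[Jk]]; rewrite ltnS leq_eqVlt => /predU1P[->|kK] Gx; first by right.
  by left; exists k => //=; rewrite Jk.
move=> [[k /= /andP[Jk kK] Gx]|Gx]; first by exists k => //=; rewrite Jk ltnS ltnW.
by exists K => //=; rewrite JK leqnn.
Qed.

Lemma sum_comp_exp a J K : adm nu B a ->
  \sum_(k < K) (if (J <= k)%N then comp_exp nu B a (G k) else 0) =
  comp_exp nu B a (block J K).
Proof.
move=> aa; elim: K => [|K IH]; first by rewrite big_ord0 block0// comp_exp0.
rewrite big_ord_recr /= IH; case: leqP => JK.
  rewrite blockS// comp_expU//; first exact: measurable_block.
  apply/seteqP; split => // x [[k /= /andP[_ kK] Gk GK]].
  move/trivIsetP : tG => /(_ k K I I); rewrite neq_ltn kK => /(_ isT).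
  by move=> /seteqP[+ _] => /(_ x); apply.
by rewrite !block0 ?addr0 ?comp_exp0// ltnW.
Qed.

Lemma measurable_jump_sum a J K : measurable_fun setT a -> measurable_fun setT (jump_sum a J K).
Proof.
move=> ma; apply: measurable_sum => k; case: (J <= k)%N => //.
apply: (measurableT_comp (measurable_piece k ma)); exact: measurable_coord.
Qed.

Lemma chf_jump_sum a J K : adm nu B a ->
  chf Q (jump_sum a J K) = cexp (comp_exp nu B a (block J K)).
Proof.
move=> aa; rewrite -sum_comp_exp// cexp_sum.
pose f k : cp_space S -> R := if (J <= k)%N then piece a k else cst 0.
have mf k : measurable_fun setT (f k).
  by rewrite /f; case: (J <= k)%N => //; apply: measurable_piece; exact: aa.1.
rewrite [X in chf _ X](_ : _ = fun w : seqspace (cp_space S) => \sum_(k < K) f k (w k)); last first.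
  by apply/funext => w; apply: eq_bigr => k _; rewrite /f; case: (J <= k)%N.
rewrite /Q chf_seq_sum//; apply: eq_bigr => k _; rewrite /f; case: ifP => _.
  exact: chf_piece.
by rewrite chf_cst mulr0.
Qed.

Lemma jump_sum_scaleD c a b J K w : adm nu B a -> adm nu B b ->
  jump_sum (fun u => a u + c * b u) J K w = jump_sum a J K w + c * jump_sum b J K w.
Proof.
move=> aa ab; rewrite /jump_sum mulr_sumr -big_split; apply: eq_bigr => k _ /=.
case: ifP => _; last by rewrite mulr0 addr0.
rewrite /piece cp_sumD cp_sumZ.
have -> : piece_mean (fun u => a u + c * b u) k = piece_mean a k + c * piece_mean b k.
  rewrite /piece_mean -RintegralZl//; last exact: integrable_piece_mean.
  rewrite -RintegralD//; last 2 first.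
  - exact: integrable_piece_mean.
  - rewrite (_ : _ \o _ = (fun u => c%:E * (b u * \1_B u)%:E)%E)//.
    by apply: integrableZl => //; exact: integrable_piece_mean.
  by apply: eq_Rintegral => u _; rewrite mulrDl mulrA.
by ring.
Qed.

Lemma jump_sumB a J K w : (J <= K)%N -> jump_sum a 0 K w - jump_sum a 0 J w = jump_sum a J K w.
Proof.
move=> JK; rewrite /jump_sum /=.
rewrite -(big_mkord xpredT (fun k => piece a k (w k))).
rewrite -(big_mkord xpredT (fun k => piece a k (w k))).
rewrite -(big_mkord xpredT (fun k => if (J <= k)%N then piece a k (w k) else 0)).
rewrite (big_cat_nat (leq0n J) JK)/= [in RHS](big_cat_nat (leq0n J) JK)/=.
rewrite addrAC subrr add0r [X in _ = X + _]big_nat_cond [X in _ = X + _]big1 ?add0r.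
  by rewrite big_nat [RHS]big_nat; apply: eq_bigr => k /andP[-> _].
by move=> k /andP[/andP[_ kJ] _]; rewrite leqNgt kJ.
Qed.

Lemma block_tail J K : block J K `<=` ~` block 0 J.
Proof.
move=> x [k /= /andP[Jk _] Gk] [l /= lJ Gl].
move/trivIsetP : tG => /(_ l k I I); rewrite neq_ltn (leq_trans lJ Jk) => /(_ isT).
by move=> /seteqP[+ _] => /(_ x); apply.
Qed.

Lemma first_moment_jump_sum a J K (eta : R) : adm nu B a -> 0 < eta -> (0 < J)%N ->
  (\int[Q]_w `|jump_sum a J K w|%:E <=
     (eta + 24 * csq nu B a (~` block 0 J) / eta)%:E)%E.
Proof.
move=> aa eta0 J0; have ma := aa.1.
apply: first_moment_le => //; first exact: measurable_jump_sum.
rewrite (_ : 24 * _ = 8 * (3 * csq nu B a (~` block 0 J))); last by rewrite mulrA -natrM.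
apply: second_moment_le; first exact: measurable_jump_sum.
  by rewrite mulr_ge0// csq_ge0.
move=> t.
have -> : (fun x => t * jump_sum a J K x) = jump_sum (fun u => t * a u) J K.
  have a0 : adm nu B (cst 0).
    have := admZ 0 aa; congr adm; apply/funext => u; exact: mul0r.
  apply/funext => w; have := jump_sum_scaleD t J K w a0 aa.
  have := jump_sum_scaleD (-1) J K w a0 a0.
  rewrite (_ : (fun u => cst 0 u + -1 * cst 0 u) = cst 0 :> (S -> R)); last first.
    by apply/funext => u /=; rewrite mulr0 addr0.
  rewrite (_ : (fun u => cst 0 u + t * a u) = (fun u => t * a u)); last first.
    by apply/funext => u /=; rewrite add0r.
  move=> + ->; rewrite mulN1r subrr => ->; by rewrite add0r.
rewrite chf_jump_sum; last exact: admZ.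
have bB : block J K `<=` B.
  move=> x [[|k] /= /andP[Jk _] Gk]; last exact: GB Gk.
  by move: Jk; rewrite leqNgt J0.
apply: le_trans (one_sub_Re_comp_exp mB nuBC t aa (measurable_block J K) bB) _.
rewrite ler_wpM2l ?sqr_ge0// ler_wpM2l//; apply: le_csq => //.
- exact: measurable_block.
- exact/measurableC/measurable_block.
- exact: block_tail.
Qed.

Lemma nondecreasing_block : nondecreasing_seq (block 0).
Proof.
move=> m n mn; apply/subsetPset => x [k /= km Gk]; exists k => //=.
exact: leq_trans km mn.
Qed.

Lemma bigcup_block : \bigcup_n block 0 n = setT.
Proof.
apply/seteqP; split => // x _; have : (\bigcup_k G k) x by rewrite GT.
by move=> [k _ Gk]; exists k.+1 => //; exists k => //=.
Qed.

Lemma L1dist_jump_sum a m n (eta : R) : adm nu B a -> 0 < eta -> (0 < m <= n)%N ->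
  (L1dist Q (jump_sum a 0 n) (jump_sum a 0 m) <=
     (eta + 24 * csq nu B a (~` block 0 m) / eta)%:E)%E.
Proof.
move=> aa eta0 /andP[m0 mn]; apply: le_trans (first_moment_jump_sum n aa eta0 m0).
by rewrite le_eqVlt; apply/orP; left; apply/eqP; apply: eq_integral => w _; rewrite jump_sumB.
Qed.

Lemma jump_sum_cvg a : adm nu B a ->
  exists2 X : seqspace (cp_space S) -> R, measurable_fun setT X
    & L1cvg Q (jump_sum a 0) X.
Proof.
move=> aa; apply: L1_complete; first by move=> n; apply: measurable_jump_sum; exact: aa.1.
move=> e e0.
have t0 := csq_tail_cvg mB aa (measurable_block 0) nondecreasing_block bigcup_block.
have e2 : 0 < e / 2 by rewrite divr_gt0.
have e96 : 0 < e ^+ 2 / 96 by rewrite divr_gt0// exprn_gt0.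
move/cvgrPdist_le : t0 => /(_ _ e96) [N _ HN].
have key m n : (N.+1 <= m)%N -> (m <= n)%N ->
    (L1dist Q (jump_sum a 0 n) (jump_sum a 0 m) <= e%:E)%E.
  move=> Nm mn; apply: le_trans (L1dist_jump_sum aa e2 _) _.
    by rewrite mn (leq_trans _ Nm).
  have := HN m (ltnW Nm); rewrite sub0r normrN ger0_norm ?csq_ge0// => cm.
  rewrite lee_fin -lerBrDl ler_pdivrMr// [leRHS](_ : _ = 24 * (e ^+ 2 / 96)).
    by rewrite ler_wpM2l.
  by field.
exists N.+1 => m n Nm Nn; have [mn|nm] := leqP m n; last exact: key (ltnW nm).
by rewrite L1distC; exact: key.
Qed.

Definition poisson_integral a : seqspace (cp_space S) -> R :=
  xget (cst 0) [set X | measurable_fun setT X /\ L1cvg Q (jump_sum a 0) X].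

Lemma poisson_integralP a : adm nu B a ->
  measurable_fun setT (poisson_integral a) /\
  L1cvg Q (jump_sum a 0) (poisson_integral a).
Proof.
by move=> /jump_sum_cvg[X mX LX]; rewrite /poisson_integral; case: xgetP => [_ -> //|/(_ X)[]].
Qed.

Lemma poisson_integral_scaleD c a b : adm nu B a -> adm nu B b ->
  Q [set w | poisson_integral (fun u => a u + c * b u) w !=
             poisson_integral a w + c * poisson_integral b w] = 0%E.
Proof.
move=> aa ab; have [mX LX] := poisson_integralP aa; have [mY LY] := poisson_integralP ab.
have ac := adm_scaleD mB c aa ab; have [mZ LZ] := poisson_integralP ac.
move: (poisson_integral _) (poisson_integral a) (poisson_integral b) mX mY mZ LX LY LZ.
move=> Z X Y mX mY mZ LX LY LZ.
have mXY : measurable_fun setT (fun w => X w + c * Y w).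
  by apply: measurable_funD => //; exact: measurable_funM.
apply: L1dist_eq0 => //; apply/eqP; rewrite eq_le L1dist_ge0 andbT.
apply/lee_addgt0Pr => e e0; rewrite add0e.
have c0 : 0 < 2 + `|c| by rewrite ltr_wpDr.
have e1 : 0 < e / (2 + `|c|) by rewrite divr_gt0.
have [N1 H1] := LX _ e1; have [N2 H2] := LY _ e1; have [N3 H3] := LZ _ e1.
set n := (N1 + N2 + N3)%N.
have {}H1 := H1 n (leq_trans (leq_addr N2 N1) (leq_addr _ _)).
have {}H2 := H2 n (leq_trans (leq_addl N1 N2) (leq_addr _ _)).
have {}H3 := H3 n (leq_addl _ _).
have ms f (af : adm nu B f) : measurable_fun setT (jump_sum f 0 n).
  apply: measurable_jump_sum; exact: af.1.
apply: le_trans (L1dist_triangle Q mZ mXY (ms _ ac)) _.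
rewrite L1distC.
have E : (L1dist Q (jump_sum (fun u => a u + c * b u)%R 0 n) (fun w => X w + c * Y w)%R <=
   L1dist Q (jump_sum a 0 n) X + `|c|%:E * L1dist Q (jump_sum b 0 n) Y)%E.
  rewrite /L1dist -ge0_integralZl_EFin//; [|exact: (measurable_dist (ms _ ab) mY)].
  rewrite -ge0_integralD//; last 2 first.
  - exact: (measurable_dist (ms _ aa) mX).
  - by apply: emeasurable_funM => //; exact: (measurable_dist (ms _ ab) mY).
  apply: ge0_le_integral => //.
  - exact: (measurable_dist (ms _ ac) mXY).
  - apply: emeasurable_funD; first exact: (measurable_dist (ms _ aa) mX).
    by apply: emeasurable_funM => //; exact: (measurable_dist (ms _ ab) mY).
  - move=> w _; rewrite jump_sum_scaleD// -EFinM -EFinD lee_fin -normrM.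
    by apply: le_trans (ler_normD _ _); rewrite mulrBr opprD addrACA.
apply: le_trans (leeD H3 (le_trans E (leeD H1 (lee_wpmul2l _ H2)))) _ => //.
rewrite -EFinM -!EFinD lee_fin le_eqVlt; apply/orP; left; apply/eqP.
by field; rewrite gt_eqF.
Qed.

Lemma chf_poisson_integral a : adm nu B a ->
  chf Q (poisson_integral a) = cexp (comp_exp nu B a setT).
Proof.
move=> aa; have [mX LX] := poisson_integralP aa.
have [c1 c2] := chf_L1cvg (fun n => measurable_jump_sum 0 n aa.1) mX LX.
have [d1 d2] := comp_exp_cvg mB nuBC aa (measurable_block 0) nondecreasing_block bigcup_block.
have [e1 e2] := cvg_cexp d1 d2.
have E : (fun n => chf Q (jump_sum a 0 n)) = (fun n => cexp (comp_exp nu B a (block 0 n))).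
  by apply/funext => n; rewrite chf_jump_sum.
have E1 : (fun n => complex.Re (chf Q (jump_sum a 0 n))) =
    (fun n => complex.Re (cexp (comp_exp nu B a (block 0 n)))).
  by apply/funext => n; rewrite chf_jump_sum.
have E2 : (fun n => complex.Im (chf Q (jump_sum a 0 n))) =
    (fun n => complex.Im (cexp (comp_exp nu B a (block 0 n)))).
  by apply/funext => n; rewrite chf_jump_sum.
rewrite E1 in c1; rewrite E2 in c2.
apply/eqP; rewrite eq_complex; apply/andP; split; apply/eqP.
  exact: (cvg_unique (@Rhausdorff R) c1 e1).
exact: (cvg_unique (@Rhausdorff R) c2 e2).
Qed.

Lemma poisson_integral_small (N : S -> R) (e : R) : measurable_fun setT N -> 0 < e ->
  exists2 D : R, 0 < D & forall a r, adm nu B a -> 0 <= r <= D ->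
    (forall u, `|a u| <= r * N u) -> csq nu B a setT <= D ->
    (Q [set w | (1 <= `|poisson_integral a w|)%R] <= e%:E)%E.
Proof.
move=> mN e0.
pose F n := [set w : seqspace (cp_space S) | n%:R <= cp_sum N (w 0%N)].
have mcs : measurable_fun setT (fun w : seqspace (cp_space S) => cp_sum N (w 0%N)).
  apply: (measurableT_comp (measurable_cp_sum mN)); exact: measurable_coord.
have mF n : measurable (F n).
  rewrite (_ : F n = (fun w : seqspace (cp_space S) => cp_sum N (w 0%N)) @^-1` `[n%:R, +oo[).
    by rewrite -[X in measurable X]setTI; exact: mcs.
  by apply/seteqP; split => w; rewrite /F /= in_itv/= andbT.
have FI : \bigcap_n F n = set0.
  apply/seteqP; split => // w Fw.
  have /(_ (Num.trunc (cp_sum N (w 0%N))).+1 I) := Fw.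
  by rewrite /F /= leNgt truncnS_gt.
have Fcvg : Q (F n) @[n --> \oo] --> 0%E.
  rewrite -[X in _ --> X](measure0 Q) -FI.
  apply: nonincreasing_cvg_mu => //.
  - by apply: le_lt_trans (probability_le1 Q (mF 0%N)) _; rewrite ltry.
  - by rewrite FI.
  - move=> m n mn; apply/subsetPset => w; apply: le_trans; by rewrite ler_nat.
have e4 : 0 < e / 2 by rewrite divr_gt0.
have [n nF] : exists n, (Q (F n.+1) <= (e / 2)%:E)%E.
  have [k _ Hk] := (cvgrPdist_lt _ _).1 (fine_cvg Fcvg) _ e4.
  exists k; have := Hk k.+1 (leqnSn k); rewrite /= sub0r normrN ger0_norm ?fine_ge0//.
  by move=> /ltW; rewrite -lee_fin fineK// fin_num_measure.
pose D := Num.min (2 * n.+1%:R)^-1 ((e / 8) ^+ 2 / 24).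
have D0 : 0 < D.
  rewrite lt_min; apply/andP; split; first by rewrite invr_gt0 mulr_gt0// ltr0n.
  by apply: divr_gt0; [apply: exprn_gt0; exact: divr_gt0|exact: ltr0n].
exists D => // a r aa /andP[r0 rD] ar csqD.
have [mX LX] := poisson_integralP aa.
have ms k : measurable_fun setT (jump_sum a 0 k) by apply: measurable_jump_sum; exact: aa.1.
have p1E w : jump_sum a 0 1 w = cp_sum a (w 0%N).
  rewrite /jump_sum big_ord1 /= /piece /piece_mean G0.
  rewrite [X in _ - X](_ : _ = 0) ?subr0//.
  transitivity (\int[nu]_(u in ~` B) (0 : R)).
    by apply: eq_Rintegral => u; rewrite inE => nBu; rewrite indicE memNset//= mulr0.
  by rewrite Rintegral_cst ?mul0r//; exact: measurableC.
have dist1 : (L1dist Q (poisson_integral a) (jump_sum a 0 1) <= (e / 4)%:E)%E.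
  apply/lee_addgt0Pr => g g0; have [k Hk] := LX g g0.
  apply: le_trans (L1dist_triangle Q mX (ms 1%N) (ms k.+1)) _.
  rewrite L1distC addeC; apply: leeD; last exact: Hk.
  have e8 : 0 < e / 8 by rewrite divr_gt0.
  apply: le_trans (L1dist_jump_sum aa e8 _) _ => //; rewrite lee_fin.
  have c1 : csq nu B a (~` block 0 1) <= (e / 8) ^+ 2 / 24.
    apply: le_trans (le_trans csqD _); last by rewrite /D ge_min lexx orbT.
    by apply: le_csq => //; exact/measurableC/measurable_block.
  rewrite -lerBrDl ler_pdivrMr// [leRHS](_ : _ = 24 * ((e / 8) ^+ 2 / 24)).
    by rewrite ler_wpM2l.
  by field.
pose A := [set w | 2^-1 <= `|poisson_integral a w - jump_sum a 0 1 w|].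
have mA : measurable A by apply: measurable_le_normr; exact: measurable_funB.
have QA : (Q A <= (e / 2)%:E)%E.
  have mdiff : measurable_fun setT (fun w => (poisson_integral a w - jump_sum a 0 1 w)%:E).
    by apply/measurable_EFinP; exact: measurable_funB.
  have e2 : 0 < (2^-1 : R) by rewrite invr_gt0.
  have := @le_integral_comp_abse _ _ _ Q _ measurableT _ (2^-1) id (@measurable_id _ _ _)
    (fun r r0 => r0) (fun _ _ _ _ h => h) mdiff e2.
  rewrite setTI => /le_trans/(_ dist1).
  rewrite -lee_pdivlMl// invrK -EFinM (_ : 2 * (e / 4) = e / 2); last by field.
  exact.
have sub : [set w | 1 <= `|poisson_integral a w|] `<=` A `|` F n.+1.
  move=> w /= X1; have [?|A'] := leP 2^-1 `|poisson_integral a w - jump_sum a 0 1 w|.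
    by left.
  right; rewrite /F /=.
  have h1 : 2^-1 <= `|jump_sum a 0 1 w|.
    have := ler_normD (poisson_integral a w - jump_sum a 0 1 w) (jump_sum a 0 1 w).
    by rewrite subrK; lra.
  have h2 : `|jump_sum a 0 1 w| <= r * cp_sum N (w 0%N).
    rewrite p1E -cp_sumZ /cp_sum; apply: le_trans (ler_norm_sum _ _ _) _.
    by apply: ler_sum => i _; exact: ar.
  have rn : r <= (2 * n.+1%:R)^-1 by apply: le_trans rD _; rewrite /D ge_min lexx.
  have c0 : 0 <= cp_sum N (w 0%N).
    rewrite leNgt; apply/negP => c0.
    have := le_trans h1 h2; rewrite leNgt => /negP; apply.
    by apply: le_lt_trans (_ : 0 < _) => //; rewrite nmulr_lle0.
  have h3 : 2^-1 <= (2 * n.+1%:R)^-1 * cp_sum N (w 0%N).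
    by apply: le_trans h1 (le_trans h2 _); rewrite ler_wpM2r.
  by move: h3; rewrite invfM -mulrA ler_pMr// ler_pdivlMl// mulr1.
apply: le_trans (le_measure _ _ _ sub) _; rewrite ?inE.
- exact: measurable_le_normr.
- exact: measurableU.
apply: le_trans (measureU2 _ _ _) _ => //.
by rewrite [e]splitr EFinD; exact: leeD.
Qed.

End poisson_integral.

(* The process [X] is the compensated Poisson integral; the last clause bounds
   its jumps outside [B] by means of the weight [N]. *)
Theorem levy_ito d (S : measurableType d) (R : realType)
    (nu : {measure set S -> \bar R}) (B : set S) :
  sigma_finite setT nu -> measurable B -> (nu (~` B) < +oo)%E ->
  exists dO (O : measurableType dO) (Q : probability O R) (X : (S -> R) -> O -> R),
  [/\ forall a, adm nu B a -> measurable_fun setT (X a),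
      forall c a b, adm nu B a -> adm nu B b ->
        Q [set w | X (fun u => a u + c * b u) w != X a w + c * X b w] = 0%E,
      forall a, adm nu B a -> chf Q (X a) = cexp (comp_exp nu B a setT)
    & forall (N : S -> R) e, measurable_fun setT N -> 0 < e ->
        exists2 D : R, 0 < D & forall a r, adm nu B a -> 0 <= r <= D ->
          (forall u, `|a u| <= r * N u) -> csq nu B a setT <= D ->
          (Q [set w | (1 <= `|X a w|)%R] <= e%:E)%E].
Proof.
move=> sf mB nuBC; have [G [G0 GB GP tG GT]] := sigma_finite_pieces sf mB nuBC.
have mG k := (GP k).1; have nuG k := (GP k).2.
exists _, (seqspace (cp_space S)), (seq_prob (fun k => cp_prob (mrestr nu (mG k)))),
  (poisson_integral nu B mG).
split.
- by move=> a aa; have [] := poisson_integralP mB nuBC GB mG nuG tG GT aa.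
- by move=> c a b aa ab; apply: poisson_integral_scaleD.
- by move=> a aa; apply: chf_poisson_integral.
- by move=> N e mN e0; apply: poisson_integral_small.
Qed.

(** * Integrals against raw set functions *)

Section raw_integral.
Import HBNNSimple.
Context d (T : measurableType d) (R : realType).

Lemma eq_integral_raw (m1 m2 : set T -> \bar R) (f : T -> \bar R) :
  (forall A, measurable A -> m1 A = m2 A) -> (\int[m1]_x f x = \int[m2]_x f x)%E.
Proof.
move=> m12; have S12 (k : {nnsfun T >-> R}) : sintegral m1 k = sintegral m2 k.
  by rewrite /sintegral; apply: eq_fsbigr => x _; rewrite m12.
rewrite /integral; congr (ereal_sup _ - ereal_sup _)%E.
  by apply/seteqP; split => _ [k kp <-]; exists k; rewrite ?S12.
by apply/seteqP; split => _ [k kp <-]; exists k; rewrite ?S12.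
Qed.

Lemma eq_cintegral_raw (m1 m2 : set T -> \bar R) (f : T -> R[i]) :
  (forall A, measurable A -> m1 A = m2 A) -> cintegral m1 f = cintegral m2 f.
Proof. by move=> m12; rewrite /cintegral !(eq_integral_raw _ m12). Qed.

End raw_integral.

(** * Cylindrical laws of almost surely linear processes *)

Section cylindrical_law.
Context {R : realType} (U : normedModType R) dO (O : measurableType dO).
Variables (Q : probability O R) (X : dual U -> O -> R).
Hypothesis mX : forall a, measurable_fun setT (X a).
Hypothesis XD : forall c a b, Q [set w | X (a + c *: b) w != X a w + c * X b w] = 0%E.

Definition proc n (c : n.-tuple (dual U)) (w : O) : n.-tuple R :=
  [tuple X (tnth c i) w | i < n].

Lemma measurable_proc n (c : n.-tuple (dual U)) : measurable_fun setT (proc c).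
Proof.
apply/measurable_fun_tnthP => i; rewrite (_ : _ \o _ = X (tnth c i))//.
by apply/funext => w; rewrite /= tnth_mktuple.
Qed.

Lemma cyl_proj_range n (c : n.-tuple (dual U)) : exists T : 'M[R]_n,
  (forall j, \sum_(i < n) T i j *: tnth c i = 0) /\
  (forall x : n.-tuple R, (forall j, \sum_(i < n) T i j * tnth x i = 0) ->
     exists u, cyl_proj c u = x).
Proof.
pose M k (u : 'I_k -> U) : 'M[R]_(k, n) := \matrix_(j, i) tnth c i (u j).
pose p (r : nat) := `[< exists k (u : 'I_k -> U), \rank (M k u) = r >].
have ex : exists r, p r by exists (\rank (M 0%N (fun=> 0))); apply/asboolP; exists 0%N, (fun=> 0).
have ub r : p r -> (r <= n)%N by move=> /asboolP[k [u <-]]; exact: rank_leq_col.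
have [_ /asboolP[k [u <-]] maxr] := ex_maxnP ex ub.
have sub v : ((\row_i tnth c i v) <= M k u)%MS.
  pose u' (j : 'I_(1 + k)) := match fintype.split j with inl _ => v | inr j' => u j' end.
  have E : M _ u' = col_mx (\row_i tnth c i v) (M k u).
    by apply/matrixP => j i; rewrite !mxE /u'; case: splitP => j' _; rewrite !mxE.
  have : (\rank (M _ u') <= \rank (M k u))%N.
    by apply: maxr; apply/asboolP; exists (1 + k)%N, u'.
  rewrite E -addsmxE => rk.
  have [rk' eqv] := mxrank_leqif_sup (addsmxSr (\row_i tnth c i v) (M k u)).
  have : (\row_i tnth c i v + M k u <= M k u)%MS by rewrite -eqv eqn_leq rk rk'.
  by rewrite addsmx_sub => /andP[].
exists (cokermx (M k u)); split.
- move=> j; apply/val_inj/funext => v.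
  have := sub v; rewrite submxE => /eqP /matrixP /(_ 0 j); rewrite !mxE.
  have -> : val (\sum_i cokermx (M k u) i j *: tnth c i) v =
      \sum_i cokermx (M k u) i j * tnth c i v.
    elim/big_ind2 : _ => //= x1 y1 x2 y2 <- <-.
    by [].
  by move=> E; rewrite -[RHS]E; apply: eq_bigr => i _; rewrite !mxE mulrC.
- move=> x Hx; have : ((\row_i tnth x i) <= M k u)%MS.
    rewrite submxE; apply/eqP/matrixP => i j; rewrite !mxE -[RHS](Hx j).
    by apply: eq_bigr => l _; rewrite mxE mulrC.
  move=> /submxP[y yE]; exists (\sum_j y 0 j *: u j).
  apply: eq_from_tnth => i; rewrite tnth_mktuple.
  move/matrixP: yE => /(_ 0 i); rewrite !mxE => ->.
  by rewrite linear_sum; apply: eq_bigr => j _; rewrite linearZ /= mxE.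
Qed.

Lemma ae_scaleD c a b : {ae Q, forall w, X (a + c *: b) w = X a w + c * X b w}.
Proof.
exists [set w | X (a + c *: b) w != X a w + c * X b w]; split => //.
- rewrite (_ : [set w | _] = (fun w => X (a + c *: b) w - (X a w + c * X b w)) @^-1` [set~ 0]).
    have m : measurable_fun setT (fun w => X (a + c *: b) w - (X a w + c * X b w)).
      by apply: measurable_funB => //; apply: measurable_funD => //; exact: measurable_funM.
    by rewrite -[X in measurable X]setTI; apply: m => //; exact: measurableC.
  by apply/seteqP; split => w /=; rewrite -subr_eq0 => /eqP.
- by move=> w /= /eqP.
Qed.

Lemma ae_proc0 : {ae Q, forall w, X 0 w = 0}.
Proof.
have := ae_scaleD (-1) 0 0; apply: filterS => w.
by rewrite scaler0 addr0 mulN1r subrr.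
Qed.

Lemma ae_sum n (t : 'I_n -> R) (a : 'I_n -> dual U) :
  {ae Q, forall w, X (\sum_i t i *: a i) w = \sum_i t i * X (a i) w}.
Proof.
elim: n t a => [|n IH] t a.
  by have := ae_proc0; apply: filterS => w; rewrite !big_ord0.
have := IH (fun i => t (widen_ord (leqnSn n) i)) (fun i => a (widen_ord (leqnSn n) i)).
have := ae_scaleD (t ord_max) (\sum_(i < n) t (widen_ord (leqnSn n) i) *: a (widen_ord (leqnSn n) i)) (a ord_max).
by apply: filterS2 => w; rewrite !big_ord_recr /= => -> ->.
Qed.

Lemma ae_range n (c : n.-tuple (dual U)) :
  {ae Q, forall w, exists u, cyl_proj c u = proc c w}.
Proof.
have [T [T0 TR]] := cyl_proj_range c.
have : {ae Q, forall w, forall j, \sum_i T i j * X (tnth c i) w = 0}.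
  apply: filter_forall => j; have := ae_sum (T^~ j) (tnth c); have := ae_proc0.
  by apply: filterS2 => w X0; rewrite T0 X0.
apply: filterS => w H; apply: TR => j; rewrite -[RHS](H j).
by apply: eq_bigr => i _; rewrite tnth_mktuple.
Qed.

(* The value of the law on a cylinder; its independence of the representation
   of the cylinder is [cyl_lawE]. *)
Definition cyl_law (A : set U) : \bar R :=
  xget 0%E [set r | exists n (c : n.-tuple (dual U)) B,
    [/\ measurable B, A = cyl_proj c @^-1` B & r = Q (proc c @^-1` B)]].

Lemma measurable_proc_preimage n (c : n.-tuple (dual U)) B :
  measurable B -> measurable (proc c @^-1` B).
Proof. by move=> mB; rewrite -[X in measurable X]setTI; exact: measurable_proc. Qed.

Lemma ae_eq_probability A A' : measurable A -> measurable A' ->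
  {ae Q, forall w, A w <-> A' w} -> Q A = Q A'.
Proof.
move=> mA mA' [N [mN QN0 HN]].
have le (C D : set O) : measurable C -> measurable D -> C `<=` D `|` N -> (Q C <= Q D)%E.
  move=> mC mD CD; rewrite -[leRHS]adde0 -QN0; apply: le_trans (measureU2 _ _ _) => //.
  by apply: le_measure => //; rewrite inE//; exact: measurableU.
apply/eqP; rewrite eq_le !le// => w.
- move=> Aw; have [|nAw] := pselect (A w <-> A' w); [by left; tauto|].
  by right; exact: HN.
- move=> Aw; have [|nAw] := pselect (A w <-> A' w); [by left; tauto|].
  by right; exact: HN.
Qed.

Lemma cyl_lawE n (c : n.-tuple (dual U)) B : measurable B ->
  cyl_law (cyl_proj c @^-1` B) = Q (proc c @^-1` B).
Proof.
move=> mB; rewrite /cyl_law; case: xgetP => [_ ->|/(_ (Q (proc c @^-1` B)))[]]; last first.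
  by exists n, c, B.
move=> [m [e [D [mD AE ->]]]].
apply: ae_eq_probability; [exact: measurable_proc_preimage|exact: measurable_proc_preimage|].
have := ae_range [tuple of c ++ e]; apply: filterS => w [u uE].
have ce i : tnth c i u = tnth (proc c w) i.
  have := congr1 (fun x => tnth x (lshift m i)) uE.
  by rewrite !tnth_mktuple /= tnth_lshift.
have ee i : tnth e i u = tnth (proc e w) i.
  have := congr1 (fun x => tnth x (rshift n i)) uE.
  by rewrite !tnth_mktuple /= tnth_rshift.
change (D (proc e w) <-> B (proc c w)).
have -> : proc c w = cyl_proj c u by apply: eq_from_tnth => i; rewrite -ce tnth_mktuple.
have -> : proc e w = cyl_proj e u by apply: eq_from_tnth => i; rewrite -ee tnth_mktuple.
by have /seteqP[h1 h2] := AE; split; [exact: h2|exact: h1].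
Qed.

Lemma cyl_lawT : cyl_law setT = 1%E.
Proof.
have := @cyl_lawE 0%N [tuple] setT measurableT.
by rewrite !preimage_setT probability_setT.
Qed.

Lemma sigma_cylindersP (G : set (dual U)) : finite_set G ->
  exists n (c : n.-tuple (dual U)), forall A, <<s cylinders G >> A ->
    exists2 B, measurable B & A = cyl_proj c @^-1` B.
Proof.
move=> /finite_seqP[s GE]; exists (size s), (in_tuple s) => A.
move=> /(_ [set D | exists2 B, measurable B & D = cyl_proj (in_tuple s) @^-1` B]).
apply; split.
  split => /=.
  - by exists set0; rewrite // preimage_set0.
  - by move=> D [B mB ->]; exists (~` B); [exact: measurableC|rewrite setTD].
  - move=> F FB.
    have /choice[f fP] : forall i, exists B, measurable B /\ F i = cyl_proj (in_tuple s) @^-1` B.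
      by move=> i; have [B] := FB i; exists B.
    exists (\bigcup_i f i); first by apply: bigcup_measurable => i _; case: (fP i).
    by rewrite preimage_bigcup; apply: eq_bigcup => // i _; case: (fP i).
move=> D [m [a [B [aG mB ->]]]].
have /choice[j jP] : forall i, exists j : 'I_(size s), tnth (in_tuple s) j = tnth a i.
  by move=> i; have := aG i; rewrite GE /= => /(nthP 0)[k ks kE]; exists (Ordinal ks); rewrite (tnth_nth 0).
pose re (x : (size s).-tuple R) : m.-tuple R := [tuple tnth x (j i) | i < m].
have mre : measurable_fun setT re.
  apply/measurable_fun_tnthP => i; rewrite (_ : _ \o _ = tnth (T:=R) ^~ (j i)).
    exact: measurable_tnth.
  by apply/funext => x; rewrite /= tnth_mktuple.
exists (re @^-1` B); first by rewrite -[X in measurable X]setTI; exact: (mre measurableT B mB).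
rewrite (_ : cyl_proj a = re \o cyl_proj (in_tuple s)) ?comp_preimage//.
by apply/funext => u; apply: eq_from_tnth => i; rewrite !tnth_mktuple jP.
Qed.

Lemma cyl_law_probability : cylindrical_probability cyl_law.
Proof.
split; last exact: cyl_lawT.
move=> G finG; have [n [c cP]] := sigma_cylindersP finG.
have [N [mN QN0 HN]] := ae_range c.
have /choice[y yP] : forall w, exists u : U, ~ N w -> cyl_proj c u = proc c w.
  move=> w; have [[u uE]|nu] := pselect (exists u, cyl_proj c u = proc c w).
    by exists u.
  by exists 0 => nN; exfalso; apply: nN; exact: HN.
pose y0 w : g_sigma_algebraType (cylinders G) := if w \in N then 0 else y w.
have y0E B : y0 @^-1` (cyl_proj c @^-1` B) =
    (proc c @^-1` B `\` N) `|` (if pselect (B (cyl_proj c 0)) then N else set0).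
  apply/seteqP; split => w; rewrite /y0 /=.
    case: ifPn; first by rewrite inE => Nw B0; right; case: pselect.
    by move=> /negP; rewrite inE => nN; rewrite yP//; left.
  move=> [[Bw nN]|]; first by rewrite memNset// yP.
  by case: pselect => // B0 Nw; rewrite mem_set.
have mPN B : measurable B -> measurable (y0 @^-1` (cyl_proj c @^-1` B)).
  move=> mB; rewrite y0E; apply: measurableU.
    by apply: measurableD => //; exact: measurable_proc_preimage.
  by case: (pselect (B (cyl_proj c 0))) => ?; [exact: mN|exact: measurable0].
have my : measurable_fun setT y0.
  move=> _ A /cP[B mB ->]; rewrite setTI; exact: mPN.
exists (law Q my) => A sA; rewrite /law /pushforward /=.
have [B mB ->] := cP _ sA; rewrite cyl_lawE//.
apply: ae_eq_probability; [exact: measurable_proc_preimage|exact: mPN|].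
exists N; split => // w /= nw; apply: contrapT => nN; apply: nw.
by rewrite /y0 memNset// yP.
Qed.

End cylindrical_law.

(** * Characteristic functions of cylindrical laws *)

Section image_cintegral.
Context d d' (T : measurableType d) (T' : measurableType d') (R : realType).

Lemma integral_law (m : {measure set T -> \bar R}) (f : T -> T')
    (mf : measurable_fun setT f) (g : T' -> R) : measurable_fun setT g ->
  (\int[law m mf]_x (g x)%:E = \int[m]_x (g (f x))%:E)%E.
Proof.
move=> mg; have mge : measurable_fun setT (EFin \o g) by exact/measurable_EFinP.
rewrite [LHS]integralE [RHS]integralE.
congr (_ - _)%E.
- rewrite (ge0_integral_law m mf (measurable_funepos mge) (funepos_ge0 _)).
  by apply: eq_integral => x _; rewrite !funeposE.
- rewrite (ge0_integral_law m mf (measurable_funeneg mge) (funeneg_ge0 _)).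
  by apply: eq_integral => x _; rewrite !funenegE.
Qed.

Lemma cintegral_law (m : {measure set T -> \bar R}) (f : T -> T')
    (mf : measurable_fun setT f) (g : T' -> R[i]) :
  measurable_fun setT (fun x => complex.Re (g x)) ->
  measurable_fun setT (fun x => complex.Im (g x)) ->
  cintegral (law m mf) g = cintegral m (g \o f).
Proof. by move=> mr mi; rewrite /cintegral !integral_law. Qed.

End image_cintegral.

Lemma ae_eq_chf d (T : measurableType d) (R : realType) (Q : probability T R)
    (f g : T -> R) : measurable_fun setT f -> measurable_fun setT g ->
  {ae Q, forall x, f x = g x} -> chf Q f = chf Q g.
Proof.
move=> mf mg fg; rewrite !chfE; congr Complex; congr fine; apply: ae_eq_integral => //.
- exact/measurable_EFinP/(bdd_cos mf).1.
- exact/measurable_EFinP/(bdd_cos mg).1.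
- by apply: filterS fg => x -> _.
- exact/measurable_EFinP/(bdd_sin mf).1.
- exact/measurable_EFinP/(bdd_sin mg).1.
- by apply: filterS fg => x -> _.
Qed.

Lemma measurable_tnth_preimage (R : realType) n (i : 'I_n) (B : set R) :
  measurable B -> measurable ((fun x : n.-tuple R => tnth x i) @^-1` B).
Proof.
move=> mB; have mt : measurable_fun setT (fun x : n.-tuple R => tnth x i).
  exact: measurable_tnth.
by rewrite -[X in measurable X]setTI; exact: (mt measurableT B mB).
Qed.

Section cylindrical_integral.
Context {R : realType} (U : normedModType R).
Implicit Types (mu : set U -> \bar R) (a : dual U).
Local Open Scope complex_scope.

Lemma measurable_dual_cyl a :
  measurable_fun setT (a : g_sigma_algebraType (cylinders [set a]) -> R).
Proof.
move=> _ B mB; rewrite setTI; apply: sub_sigma_algebra.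
exists 1%N, [tuple a], (tnth (T:=R) ^~ ord0 @^-1` B); split.
- by move=> i; rewrite (ord1 i).
- exact: measurable_tnth_preimage.
- by apply/funext => u; rewrite /preimage/= /cyl_proj tnth_mktuple.
Qed.

Lemma cyl_cintegralE mu a (lam : {measure set R -> \bar R}) (f : R -> R[i]) :
  cylindrical_measure mu -> (forall B, measurable B -> mu (a @^-1` B) = lam B) ->
  measurable_fun setT (fun x => complex.Re (f x)) ->
  measurable_fun setT (fun x => complex.Im (f x)) ->
  cyl_cintegral mu a f = cintegral lam f.
Proof.
move=> /(_ _ (finite_set1 a))[m mE] mulam mr mi.
have ma := @measurable_dual_cyl a.
rewrite /cyl_cintegral (eq_cintegral_raw (m2 := m)); last exact: mE.
rewrite -(@cintegral_law _ _ _ _ _ m _ ma)//; apply: eq_cintegral_raw => B mB.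
have mpB : <<s cylinders [set a] >> (a @^-1` B).
  by rewrite -[X in <<s _ >> X]setTI; exact: ma.
by rewrite -mulam// mE.
Qed.

End cylindrical_integral.

Section convolution_powers.
Context {R : realType} (n : nat).
Implicit Types p q : probability (n.-tuple R) R.

Lemma measurable_tadd :
  measurable_fun setT (fun z : n.-tuple R * n.-tuple R => tadd z.1 z.2).
Proof.
apply/measurable_fun_tnthP => i.
rewrite (_ : _ \o _ = (fun z : n.-tuple R * n.-tuple R => tnth z.1 i + tnth z.2 i)).
  apply: measurable_funD.
    exact: (measurableT_comp (measurable_tnth i) measurable_fst).
  exact: (measurableT_comp (measurable_tnth i) measurable_snd).
by apply/funext => z; rewrite /= tnth_mktuple.
Qed.

Lemma convolutionE p q B : convolution p q B = law (p \x q)%E measurable_tadd B.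
Proof.
apply: eq_integral => x _ /=; congr (q _).
by apply/seteqP; split => y; rewrite /xsection /= inE.
Qed.

Lemma chf_tadd p q t : chf (law (p \x q)%E measurable_tadd) (tdot t) =
  chf p (tdot t) * chf q (tdot t).
Proof.
rewrite chf_law; last exact: measurable_tdot.
rewrite -(chf_prod p q (measurable_tdot t) (measurable_tdot t)).
congr chf; apply/funext => z /=.
by rewrite tdotC tdotDl tdotC [X in _ + X]tdotC.
Qed.

Lemma convolution_powerP (m : set (n.-tuple R) -> \bar R) p k :
  (forall B, measurable B -> m B = p B) ->
  exists2 q : probability (n.-tuple R) R,
    forall B, measurable B -> convolution_power m k B = q B
  & forall t, chf q (tdot t) = chf p (tdot t) ^+ k.
Proof.
move=> mp; elim: k => [|k [q qE qchf]].
  exists (dirac (tzero : n.-tuple R)) => // t; rewrite expr0.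
  rewrite chfE.
  have I (g : n.-tuple R -> R) : measurable_fun setT g ->
      \int[dirac (tzero : n.-tuple R)]_x g x = g tzero.
    move=> mg; rewrite /Rintegral integral_dirac//; last exact/measurable_EFinP.
    by rewrite diracT mul1e.
  rewrite !I; last 2 first.
  - exact: (bdd_sin (measurable_tdot t)).1.
  - exact: (bdd_cos (measurable_tdot t)).1.
  by rewrite tdotC tdot0l cos0 sin0.
exists (law (p \x q)%E measurable_tadd).
  move=> B mB; transitivity (convolution p q B); last exact: convolutionE.
  rewrite /convolution_power iterS /convolution (eq_integral_raw _ mp).
  apply: eq_integral => x _; apply: qE.
  have mx : measurable_fun setT (tadd x).
    apply/measurable_fun_tnthP => i.
    rewrite (_ : _ \o _ = (fun y : n.-tuple R => tnth x i + tnth y i)).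
      by apply: measurable_funD => //; exact: measurable_tnth.
    by apply/funext => y; rewrite /= tnth_mktuple.
  by have := mx measurableT B mB; rewrite setTI.
by move=> t; rewrite chf_tadd qchf exprS.
Qed.

End convolution_powers.

Section process_chf.
Local Open Scope complex_scope.
Context {R : realType} (U : normedModType R) dO (O : measurableType dO).
Variables (Q : probability O R) (X : dual U -> O -> R).
Hypothesis mX : forall a, measurable_fun setT (X a).
Hypothesis XD : forall c a b, Q [set w | X (a + c *: b) w != X a w + c * X b w] = 0%E.

Lemma chf_proc n (c : n.-tuple (dual U)) t :
  chf (law Q (measurable_proc mX c)) (tdot t) =
  chf Q (X (\sum_(i < n) tnth t i *: tnth c i)).
Proof.
rewrite chf_law; last exact: measurable_tdot.
apply: ae_eq_chf => //.
  apply: measurableT_comp; [exact: measurable_tdot|exact: measurable_proc].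
have := ae_sum mX XD (tnth t) (tnth c); apply: filterS => w ->.
by apply: eq_bigr => i _; rewrite tnth_mktuple.
Qed.

Lemma cyl_law1 (a : dual U) B : measurable B -> cyl_law Q X (a @^-1` B) = law Q (mX a) B.
Proof.
move=> mB; have mB1 : measurable (tnth (T:=R) ^~ ord0 @^-1` B : set (1.-tuple R)).
  exact: measurable_tnth_preimage.
have E1 : cyl_proj [tuple a] @^-1` (tnth (T:=R) ^~ ord0 @^-1` B) = a @^-1` B.
  by apply/funext => u; rewrite /preimage/= /cyl_proj tnth_mktuple.
have E2 : proc X [tuple a] @^-1` (tnth (T:=R) ^~ ord0 @^-1` B) = X a @^-1` B.
  by apply/funext => u; rewrite /preimage/= /proc tnth_mktuple.
by rewrite -E1 cyl_lawE// E2.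
Qed.

Lemma char_fun_cyl_law a : char_fun (cyl_law Q X) a = chf Q (X a).
Proof.
have mre : measurable_fun setT (fun x : R => complex.Re (cexp ('i%C * x%:C))).
  by under eq_fun do rewrite cexp_i /=; exact: (bdd_cos (@measurable_id _ _ _)).1.
have mim : measurable_fun setT (fun x : R => complex.Im (cexp ('i%C * x%:C))).
  by under eq_fun do rewrite cexp_i /=; exact: (bdd_sin (@measurable_id _ _ _)).1.
rewrite /char_fun (cyl_cintegralE (cyl_law_probability mX XD).1 (@cyl_law1 a))//.
by rewrite cintegral_law.
Qed.

End process_chf.

(** * The dual is complete *)

Section dual_complete.
Context {R : realType} (U : normedModType R).
Implicit Types (a b : dual U) (u : U).

Lemma dual_le a u : `|a u| <= `|a| * `|u|.
Proof.
have [->|u0] := eqVneq u 0; first by rewrite linear0 !normr0 mulr0.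
have nu : 0 < `|u| by rewrite normr_gt0.
have := @dual_normP R U a (`|u|^-1 *: u).
rewrite normrZ normfV normr_id mulVf ?gt_eqF// => /(_ (lexx _)).
by rewrite linearZ /= normrM normfV normr_id ler_pdivrMl// mulrC.
Qed.

Lemma dual_complete (F : set_system (dual U)) : ProperFilter F -> cauchy F -> cvg F.
Proof.
move=> FF /cauchyP cF.
have ball_le a (e : R) u : F (ball a e) -> F [set b : dual U | `|a u - b u| <= e * `|u|].
  apply: filterS => b; rewrite -ball_normE /= => /ltW abe.
  by apply: le_trans (dual_le (a - b) u) _; rewrite ler_wpM2r.
have evc u : exists l : R, forall e : R, 0 < e -> F [set b : dual U | `|l - b u| < e].
  have : cvg ((fun b : dual U => b u : R^o) @ F).
    apply: cauchy_cvg; apply: cauchy_exP => e e0.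
    have u1 : 0 < `|u| + 1 by rewrite ltr_wpDl.
    have [a Fa] := cF _ (divr_gt0 e0 u1).
    exists (a u); change (F [set b : dual U | ball (a u : R^o) e (b u)]).
    apply: (filterS _ (ball_le _ _ u Fa)) => b /= abu.
    rewrite -ball_normE /=; apply: le_lt_trans abu _.
    by rewrite mulrAC ltr_pdivrMr// ltr_pM2l// ltrDl.
  move=> /cvg_ex[/= l cl]; exists l => e e0.
  by have /cvgrPdist_lt/(_ e e0) := cl.
have [l lP] := choice evc.
have lim_le a (e : R) u : F (ball a e) -> `|a u - l u| <= e * `|u|.
  move=> Fa; apply/ler_addgt0Pr => g g0.
  have [b [/= h1 h2]] := filter_ex (filterI (ball_le _ _ u Fa) (lP u g g0)).
  rewrite -(subrKA (b u)); apply: le_trans (ler_normD _ _) (lerD h1 _).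
  by rewrite distrC ltW.
have l_linear : linear (l : U -> R^o).
  move=> k x y; apply/eqP; rewrite -subr_eq0 -normr_le0; apply/ler_addgt0Pr => g g0.
  have K0 : 0 < `|k| + 2 by rewrite ltr_wpDl.
  have g1 : 0 < g / (`|k| + 2) by rewrite divr_gt0.
  have [b [[/= h1 h2] h3]] := filter_ex
    (filterI (filterI (lP x _ g1) (lP y _ g1)) (lP (k *: x + y) _ g1)).
  rewrite add0r.
  have -> : l (k *: x + y) - (k *: (l x : R^o) + l y) =
      (l (k *: x + y) - b (k *: x + y)) - (k * (l x - b x) + (l y - b y)).
    have -> : b (k *: x + y) = k * b x + b y :> R by exact: linearP.
    by rewrite [LHS](_ : _ = l (k *: x + y) - (k * l x + l y))//; ring.
  apply: le_trans (ler_normB _ _) _.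
  apply: le_trans (lerD (ltW h3) (le_trans (ler_normD _ _) (lerD _ (ltW h2)))) _.
    by rewrite normrM; apply: ler_wpM2l (ltW h1).
  by rewrite le_eqVlt; apply/orP; left; apply/eqP; field; rewrite gt_eqF.
have [a0 Fa0] := cF 1 ltr01.
have l_bound u : `|l u| <= (`|a0| + 1) * `|u|.
  rewrite -[l u](subrK (a0 u)) mulrDl addrC; apply: le_trans (ler_normD _ _) _.
  by apply: lerD; [exact: dual_le|rewrite distrC; exact: lim_le].
have l_cont : continuous (l : U -> R^o).
  move=> x; apply/cvgrPdist_lt => e e0.
  have M0 : 0 < `|a0| + 1 by rewrite ltr_wpDl.
  near=> y.
  have -> : l x - l y = l (x - y).
    rewrite (_ : x - y = -1 *: y + x); last by rewrite scaleN1r addrC.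
    rewrite l_linear [RHS](_ : _ = -1 * l y + l x)//; ring.
  apply: le_lt_trans (l_bound _) _; rewrite mulrC -ltr_pdivlMr//.
  near: y; apply: cvgr_dist_lt; [exact: cvg_id|exact: divr_gt0].
have lD : (l : U -> R^o) \in @dual_pred R U by apply/dual_predP.
pose L := Dual lD.
apply/cvg_ex; exists L; apply/cvg_ballP => e e0.
have e3 : 0 < e / 3 by rewrite divr_gt0.
have [a Fa] := cF _ e3; apply: (filterS _ Fa) => b; rewrite -!ball_normE /= => ab.
have La : `|L - a| <= e / 3.
  apply: dual_norm_le => u u1; rewrite distrC.
  apply: le_trans (lim_le _ _ u Fa) _.
  by rewrite ler_piMr// ltW.
rewrite -(subrKA a); apply: le_lt_trans (ler_normD _ _) _.
by apply: le_lt_trans (lerD La (ltW ab)) _; lra.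
Unshelve. all: by end_near. Qed.

HB.instance Definition _ := Uniform_isComplete.Build (dual U) dual_complete.

End dual_complete.

(** * Measures on the Borel sets of the space *)

Section borel_measurability.
Context {R : realType} (U : normedModType R).

Lemma measurable_continuous (f : U -> R) : continuous (f : U -> R^o) ->
  measurable_fun setT (f : borelType U -> R).
Proof.
move=> cf; apply: (measurability _ (RGenOInfty.measurableE R)).
move=> _ [_ [x ->] <-]; rewrite setTI; apply: sub_sigma_algebra.
by apply: open_comp => [u _|]; [exact: cf|exact: interval_open].
Qed.

Lemma measurable_dual (a : dual U) : measurable_fun setT (a : borelType U -> R).
Proof. by apply: measurable_continuous; exact: dual_continuous. Qed.

Lemma measurable_norm : measurable_fun setT (fun u : borelType U => `|u : U|).
Proof. by apply: measurable_continuous => u; exact: norm_continuous. Qed.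

Lemma measurable_unit_ball : measurable (unit_ball U : set (borelType U)).
Proof.
rewrite (_ : unit_ball U = (fun u : U => `|u|) @^-1` `]-oo, 1]); last first.
  by apply/seteqP; split => u; rewrite /unit_ball /= in_itv.
have m : measurable (`]-oo, 1] : set R) by exact: measurable_itv.
by have := measurable_norm measurableT m; rewrite setTI.
Qed.

Lemma measurable_cyl_proj n (c : n.-tuple (dual U)) :
  measurable_fun setT (cyl_proj c : borelType U -> n.-tuple R).
Proof.
apply/measurable_fun_tnthP => i; rewrite (_ : _ \o _ = tnth c i).
  exact: measurable_dual.
by apply/funext => u; rewrite /= tnth_mktuple.
Qed.

End borel_measurability.

Section square_functional.
Context {R : realType} (U : normedModType R).
Variables (nu : {measure set (borelType U) -> \bar R}) (B : set U).
Hypothesis mB : measurable (B : set (borelType U)).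
Hypothesis aU : forall a : dual U, adm nu B a.

Let q (a : dual U) := csq nu B a setT.

Lemma csq_dual_ge0 a : 0 <= q a. Proof. exact: csq_ge0. Qed.

Let intq (a : dual U) : nu.-integrable setT (EFin \o (fun u => a u ^+ 2 * \1_B u)) := (aU a).2.

Lemma csq_dualZ k (a : dual U) : q (k *: a) = k ^+ 2 * q a.
Proof.
rewrite /q /csq -RintegralZl//; apply: eq_Rintegral => u _.
rewrite (_ : (k *: a) u = k * a u)//; by rewrite exprMn mulrA.
Qed.

Lemma csq_dualB (a b : dual U) : q (a - b) <= 2 * q a + 2 * q b.
Proof.
have iZ (c : R) f : nu.-integrable setT (EFin \o f) ->
    nu.-integrable setT (EFin \o (fun u => c * f u)).
  by move=> fi; exact: (integrableZl measurableT c fi).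
rewrite /q /csq -!RintegralZl// -RintegralD//; [|exact: iZ|exact: iZ].
apply: le_Rintegral => //.
- exact: (integrableD measurableT (iZ 2 _ (intq a)) (iZ 2 _ (intq b))).
- move=> u _; rewrite (_ : (a - b) u = a u - b u)// !mulrA -mulrDl ler_wpM2r//.
  by have := sqr_ge0 (a u + b u); rewrite sqrrB sqrrD; lra.
Qed.

Lemma open_csq_gt (M : R) : open [set a | M < q a].
Proof.
have EqE (a : dual U) : (\int[nu]_u (a u ^+ 2 * \1_B u)%:E)%E = (q a)%:E.
  by rewrite /q /csq /Rintegral fineK//; exact: integrable_fin_num (intq a).
rewrite openE => a /= Ma; apply: contrapT => notin.
have /choice[b bP] : forall n : nat, exists b : dual U, `|a - b| < n.+1%:R^-1 /\ q b <= M.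
  move=> n; apply: contrapT => nb; apply: notin; apply/nbhs_ballP.
  exists n.+1%:R^-1 => /=; first by rewrite invr_gt0 ltr0n.
  move=> b; rewrite -ball_normE /= => ab; rewrite ltNge; apply/negP => qb.
  by apply: nb; exists b.
suff : ((q a)%:E <= M%:E)%E by rewrite lee_fin leNgt Ma.
rewrite -EqE; apply: (@fatou_le _ _ _ nu (fun n u => (b n u ^+ 2 * \1_B u)%:E)).
- by move=> n; apply/measurable_EFinP/measurable_sqB => //; exact: measurable_dual.
- by move=> n u; rewrite lee_fin sqB_ge0.
- move=> u; apply: cvg_EFin; first exact: nearW.
  apply: cvgM; last exact: cvg_cst.
  have bu : b n u @[n --> \oo] --> (a u : R).
    apply/cvgrPdist_le => e e0.
    have e1 : 0 < e / (`|u| + 1) by rewrite divr_gt0// ltr_wpDl.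
    near=> n.
    have h : `|a - b n| <= e / (`|u| + 1).
      apply: le_trans (ltW (bP n).1) _; apply: ltW.
      by near: n; exact: (near_infty_natSinv_lt (PosNum e1)).
    apply: le_trans (dual_le (a - b n) u) _.
    apply: le_trans (ler_wpM2r (normr_ge0 u) h) _.
    have u1 : 0 < `|u| + 1 by rewrite ltr_wpDl.
    by rewrite mulrAC ler_pdivrMr// ler_pM2l// lerDl.
  exact: cvgM.
- by apply: nearW => n; rewrite EqE lee_fin; exact: (bP n).2.
Unshelve. all: by end_near. Qed.

(* Baire: the sublevel sets of the everywhere finite, lower semicontinuous
   quadratic functional [q] are closed, so one of them has an interior point. *)
Lemma csq_small (D : R) : 0 < D -> \forall a \near (0 : dual U), q a <= D.
Proof.
move=> D0.
have [n nd] : exists n : nat, ~ dense [set a | n%:R < q a].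
  apply: contrapT => H.
  have : dense (\bigcap_(n : nat) [set a : dual U | n%:R < q a]).
    apply: Baire => n; split; first exact: open_csq_gt.
    by apply: contrapT => nd; apply: H; exists n.
  move=> /(_ setT) [|  |a [_ /(_ (Num.trunc (q a)).+1 I)]]; first by exists 0.
    exact: openT.
  by rewrite /= ltNge ltW// truncnS_gt.
have [V [[a0 [oO Oa0]] O0]] := denseNE nd.
have [r r0 Or] : exists2 r : R, 0 < r & forall b, `|a0 - b| < r -> q b <= n%:R.
  have := oO; rewrite openE => /(_ a0 Oa0) /nbhs_ballP[r r0 Hr].
  exists r => // b ab; rewrite leNgt; apply/negP => qb.
  have : (V `&` [set a | n%:R < q a]) b.
    by split => //; apply: Hr; rewrite -ball_normE.
  by rewrite O0.
have bound b : `|b| < r -> q b <= 4 * n%:R.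
  move=> br; have -> : b = (b + a0) - a0 by rewrite addrK.
  apply: le_trans (csq_dualB _ _) _.
  have h1 : q (b + a0) <= n%:R by apply: Or; rewrite opprD addrCA subrr addr0 normrN.
  have h2 : q a0 <= n%:R by apply: Or; rewrite subrr normr0.
  by lra.
pose s : R := Num.min 1 (D / (4 * n%:R + 1)).
have n0 : 0 <= n%:R :> R by [].
have K0 : 0 < 4 * n%:R + 1 :> R by lra.
have s0 : 0 < s by rewrite lt_min ltr01 divr_gt0.
apply/nbhs_ballP; exists (r * s) => /=; first by rewrite mulr_gt0.
move=> b; rewrite -ball_normE /= sub0r normrN => bs.
have -> : b = s *: (s^-1 *: b) by rewrite scalerKV// gt_eqF.
rewrite csq_dualZ.
have : q (s^-1 *: b) <= 4 * n%:R.
  by apply: bound; rewrite normrZ gtr0_norm ?invr_gt0// ltr_pdivrMl// mulrC.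
have s1 : s <= 1 by rewrite /s ge_min lexx.
have sD : s * (4 * n%:R + 1) <= D by rewrite -ler_pdivlMr// /s ge_min lexx orbT.
move: (csq_dual_ge0 (s^-1 *: b)); move: (q _) => x x0 xn.
apply: le_trans sD; rewrite expr2 -mulrA; apply: ler_wpM2l; first exact: ltW.
have : s * x <= x by rewrite ler_piMl.
by move: (s * x) => y; lra.
Qed.

End square_functional.

(** * The cylindrical Poisson law *)

Section scaled_measure.
Context d (S : measurableType d) (R : realType) (nu : {measure set S -> \bar R}).
Variable r : {nonneg R}.

Lemma Rintegral_mscale (f : S -> R) : nu.-integrable setT (EFin \o f) ->
  \int[mscale r nu]_x f x = r%:num * \int[nu]_x f x.
Proof.
move=> fi; have mf := measurable_int _ fi.
have fp : (\int[nu]_x (EFin \o f)^\+ x)%E \is a fin_num.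
  by apply: integrable_fin_num => //; exact: integrable_funepos.
have fn : (\int[nu]_x (EFin \o f)^\- x)%E \is a fin_num.
  by apply: integrable_fin_num => //; exact: integrable_funeneg.
rewrite /Rintegral [in LHS]integralE [in RHS]integralE.
rewrite !ge0_integral_mscale//; [|exact: measurable_funeneg|exact: measurable_funepos].
rewrite -muleBr//; last by rewrite fin_num_adde_defr.
by rewrite fineM// fin_numB fp fn.
Qed.

Lemma sigma_finite_mscale : sigma_finite setT nu -> sigma_finite setT (mscale r nu).
Proof.
move=> [F FT Ffin]; exists F => // n; have [mF nuF] := Ffin n; split => //.
by rewrite /mscale/= lte_mul_pinfty.
Qed.

End scaled_measure.

Section cylindrical_poisson.
Context {R : realType} (U : normedModType R).
Implicit Types (nu : {measure set (borelType U) -> \bar R}) (a : dual U).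
Local Open Scope complex_scope.

Definition cap (s : R) : R := Num.min (`|s| ^+ 2) 1.

Lemma cap_ge0 s : 0 <= cap s.
Proof. by rewrite /cap le_min ler01 exprn_ge0. Qed.

Lemma measurable_cap : measurable_fun setT cap.
Proof.
by apply: measurable_minr => //; apply: measurable_funX; exact: normr_measurable.
Qed.

Definition Levy_finite nu := forall a, (\int[nu]_u (cap (a u))%:E < +oo)%E.

Lemma integrable_cap nu a : Levy_finite nu ->
  nu.-integrable setT (EFin \o (fun u => cap (a u))).
Proof.
move=> nuL; apply/integrableP; split.
  apply/measurable_EFinP; apply: measurableT_comp; first exact: measurable_cap.
  exact: measurable_dual.
by under eq_integral do rewrite /= ger0_norm ?cap_ge0//.
Qed.

Lemma integrable_le_cap nu a (C : R) (f : U -> R) : Levy_finite nu ->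
  measurable_fun setT (f : borelType U -> R) ->
  (forall u, `|f u| <= C * cap (a u)) -> nu.-integrable setT (EFin \o f).
Proof.
move=> nuL mf fC; have := integrableZl measurableT C (integrable_cap a nuL).
apply: le_integrable => //; first exact/measurable_EFinP.
by move=> u _; rewrite /= lee_fin; apply: le_trans (fC u) _; exact: ler_norm.
Qed.

Lemma adm_dual nu a : Levy_finite nu -> adm nu (unit_ball U) a.
Proof.
move=> nuL; split; first exact: measurable_dual.
apply: (integrable_le_cap (a := a) (C := 1 + `|a| ^+ 2)) => //.
  by apply: measurable_sqB; [exact: measurable_unit_ball|exact: measurable_dual].
move=> u; rewrite ger0_norm ?sqB_ge0// indicE.
have [uB|uB] := boolP (u \in unit_ball U); last first.
  by rewrite mulr0 mulr_ge0 ?cap_ge0// addr_ge0 ?sqr_ge0.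
have u1 : `|u| <= 1 by move: uB; rewrite inE.
have au : `|a u| <= `|a| by apply: le_trans (dual_le a u) _; rewrite ler_piMr.
rewrite mulr1 -(real_normK (num_real (a u))) /cap.
have a0 := normr_ge0 (a u).
have sq : `|a u| ^+ 2 <= `|a| ^+ 2 by rewrite lerXn2r// nnegrE.
have sq0 : 0 <= `|a u| ^+ 2 by rewrite exprn_ge0.
by case: (leP (`|a u| ^+ 2) 1) => h; nra.
Qed.

Lemma cylindrical_poisson nu : sigma_finite setT nu ->
  (nu (~` unit_ball U) < +oo)%E -> Levy_finite nu ->
  exists dO (O : measurableType dO) (Q : probability O R) (X : dual U -> O -> R),
  [/\ forall a, measurable_fun setT (X a),
      forall c a b, Q [set w | X (a + c *: b) w != X a w + c * X b w] = 0%E,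
      forall a, chf Q (X a) = cexp (comp_exp nu (unit_ball U) a setT)
    & forall e, 0 < e ->
        \forall a \near (0 : dual U), (Q [set w | (1 <= `|X a w|)%R] <= e%:E)%E].
Proof.
move=> nusf nuBC nuL; have mB := @measurable_unit_ball R U.
have aU a : adm nu (unit_ball U) a by exact: adm_dual.
have [dO [V [Q [X [mX XD chfX Xs]]]]] := levy_ito nusf mB nuBC.
exists dO, V, Q, (fun a => X a); split => //.
- by move=> a; exact: mX.
- move=> c a b; rewrite -[RHS](XD c _ _ (aU a) (aU b)).
  have -> : (a + c *: b : dual U) = (fun u => a u + c * b u) :> (U -> R) by [].
  by [].
- by move=> a; exact: chfX.
- move=> e e0; have [D D0 HD] := Xs _ _ (@measurable_norm R U) e0.
  near=> a; apply: (HD a `|a|) => //.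
  + rewrite normr_ge0 /= -[a]subr0 distrC; apply: ltW; near: a.
    by apply: cvgr_dist_lt => //; exact: cvg_id.
  + by move=> u; exact: dual_le.
  + by near: a; exact: csq_small.
Unshelve. all: by end_near. Qed.

Lemma comp_exp_mscale nu a (k : nat) : (nu (~` unit_ball U) < +oo)%E ->
  Levy_finite nu -> (0 < k)%N -> forall kn : 0 <= k%:R^-1 :> R,
  comp_exp (mscale (NngNum kn) nu) (unit_ball U) a setT *+ k =
  comp_exp nu (unit_ball U) a setT.
Proof.
move=> nuBC nuL k0 kn; have mB := @measurable_unit_ball R U.
have aa := adm_dual a nuL.
have kV (x : R) : k%:R^-1 * x *+ k = x.
  by rewrite -mulr_natl mulrA mulfV ?mul1r// pnatr_eq0 -lt0n.
have natC m (x y : R) : (x +i* y) *+ m = (x *+ m) +i* (y *+ m).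
  by elim: m => [//|m IH]; rewrite !mulrS IH.
rewrite /comp_exp !Rintegral_mscale.
- by rewrite natC !kV.
- exact: (integrable_comp_im mB nuBC aa).
- exact: (integrable_comp_re mB nuBC aa).
Qed.

Lemma Levy_finite_mscale nu (r : {nonneg R}) : Levy_finite nu ->
  Levy_finite (mscale r nu).
Proof.
move=> nuL a; have mc : measurable_fun setT (fun u : borelType U => (cap (a u))%:E).
  apply/measurable_EFinP; apply: measurableT_comp; first exact: measurable_cap.
  exact: measurable_dual.
rewrite ge0_integral_mscale//; last by move=> u _; rewrite lee_fin cap_ge0.
by rewrite lte_mul_pinfty.
Qed.

Lemma infinitely_divisible_cyl_law nu dO (O : measurableType dO) (Q : probability O R)
    (X : dual U -> O -> R) : sigma_finite setT nu ->
  (nu (~` unit_ball U) < +oo)%E -> Levy_finite nu ->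
  (forall a, measurable_fun setT (X a)) ->
  (forall c a b, Q [set w | X (a + c *: b) w != X a w + c * X b w] = 0%E) ->
  (forall a, chf Q (X a) = cexp (comp_exp nu (unit_ball U) a setT)) ->
  infinitely_divisible (cyl_law Q X).
Proof.
move=> nusf nuBC nuL mX XD chfX k k0.
have kn : 0 <= k%:R^-1 :> R by [].
pose nuk := mscale (NngNum kn) nu.
have nukBC : (nuk (~` unit_ball U) < +oo)%E by rewrite /nuk /= /mscale /= lte_mul_pinfty.
have [dk [Tk [Qk [Xk [mXk XDk chfXk _]]]]] :=
  cylindrical_poisson (sigma_finite_mscale (NngNum kn) nusf) nukBC
    (Levy_finite_mscale (NngNum kn) nuL).
exists (cyl_law Qk Xk); split; first exact: cyl_law_probability.
move=> n c B mB; rewrite /cyl_image cyl_lawE//.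
have [q qE qchf] := @convolution_powerP R n (cyl_image (cyl_law Qk Xk) c)
  (law Qk (measurable_proc mXk c)) k (fun D mD => cyl_lawE mXk XDk c mD).
rewrite qE//; apply: (chf_unique (m1 := law Q (measurable_proc mX c))) => // t.
rewrite qchf !chf_proc// chfX chfXk.
rewrite -(comp_exp_mscale _ nuBC nuL k0 kn).
move: (comp_exp _ _ _ _) => z.
have -> : z *+ k = \sum_(i < k) z by rewrite sumr_const card_ord.
by rewrite cexp_sum prodr_const card_ord.
Qed.

End cylindrical_poisson.

(** * The exponent and the Levy measures *)

Lemma Rintegral_sum d (S : measurableType d) (R : realType)
    (nu : {measure set S -> \bar R}) n (f : 'I_n -> S -> R) :
  (forall i, nu.-integrable setT (EFin \o f i)) ->
  nu.-integrable setT (EFin \o (fun u => \sum_i f i u)) /\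
  \int[nu]_u \sum_i f i u = \sum_i \int[nu]_u f i u.
Proof.
move=> fi; have E : EFin \o (fun u => \sum_i f i u) = (fun u => \sum_i (EFin \o f i) u)%E.
  by apply/funext => u; rewrite /= sumEFin.
split; first by rewrite E; exact: integrable_sum.
rewrite /Rintegral (_ : (fun u => _) = EFin \o (fun u => \sum_i f i u))// E.
rewrite integral_sum//; apply: EFin_inj; rewrite -sumEFin fineK.
  by apply: eq_bigr => i _; rewrite fineK//; exact: (integrable_fin_num measurableT (fi i)).
by apply/sum_fin_numP => i _ _; exact: (integrable_fin_num measurableT (fi i)).
Qed.

Section exponents.
Context {R : realType} (U : normedModType R).
Variable nu : {measure set (borelType U) -> \bar R}.
Hypotheses (nuBC : (nu (~` unit_ball U) < +oo)%E) (nuL : Levy_finite nu).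
Implicit Types a : dual U.
Local Open Scope complex_scope.

Let B : set (borelType U) := unit_ball U.
Let mB : measurable B := @measurable_unit_ball R U.
Let aU a : adm nu B a := adm_dual a nuL.

Lemma comp_exp_scale_continuous a :
  continuous (fun t : R => complex.Re (comp_exp nu B (t *: a : dual U) setT)) /\
  continuous (fun t : R => complex.Im (comp_exp nu B (t *: a : dual U) setT)).
Proof.
have dom (t t0 : R) (u : borelType U) : (`]t0 - 1, t0 + 1[%classic : set R) t ->
    comp_dom B (t *: a : dual U) u <= comp_dom B ((`|t0| + 1) *: a : dual U) u.
  rewrite /= in_itv/= => /andP[h1 h2]; rewrite /comp_dom lerD2r ler_wpM2l//.
  rewrite ler_wpM2r//.
  change ((t * a u) ^+ 2 <= ((`|t0| + 1) * a u) ^+ 2).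
  rewrite !exprMn ler_wpM2r ?sqr_ge0// -(real_normK (num_real t)).
  rewrite lerXn2r ?nnegrE ?addr_ge0//.
  rewrite -[t](subrK t0) addrC; apply: le_trans (ler_normD _ _) _.
  by rewrite lerD2l ler_norml; apply/andP; split; lra.
have mem (t0 : R) : t0 \in (`]t0 - 1, t0 + 1[%classic : set R).
  by rewrite inE /= in_itv/=; apply/andP; split; lra.
have scale_cont u : continuous (fun t : R => (t *: a : dual U) u : R).
  move=> t; rewrite (_ : (fun t : R => _) = (fun t : R => t * a u))//.
  by apply: cvgM; [exact: cvg_id|exact: cvg_cst].
split=> t0.
- have C := @continuity_under_integral R _ (borelType U) nu
    (fun t => @comp_re _ (borelType U) R (t *: a : dual U)) setT measurableT (t0 - 1) (t0 + 1).
  apply: (C _ _ _ (integrable_comp_dom mB nuBC (aU ((`|t0| + 1) *: a))) _ _ (mem t0)).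
  + by move=> t _; exact: (integrable_comp_re mB nuBC (aU (t *: a))).
  + apply: aeW => u _ t _; apply: cvgB; last exact: cvg_cst.
    by apply: continuous_cvg; [exact: continuous_cos|exact: scale_cont].
  + move=> t It; apply: aeW => u _; apply: le_trans (dom _ _ u It).
    exact: comp_re_dom.
- have C := @continuity_under_integral R _ (borelType U) nu
    (fun t => @comp_im _ (borelType U) R B (t *: a : dual U)) setT measurableT (t0 - 1) (t0 + 1).
  apply: (C _ _ _ (integrable_comp_dom mB nuBC (aU ((`|t0| + 1) *: a))) _ _ (mem t0)).
  + by move=> t _; exact: (integrable_comp_im mB nuBC (aU (t *: a))).
  + apply: aeW => u _ t _; apply: cvgB.
      by apply: continuous_cvg; [exact: continuous_sin|exact: scale_cont].
    by apply: cvgM; [exact: scale_cont|exact: cvg_cst].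
  + move=> t It; apply: aeW => u _; apply: le_trans (dom _ _ u It).
    exact: comp_im_dom.
Qed.

Lemma comp_exp_dual0 : comp_exp nu B (0 : dual U) setT = 0.
Proof.
rewrite /comp_exp /comp_re /comp_im.
have I0 : \int[nu]_(u in setT) (0 : R) = 0 by rewrite /Rintegral integral0.
congr Complex; rewrite -[RHS]I0; apply: eq_Rintegral => u _.
  by rewrite (_ : (0 : dual U) u = 0)// cos0 subrr.
by rewrite (_ : (0 : dual U) u = 0)// sin0 mul0r subrr.
Qed.

Lemma truncation_sin (h : R -> R) : truncation_function h ->
  exists C : R, forall s, `|sin s - h s| <= C * cap s.
Proof.
move=> [[M hM] mh /nbhs_ballP[d /= d0 hd]].
have M0 : 0 <= M by apply: le_trans (hM 0).
pose e : R := Num.min d 1.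
have e0 : 0 < e by rewrite lt_min d0 ltr01.
have e1 : e <= 1 by rewrite /e ge_min lexx orbT.
have q0 : 0 <= (1 + M) / e ^+ 2 by rewrite divr_ge0 ?addr_ge0 ?sqr_ge0.
exists (2 + (1 + M) / e ^+ 2) => s; have s0 := normr_ge0 s.
have [se|es] := ltP `|s| e.
  have -> : h s = s.
    apply: hd; rewrite -ball_normE /= sub0r normrN.
    by apply: lt_le_trans se _; rewrite /e ge_min lexx.
  apply: le_trans (sin_sub_id_le s) _.
  have s1 : `|s| ^+ 2 <= 1 by rewrite expr_le1// ltW// (lt_le_trans se).
  rewrite /cap (min_idPl s1) (real_normK (num_real s)) ler_wpM2r ?sqr_ge0//.
  by rewrite lerDl.
have es2 : e ^+ 2 <= cap s.
  rewrite /cap le_min; apply/andP; split; last by rewrite expr_le1// ltW.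
  by rewrite lerXn2r ?nnegrE// ltW.
have h1 : `|sin s - h s| <= 1 + M.
  apply: le_trans (ler_normB _ _) _; apply: lerD (hM s).
  by rewrite ler_norml sin_geN1 sin_le1.
apply: le_trans h1 _; rewrite mulrDl.
have : 1 + M <= (1 + M) / e ^+ 2 * cap s.
  rewrite mulrAC ler_pdivlMr ?exprn_gt0//.
  by rewrite ler_wpM2l// addr_ge0.
by have := cap_ge0 s; lra.
Qed.

Lemma drift_exponent (h : R -> R) a : truncation_function h ->
  'i%C * (drift h nu a)%:C - (2^-1 * 0)%:C +
    cintegral nu (fun u => psi_trunc h (a u)) = comp_exp nu B a setT.
Proof.
move=> hh; have [C hC] := truncation_sin hh; have [_ mh _] := hh.
have ma : measurable_fun setT (a : borelType U -> R) := measurable_dual a.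
have mha : measurable_fun setT (fun u : borelType U => h (a u)) by exact: measurableT_comp.
have msh : measurable_fun setT (fun u : borelType U => sin (a u) - h (a u)).
  by apply: measurable_funB => //; exact: (bdd_sin ma).1.
have ish : nu.-integrable setT (EFin \o (fun u : borelType U => sin (a u) - h (a u))).
  exact: (integrable_le_cap nuL msh (fun u => hC (a u))).
have iim := integrable_comp_im mB nuBC (aU a).
have E1 : cintegral nu (fun u => psi_trunc h (a u)) =
    (\int[nu]_u @comp_re _ (borelType U) R a u) +i* (\int[nu]_u (sin (a u) - h (a u))).
  rewrite /cintegral; congr (fine _ +i* fine _); apply: eq_integral => u _;
    by rewrite /psi_trunc cexp_i /comp_re /=; congr EFin; ring.
have E2 : drift h nu a = \int[nu]_u @comp_im _ (borelType U) R B a u - \int[nu]_u (sin (a u) - h (a u)).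
  rewrite /drift -RintegralB//; apply: eq_Rintegral => u _.
  by rewrite /comp_im; ring.
rewrite E1 E2 /comp_exp mulr0; simpc; congr (_ +i* _); ring.
Qed.

End exponents.

Section tuple_norm.
Context {R : realType} {n : nat}.
Implicit Types x : n.-tuple R.

Lemma tnorm_sqr x : tnorm x ^+ 2 = \sum_i tnth x i ^+ 2.
Proof.
rewrite /tnorm sqr_sqrtr; last by apply: sumr_ge0 => i _; rewrite -expr2 sqr_ge0.
by apply: eq_bigr => i _; rewrite expr2.
Qed.

Lemma le_tnth_tnorm x i : `|tnth x i| <= tnorm x.
Proof.
rewrite -(ler_pXn2r (n := 2)) ?nnegrE ?sqrtr_ge0// tnorm_sqr (real_normK (num_real _)).
by rewrite (bigD1 i)//= lerDl sumr_ge0// => j _; exact: sqr_ge0.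
Qed.

Lemma min_tnorm_cap x : Num.min (tnorm x ^+ 2) 1 <= \sum_i cap (tnth x i).
Proof.
have c0 i : 0 <= cap (tnth x i) by exact: cap_ge0.
have [/existsP[i xi]|] := boolP [exists i, 1 <= `|tnth x i| ^+ 2].
  apply: (@le_trans _ _ 1); first by rewrite ge_min lexx orbT.
  rewrite (bigD1 i)//= {1}/cap (min_idPr xi) lerDl.
  by apply: sumr_ge0 => j _; exact: c0.
rewrite negb_exists => /forallP x1.
rewrite ge_min; apply/orP; left; rewrite tnorm_sqr; apply: ler_sum => i _.
have := x1 i; rewrite -ltNge => /ltW xi.
by rewrite /cap (min_idPl xi) (real_normK (num_real _)).
Qed.

Lemma measurable_tnorm : measurable_fun setT (@tnorm R n).
Proof.
have m : measurable_fun setT (fun x : n.-tuple R => tdot x x).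
  by apply: measurable_sum => i; apply: measurable_funM; exact: measurable_tnth.
apply: (measurableT_comp _ m); apply: continuous_measurable_fun.
exact: sqrt_continuous.
Qed.

Lemma tnorm_eq0 x : (tnorm x == 0) = (x == tzero).
Proof.
apply/eqP/eqP => [x0|->].
  apply: eq_from_tnth => i; rewrite tnth_mktuple; apply/eqP.
  by rewrite -normr_le0 -x0 le_tnth_tnorm.
by rewrite /tnorm tdot0l sqrtr0.
Qed.

Lemma measurable_tzero : measurable [set (tzero : n.-tuple R)].
Proof.
rewrite (_ : [set _] = @tnorm R n @^-1` [set 0]).
  by rewrite -[X in measurable X]setTI; apply: measurable_tnorm.
apply/seteqP; split => x /=.
  by move=> ->; apply/eqP; rewrite tnorm_eq0.
by move=> /eqP; rewrite tnorm_eq0 => /eqP.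
Qed.

End tuple_norm.

Section Levy_measure.
Context {R : realType} (U : normedModType R).
Variable nu : {measure set (borelType U) -> \bar R}.
Hypotheses (nuBC : (nu (~` unit_ball U) < +oo)%E) (nuL : Levy_finite nu).
Variables (n : nat) (c : n.-tuple (dual U)).
Local Open Scope complex_scope.

Let B : set (borelType U) := unit_ball U.
Let mB : measurable B := @measurable_unit_ball R U.
Let aU (a : dual U) : adm nu B a := adm_dual a nuL.
Let proj : borelType U -> n.-tuple R := cyl_proj c.
Let mproj : measurable_fun setT proj := measurable_cyl_proj c.
Let D : set (borelType U) := ~` (proj @^-1` [set tzero]).

Let mD : measurable D.
Proof.
apply: measurableC; rewrite -[X in measurable X]setTI.
by apply: mproj => //; exact: measurable_tzero.
Qed.

Let lam := law (mrestr nu mD) mproj.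

Lemma Levy_measureE A : lam A = nu (proj @^-1` (A `\ tzero)).
Proof.
by rewrite /lam /law /pushforward /mrestr; congr (nu _).
Qed.

Let ind (u : borelType U) : R := \1_[set x : n.-tuple R | tnorm x <= 1] (proj u).

(* Summands of the difference between the two compensators. *)
Let beta i (u : borelType U) : R := tnth c i u * (ind u - \1_B u).

Let dom (u : borelType U) : R := (\sum_i cap (tnth c i u)) + \1_(~` B) u.

Let projE u i : tnth (proj u) i = tnth c i u.
Proof. by rewrite /proj /cyl_proj tnth_mktuple. Qed.

Let mind : measurable_fun setT ind.
Proof.
apply: (measurableT_comp _ mproj); apply: measurable_indic.
rewrite (_ : [set x | _] = @tnorm R n @^-1` `]-oo, 1]); last first.
  by apply/seteqP; split => x; rewrite /= in_itv.
by rewrite -[X in measurable X]setTI; apply: measurable_tnorm.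
Qed.

Let int_sumcap : nu.-integrable setT (EFin \o (fun u : borelType U => \sum_i cap (tnth c i u))).
Proof. by apply: (Rintegral_sum _).1 => i; exact: integrable_cap. Qed.

Let int_dom : nu.-integrable setT (EFin \o dom).
Proof.
rewrite (_ : _ \o _ = (EFin \o (fun u : borelType U => (\sum_i cap (tnth c i u))%R)) \+
  (fun u => (\1_(~` B) u)%:E))%E//.
apply: integrableD => //.
apply/integrableP; split; first exact/measurable_EFinP/measurable_indic/measurableC.
under eq_integral do rewrite gee0_abs ?lee_fin//.
by rewrite integral_indic ?setIT//; exact: measurableC.
Qed.

Let dom_ge0 u : 0 <= dom u.
Proof. by rewrite addr_ge0// sumr_ge0// => i _; exact: cap_ge0. Qed.

Let int_beta i : nu.-integrable setT (EFin \o beta i).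
Proof.
have := integrableZl measurableT (1 + `|tnth c i|) int_dom.
apply: le_integrable => //.
  apply/measurable_EFinP; apply: measurable_funM; first exact: measurable_dual.
  by apply: measurable_funB => //; exact: measurable_indic.
move=> u _; rewrite /= lee_fin [leRHS]ger0_norm; last first.
  by rewrite mulr_ge0// addr_ge0.
rewrite /beta /ind /dom; set x := proj u.
have s0 : 0 <= \sum_j cap (tnth c j u) by apply: sumr_ge0 => j _; exact: cap_ge0.
have n0 : 0 <= `|tnth c i| by [].
rewrite normrM !indicE.
have [xN|xN] := boolP (x \in [set x : n.-tuple R | tnorm x <= 1]);
  have [uB|uB] := pselect (B u).
- rewrite mem_set// memNset//= subrr normr0 mulr0 addr0.
  by rewrite mulr_ge0// addr_ge0.
- rewrite memNset// mem_set//= subr0 normr1 mulr1.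
  have h : `|tnth c i u| <= 1.
    by rewrite -projE; apply: le_trans (le_tnth_tnorm _ _) _; move: xN; rewrite inE.
  by nra.
- rewrite mem_set// memNset//= sub0r normrN normr1 mulr1 addr0.
  have h : `|tnth c i u| <= `|tnth c i|.
    apply: le_trans (dual_le _ _) _; rewrite ler_piMr//.
  have x1 : 1 <= tnorm x.
    by move/negP: xN; rewrite inE /= => /negP; rewrite -ltNge => /ltW.
  have h2 : 1 <= \sum_j cap (tnth c j u).
    have := min_tnorm_cap x; rewrite (min_idPr _); last first.
      by rewrite expr_ge1// sqrtr_ge0.
    by under eq_bigr do rewrite projE.
  by nra.
- rewrite memNset// mem_set//= subrr normr0 mulr0.
  by rewrite mulr_ge0 ?addr_ge0.
Qed.

Let comb (t : n.-tuple R) : dual U := \sum_(i < n) tnth t i *: tnth c i.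

Let combE t (u : borelType U) : comb t u = \sum_i tnth t i * tnth c i u.
Proof.
have -> : comb t u = val (comb t) u by [].
rewrite /comb; elim/big_ind2 : _ => //= x1 y1 x2 y2 <- <-.
by [].
Qed.

Let tdotE t u : tdot t (proj u) = comb t u.
Proof. by rewrite combE; apply: eq_bigr => i _; rewrite projE. Qed.

Lemma Levy_measure_cyl (m : set (n.-tuple R) -> \bar R) :
  (forall t, cintegral m (fun x => cexp ('i%C * (tdot t x)%:C)) =
     cexp (comp_exp nu B (\sum_(i < n) tnth t i *: tnth c i : dual U) setT)) ->
  exists lam : {measure set (n.-tuple R) -> \bar R}, Levy_measure_of m lam /\
    forall A, measurable A -> lam A = nu (cyl_proj c @^-1` (A `\ tzero)).
Proof.
move=> mchf; exists lam; split; last by move=> A _; exact: Levy_measureE.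
split.
- transitivity (nu (proj @^-1` ([set tzero] `\ tzero))); first exact: Levy_measureE.
  by rewrite setDv preimage_set0 measure0.
- have mt : measurable_fun setT (fun x : n.-tuple R => (Num.min (tnorm x ^+ 2) 1)%:E).
    apply/measurable_EFinP; apply: measurable_minr => //.
    by apply: measurable_funX; exact: measurable_tnorm.
  have t0 x : (0 <= (Num.min (tnorm x ^+ 2) 1 : R)%:E)%E.
    by rewrite lee_fin le_min ler01 sqr_ge0.
  rewrite (ge0_integral_law _ mproj)//.
  have mtp : measurable_fun setT (fun u : borelType U => (Num.min (tnorm (proj u) ^+ 2) 1)%:E).
    exact: (measurableT_comp mt mproj).
  rewrite ge0_integral_mrestr//.
  have := integral_fune_lt_pinfty measurableT int_sumcap.
  apply: le_lt_trans.
  apply: (@le_trans _ _ (\int[nu]_u (Num.min (tnorm (proj u) ^+ 2) 1)%R%:E)%E).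
    by apply: ge0_subset_integral => //; exact: measurable_funTS.
  apply: ge0_le_integral => //.
  + exact: (measurable_int _ int_sumcap).
  + move=> u _; rewrite lee_fin; apply: le_trans (min_tnorm_cap _) _.
    by under eq_bigr do rewrite projE.
- exists [tuple \int[nu]_u beta i u | i < n], 0; split.
  + by rewrite trmx0.
  + move=> t; rewrite big1// => i _; rewrite big1// => j _.
    by rewrite mxE mulr0 mul0r.
  + move=> t; rewrite mchf; congr cexp.
    rewrite [X in 2^-1 * X]big1; last first.
      by move=> i _; rewrite big1// => j _; rewrite mxE mulr0 mul0r.
    set a := comb t.
    have iim := integrable_comp_im mB nuBC (aU a).
    have [int_sb sumb] := Rintegral_sum (fun i => integrableZl measurableT (tnth t i) (int_beta i)).
    have mre : measurable_fun setT (fun x : n.-tuple R => cos (tdot t x) - 1).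
      by apply: measurable_funB => //; exact: (bdd_cos (measurable_tdot t)).1.
    have mim : measurable_fun setT (fun x : n.-tuple R =>
        sin (tdot t x) - tdot t x * \1_[set x | tnorm x <= 1] x).
      apply: measurable_funB; first exact: (bdd_sin (measurable_tdot t)).1.
      apply: measurable_funM; first exact: measurable_tdot.
      apply: measurable_indic.
      rewrite (_ : [set x | _] = @tnorm R n @^-1` `]-oo, 1]); last first.
        by apply/seteqP; split => x; rewrite /= in_itv.
      by rewrite -[X in measurable X]setTI; apply: measurable_tnorm.
    have ID (g : n.-tuple R -> R) : measurable_fun setT g -> g tzero = 0 ->
        \int[lam]_x g x = \int[nu]_u g (proj u).
      move=> mg g0; rewrite {1}/Rintegral integral_law//.
      have mgp : measurable_fun setT (fun u : borelType U => g (proj u)).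
        exact: (measurableT_comp mg mproj).
      rewrite -[LHS]/(\int[mrestr nu mD]_u g (proj u)) Rintegral_mrestr//.
      rewrite Rintegral_mkcond; apply: eq_Rintegral => u _; rewrite patchE.
      case: ifPn => //; rewrite notin_setE /D /= => /contrapT ->.
      by rewrite g0.
    have t0 : tdot t tzero = 0 by rewrite tdotC tdot0l.
    have E : cintegral lam (fun x => cexp ('i * (tdot t x)%:C) - 1
        - 'i * (tdot t x * \1_[set x | tnorm x <= 1] x)%:C) =
        (\int[nu]_u (cos (a u) - 1)) +i* (\int[nu]_u (sin (a u) - a u * ind u)).
      rewrite /cintegral; congr (_ +i* _).
        transitivity (\int[lam]_x (cos (tdot t x) - 1)).
          by congr fine; apply: eq_integral => x _; rewrite cexp_i /=; congr EFin; ring.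
        rewrite ID ?t0 ?cos0 ?subrr//.
        by apply: eq_Rintegral => u _; rewrite tdotE.
      transitivity (\int[lam]_x (sin (tdot t x) - tdot t x * \1_[set x | tnorm x <= 1] x)).
        by congr fine; apply: eq_integral => x _; rewrite cexp_i /=; congr EFin; ring.
      rewrite ID ?t0 ?sin0 ?mul0r ?subrr//.
      by apply: eq_Rintegral => u _; rewrite tdotE.
    rewrite E.
    have -> : tdot t [tuple \int[nu]_u beta i u | i < n] =
        \int[nu]_u \sum_i (tnth t i * beta i u).
      rewrite sumb; apply: eq_bigr => i _; rewrite tnth_mktuple RintegralZl//.
    have -> : \int[nu]_u (sin (a u) - a u * ind u) =
        \int[nu]_u comp_im B a u - \int[nu]_u \sum_i (tnth t i * beta i u).
      rewrite -RintegralB//; apply: eq_Rintegral => u _.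
      have -> : \sum_i (tnth t i * beta i u) = a u * (ind u - \1_B u).
        by rewrite /a combE mulr_suml; apply: eq_bigr => i _; rewrite /beta mulrA.
      by rewrite /comp_im; ring.
    rewrite /comp_exp mulr0; simpc; congr (_ +i* _); rewrite ?addr0//; ring.
Qed.

End Levy_measure.

(** * Characteristics of the cylindrical law *)

Section characteristics.
Context {R : realType} (U : normedModType R) (h : R -> R).
Hypothesis hh : truncation_function h.
Local Open Scope complex_scope.

Lemma cylindrical_law_of_characteristics (nu : set U -> \bar R)
    (nuL : cylindrical_Levy_measure nu)
    (nuB : {measure set (borelType U) -> \bar R})
    (nuBsf : sigma_finite [set: borelType U] nuB)
    (nuBE : forall Z : set U, cylinders [set: dual U] Z -> nuB Z = nu Z)
    (nuBfin : (nuB (~` unit_ball U) < +oo)%E) :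
  exists2 mu : set U -> \bar R, has_characteristics h (drift h nuB) (cst 0) nu mu
    & cylindrical_continuous mu.
Proof.
have nuE n (c : n.-tuple (dual U)) D : measurable D ->
    nu (cyl_proj c @^-1` D) = nuB (cyl_proj c @^-1` D).
  by move=> mD; rewrite nuBE//; exists n, c, D.
have nuE1 (a : dual U) D : measurable D -> nu (a @^-1` D) = law nuB (measurable_dual a) D.
  move=> mD; have E : a @^-1` D = cyl_proj [tuple a] @^-1` (tnth (T:=R) ^~ ord0 @^-1` D).
    by apply/funext => u; rewrite /preimage/= /cyl_proj tnth_mktuple.
  by rewrite [in LHS]E nuE -?E//; exact: measurable_tnth_preimage.
have nuBL : Levy_finite nuB.
  move=> a; have := nuL.2 a; rewrite (eq_integral_raw (m2 := law nuB (measurable_dual a))).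
    have mc : measurable_fun setT (fun s : R => (cap s)%:E).
      by apply/measurable_EFinP; exact: measurable_cap.
    have c0 (s : R) : (0 <= (cap s)%:E)%E by rewrite lee_fin cap_ge0.
    by rewrite (ge0_integral_law nuB (measurable_dual a) mc c0).
  by move=> D mD; exact: nuE1.
have [dO [V [Q [X [mX XD chfX Xs]]]]] := cylindrical_poisson nuBsf nuBfin nuBL.
have mpsi : measurable_fun setT (fun s => complex.Re (psi_trunc h s)) /\
    measurable_fun setT (fun s => complex.Im (psi_trunc h s)).
  have [_ mh _] := hh; have mid : measurable_fun setT (fun s : R => s) by [].
  split.
    rewrite (_ : (fun s => _) = (fun s : R => cos s - 1)); last first.
      by apply/funext => s; rewrite /psi_trunc cexp_i /=; ring.
    by apply: measurable_funB => //; exact: (bdd_cos mid).1.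
  rewrite (_ : (fun s => _) = (fun s : R => sin s - h s)); last first.
    by apply/funext => s; rewrite /psi_trunc cexp_i /=; ring.
  by apply: measurable_funB => //; exact: (bdd_sin mid).1.
have expE a : char_exponent h (drift h nuB) (cst 0) nu a =
    comp_exp nuB (unit_ball U) a setT.
  rewrite /char_exponent (cyl_cintegralE nuL.1 (@nuE1 a) mpsi.1 mpsi.2).
  by rewrite (cintegral_law _ _ mpsi.1 mpsi.2); exact: drift_exponent.
exists (cyl_law Q X); last first.
  move=> e e0; near=> a.
  rewrite (_ : [set u | _] = a @^-1` [set s : R | 1 <= `|s|])//.
  rewrite cyl_law1//; last by apply: measurable_le_normr.
  by near: a; exact: Xs.
split.
- split; first exact: cyl_law_probability.
  exact: (infinitely_divisible_cyl_law nuBsf).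
- split=> //; exists (fun _ _ => 0); split => //.
  by move=> a k x y /=; rewrite mulr0 addr0.
- exact: nuL.1.
- move=> n c.
  have [|lam [lamL lamE]] := Levy_measure_cyl nuBfin nuBL (c := c) (m := cyl_image (cyl_law Q X) c).
    move=> t; rewrite (eq_cintegral_raw (m2 := law Q (measurable_proc mX c))).
      by rewrite -/(chf _ _) chf_proc// chfX.
    by move=> D mD; rewrite /cyl_image cyl_lawE.
  exists lam; split => // D mD; rewrite lamE// /cyl_image nuE//.
  by apply: measurableD => //; exact: measurable_tzero.
- split.
  + by move=> a; rewrite expE char_fun_cyl_law// chfX.
  + by rewrite expE comp_exp_dual0.
  + move=> a; under eq_fun do rewrite expE.
    exact: (comp_exp_scale_continuous nuBfin nuBL a).1.
  + move=> a; under eq_fun do rewrite expE.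
    exact: (comp_exp_scale_continuous nuBfin nuBL a).2.
Unshelve. all: by end_near. Qed.

Lemma trivial_characteristics : exists2 mu : set U -> \bar R,
  has_characteristics h (cst 0) (cst 0) (cst 0%E) mu & cylindrical_continuous mu.
Proof.
pose z : {measure set (borelType U) -> \bar R} := mzero.
have E : drift h z = cst 0.
  by apply/funext => a; rewrite /drift /Rintegral integral_measure_zero.
have [||//||mu] := @cylindrical_law_of_characteristics (cst 0%E) _ z.
- split; first by move=> G _; exists mzero.
  move=> a; rewrite (eq_integral_raw (m2 := mzero))//.
  by rewrite integral_measure_zero.
- exists (fun=> setT); last by move=> n; split => //; exact: ltry.
  by apply/seteqP; split => // u _; exists 0%N.
- exact: ltry.
- by rewrite E; exists mu.
Qed.

End characteristics.

Theorem theorem5p1 (R : realType) (U : completeNormedModType R) (h : R -> R)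
    (hh : truncation_function h)
    (nu : set U -> \bar R) (nuL : cylindrical_Levy_measure nu)
    (nuB : {measure set (borelType U) -> \bar R})
    (nuBsf : sigma_finite [set: borelType U] nuB)
    (nuBE : forall Z : set U, cylinders [set: dual U] Z -> nuB Z = nu Z)
    (nuBfin : (nuB (~` unit_ball U) < +oo)%E) :
  exists mu : set U -> \bar R,
    has_characteristics h (drift h nuB) (cst 0) nu mu /\
    regularly_continuous h (drift h nuB) (cst 0) nu mu.
Proof.
have [mu muc mucont] := cylindrical_law_of_characteristics hh nuL nuBsf nuBE nuBfin.
exists mu; split => //; split => //; last by exists mu.
exact: trivial_characteristics.
Qed.
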